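(* Assume (A1), (A2), (A3). Then there exists a function $m(\mu,\varepsilon)$ with $$m(\mu,\varepsilon)=-1+\mathcal O(\varepsilon)\qquad(\varepsilon\to0^+)$$ uniformly for $\mu$ in any closed interval $I\subset(0,A(0)]$, such that for $\mu\in I$, $\lambda=i\mu$ is an eigenvalue of $L$ if and only if $$m(\mu,\varepsilon)\,e^{2iS(\mu)/\varepsilon}=1.$$
   Context: Let $\varepsilon>0$ be a small parameter. For $\rho,\theta>0$ set $D(\rho,\theta)=\{x\in\mathbb C:\ |\mathrm{Im}\,x|<\max(\rho,(\tan\theta)|\mathrm{Re}\,x|)\}$. (A1): $A:\mathbb R\to\mathbb R$ is positive and smooth, extends holomorphically to $D_0=D(\rho_0,\theta_0)$ for some $\rho_0,\theta_0>0$, and there is $\tau>0$ with $A(x)=\mathcal O(|x|^{-1-\tau})$ as $|x|\to\infty$ in $D_0$. (A2): $A(-x)=A(x)$ and $A'(x)<0$ for $x>0$. (A3): $A''(0)<0$. $L=\begin{pmatrix}-\frac{\varepsilon}{i}\frac{d}{dx} & -iA(x)\\ -iA(x) & \frac{\varepsilon}{i}\frac{d}{dx}\end{pmatrix}$; $\lambda\in\mathbb C$ is an eigenvalue if $Lu=\lambda u$ has a nonzero solution $u\in L^2(\mathbb R)^2$. For $0<\mu<A(0)$, let $x^*(\mu)>0$ be the unique positive solution of $A(x)=\mu$ (so $\pm x^*(\mu)$ are the only real solutions), and define the action $S(\mu)=\int_{-x^*(\mu)}^{x^*(\mu)}\sqrt{A(x)^2-\mu^2}\,dx$ (with $S(A(0))=0$).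 *)

(* Defs.v *)
From Stdlib Require Import Reals Lra.
Open Scope R_scope.

Definition Cplx := (R * R)%type.
Definition Re (z : Cplx) : R := fst z.
Definition Im (z : Cplx) : R := snd z.
Definition RtoC (x : R) : Cplx := (x, 0).
Definition Ci : Cplx := (0, 1).
Definition Czero : Cplx := (0, 0).
Definition Cone : Cplx := (1, 0).
Definition Cadd (z w : Cplx) : Cplx := (Re z + Re w, Im z + Im w).
Definition Copp (z : Cplx) : Cplx := (- Re z, - Im z).
Definition Csub (z w : Cplx) : Cplx := Cadd z (Copp w).
Definition Cmul (z w : Cplx) : Cplx :=
  (Re z * Re w - Im z * Im w, Re z * Im w + Im z * Re w).
Definition Cinv (z : Cplx) : Cplx :=
  (Re z / (Re z ^ 2 + Im z ^ 2), - Im z / (Re z ^ 2 + Im z ^ 2)).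
Definition Cdiv (z w : Cplx) : Cplx := Cmul z (Cinv w).
Definition Cnorm (z : Cplx) : R := sqrt (Re z ^ 2 + Im z ^ 2).
Definition Cexp (z : Cplx) : Cplx := (exp (Re z) * cos (Im z), exp (Re z) * sin (Im z)).

Definition Dom (rho theta : R) (z : Cplx) : Prop :=
  Rabs (Im z) < Rmax rho (tan theta * Rabs (Re z)).

Definition C_differentiable_at (F : Cplx -> Cplx) (z : Cplx) : Prop :=
  exists l : Cplx, forall e, 0 < e -> exists d, 0 < d /\
    forall h : Cplx, h <> Czero -> Cnorm h < d ->
      Cnorm (Csub (Cdiv (Csub (F (Cadd z h)) (F z)) h) l) < e.

Definition holomorphic_on (D : Cplx -> Prop) (F : Cplx -> Cplx) : Prop :=
  forall z, D z -> C_differentiable_at F z.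

Definition smooth_with_derivs (A : R -> R) (Dn : nat -> R -> R) : Prop :=
  Dn 0%nat = A /\ forall n x, derivable_pt_lim (Dn n) x (Dn (S n) x).

Definition hypA1 (A : R -> R) : Prop :=
  (forall x, 0 < A x) /\
  (exists Dn, smooth_with_derivs A Dn) /\
  exists rho0 theta0 tau : R, 0 < rho0 /\ 0 < theta0 /\ theta0 < PI / 2 /\ 0 < tau /\
    exists F : Cplx -> Cplx,
      holomorphic_on (Dom rho0 theta0) F /\
      (forall x : R, F (RtoC x) = RtoC (A x)) /\
      exists K R0 : R, 0 < R0 /\
        forall z, Dom rho0 theta0 z -> R0 <= Cnorm z ->
          Cnorm (F z) <= K * Rpower (Cnorm z) (- 1 - tau).

Definition hypA2 (A : R -> R) : Prop :=
  (forall x, A (- x) = A x) /\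
  forall Dn, smooth_with_derivs A Dn -> forall x, 0 < x -> Dn 1%nat x < 0.

Definition hypA3 (A : R -> R) : Prop :=
  forall Dn, smooth_with_derivs A Dn -> Dn 2%nat 0 < 0.

Definition Cderiv_R (u : R -> Cplx) (x : R) (d : Cplx) : Prop :=
  derivable_pt_lim (fun t => Re (u t)) x (Re d) /\
  derivable_pt_lim (fun t => Im (u t)) x (Im d).

(** (u1,u2) in L^2(R)^2 : the (continuous, nonnegative) integrand
    |u1|^2 + |u2|^2 has uniformly bounded integrals over [-a,a]. *)
Definition sq_integrable2 (u1 u2 : R -> Cplx) : Prop :=
  exists M : R, forall a : R, 0 <= a ->
    exists pr : Riemann_integrable
                  (fun x => Cnorm (u1 x) ^ 2 + Cnorm (u2 x) ^ 2) (- a) a,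
      RiemannInt pr <= M.

(** lam is an eigenvalue of
    L = [[ -(eps/i) d/dx , -i A ], [ -i A , (eps/i) d/dx ]] *)
Definition is_eigenvalue (A : R -> R) (eps : R) (lam : Cplx) : Prop :=
  exists u1 u2 u1' u2' : R -> Cplx,
    (forall x, Cderiv_R u1 x (u1' x) /\ Cderiv_R u2 x (u2' x)) /\
    (forall x,
       Cadd (Cmul (Copp (Cdiv (RtoC eps) Ci)) (u1' x))
            (Cmul (Copp Ci) (Cmul (RtoC (A x)) (u2 x)))
       = Cmul lam (u1 x) /\
       Cadd (Cmul (Copp Ci) (Cmul (RtoC (A x)) (u1 x)))
            (Cmul (Cdiv (RtoC eps) Ci) (u2' x))
       = Cmul lam (u2 x)) /\
    sq_integrable2 u1 u2 /\
    (exists x, u1 x <> Czero \/ u2 x <> Czero).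

(** * The action: [S_is A mu s] means s = S(mu) = int_{-xs}^{xs} sqrt(A^2-mu^2),
    where xs >= 0 solves A(xs) = mu (unique under (A2); xs = 0 when mu = A(0)). *)
Definition S_is (A : R -> R) (mu s : R) : Prop :=
  exists xs : R, 0 <= xs /\ A xs = mu /\
    exists pr : Riemann_integrable (fun x => sqrt (A x ^ 2 - mu ^ 2)) (- xs) xs,
      RiemannInt pr = s.

(* Main.v *)
(** The phase factor [m] is free pointwise, except that it must equal
    [e^(-2iS/eps)] when [i mu] is an eigenvalue, and differ from it otherwise.
    So it suffices that at an eigenvalue [e^(-2iS/eps) = -1 + O(eps)], i.e.
    [2S/pi = eps (2k + 1) + O(eps^2)] for some integer [k], uniformly in [mu >= a].

    An eigenfunction yields a decaying, even or odd solution of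
    [eps^2 w'' = (mu^2 - A^2 + O(eps^2)) w].  Langer's change of variable [xi],
    with [xi'^2 (E - xi^2) = A^2 - mu^2] and [E = 2S/pi], turns it into
    the harmonic oscillator up to an [O(eps^2)] error.  In the variable [t = x^2] the
    turning point [s = xs^2] is a simple singularity where the divided differences
    involved solve [(t - s) y' + a y = b] with [a >= 1], whose regular solution is bounded in
    terms of [b] alone; hence all bounds stay uniform as the two turning points [-xs] and [xs]
    coalesce.  Comparing zeros (Sturm) with Hermite functions of the same parity
    shows that [E] is within [O(eps^2)] of an odd multiple of [eps]. *)

From Stdlib Require Import Reals Lra Lia Classical ClassicalEpsilon.
From Coquelicot Require Import Coquelicot.
Require Import Defs.
Open Scope R_scope.

(** * Calculus on the line *)

(** Sturm's comparison is exact, so no asymptotic expansion of an eigenfunction is needed: the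
    potentials of the eigenfunction and of the transported oscillator at level [en] differ by
    [rho * (E - en) / eps^2] up to a bounded term, hence are ordered as soon as [E] is farther from
    [en] than a constant times [eps^2]. If [E] lay strictly between the levels [n] and [n + 1] of
    its parity, the eigenfunction would have at least [n + 1] positive zeros, and then level
    [n + 1], which has at most [n + 1], would have [n + 2]. Two obstacles shape the rest. Parity
    provides the boundary condition at [0], but Langer's variable is controlled on a bounded
    interval only; decay at infinity is therefore traded for the sign of a Wronskian at one point
    past the turning point. And [rho] with two derivatives must be bounded independently of [xs],
    although it is built from quotients of the form [0 / 0] at [xs], and [xs] may tend to [0]. Hence
    second derivatives in [t] are estimated with the weight [t], and the region where [t] is
    comparable to [s] is treated apart. *)

Lemma is_derive_continuous (f : R -> R) (x l : R) : is_derive f x l -> continuous f x.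
Proof. intros H; apply (ex_derive_continuous f x); exists l; exact H. Qed.

Lemma continuous_pt (f : R -> R) (x : R) : continuous f x <-> continuity_pt f x.
Proof. split; intros H; apply continuity_pt_filterlim; exact H. Qed.

Lemma mvt (f df : R -> R) (a b : R) : a < b ->
  (forall x, a <= x <= b -> continuous f x) ->
  (forall x, a < x < b -> is_derive f x (df x)) ->
  exists c, a < c < b /\ f b - f a = df c * (b - a).
Proof.
intros ab Hc Hd.
assert (pr1 : forall c, a < c < b -> derivable_pt f c).
{ intros c Hc'; exists (df c); apply is_derive_Reals; auto. }
assert (pr2 : forall c, a < c < b -> derivable_pt id c).
{ intros c _; apply derivable_pt_id. }
destruct (MVT f id a b pr1 pr2 ab) as [c [P E]].
- intros c H; apply continuous_pt; auto.
- intros c _; apply derivable_continuous_pt, derivable_pt_id.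
- exists c; split; [exact P|].
  assert (E1 : derive_pt f c (pr1 c P) = df c).
  { apply derive_pt_eq_0, is_derive_Reals; auto. }
  assert (E2 : derive_pt id c (pr2 c P) = 1).
  { apply derive_pt_eq_0, derivable_pt_lim_id. }
  rewrite E1, E2 in E; unfold id in E; lra.
Qed.

Lemma incr_strict (f df : R -> R) (a b : R) : a < b ->
  (forall x, a <= x <= b -> continuous f x) ->
  (forall x, a < x < b -> is_derive f x (df x)) ->
  (forall x, a < x < b -> 0 < df x) -> f a < f b.
Proof.
intros ab Hc Hd Hp; destruct (mvt f df a b ab Hc Hd) as [c [P E]].
specialize (Hp c P); nra.
Qed.

Lemma incr_weak (f df : R -> R) (a b : R) : a <= b ->
  (forall x, a <= x <= b -> continuous f x) ->
  (forall x, a < x < b -> is_derive f x (df x)) ->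
  (forall x, a < x < b -> 0 <= df x) -> f a <= f b.
Proof.
intros [ab|ab] Hc Hd Hp; [|rewrite ab; lra].
destruct (mvt f df a b ab Hc Hd) as [c [P E]].
specialize (Hp c P); nra.
Qed.

Lemma mvt_bound (f df : R -> R) (a b K : R) : a <= b ->
  (forall x, a <= x <= b -> continuous f x) ->
  (forall x, a < x < b -> is_derive f x (df x)) ->
  (forall x, a < x < b -> Rabs (df x) <= K) -> Rabs (f b - f a) <= K * (b - a).
Proof.
intros [ab|ab] Hc Hd Hp.
- destruct (mvt f df a b ab Hc Hd) as [c [P E]].
  rewrite E, Rabs_mult, (Rabs_pos_eq (b - a)) by lra.
  specialize (Hp c P); nra.
- rewrite ab, !Rminus_diag, Rabs_R0; lra.
Qed.

Lemma incr_strict_except (f df : R -> R) (a b s : R) : a < b ->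
  (forall x, a <= x <= b -> continuous f x) ->
  (forall x, a < x < b -> x <> s -> is_derive f x (df x)) ->
  (forall x, a < x < b -> x <> s -> 0 < df x) -> f a < f b.
Proof.
intros ab Hc Hd Hp.
destruct (Rle_lt_dec s a) as [H1|H1].
{ apply (incr_strict f df); auto; intros x Hx; [apply Hd|apply Hp]; lra. }
destruct (Rle_lt_dec b s) as [H2|H2].
{ apply (incr_strict f df); auto; intros x Hx; [apply Hd|apply Hp]; lra. }
apply Rlt_trans with (f s).
- apply (incr_strict f df); auto; intros x Hx; [apply Hc|apply Hd|apply Hp]; lra.
- apply (incr_strict f df); auto; intros x Hx; [apply Hc|apply Hd|apply Hp]; lra.
Qed.

(** * Limits and removable singularities *)

Lemma is_lim_R (f : R -> R) (x l : R) : is_lim f x l <->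
  forall e, 0 < e -> exists d, 0 < d /\ forall y, Rabs (y - x) < d -> y <> x -> Rabs (f y - l) < e.
Proof.
rewrite <- is_lim_spec; simpl; split.
- intros H e He; destruct (H (mkposreal e He)) as [d Hd]; exists d; split; [apply cond_pos|].
  intros y Hy N; apply Hd; auto.
- intros H e; destruct (H e (cond_pos e)) as [d [d0 Hd]]; exists (mkposreal d d0).
  intros y Hy N; apply Hd; auto.
Qed.

Lemma continuous_R (f : R -> R) (x : R) : continuous f x <->
  forall e, 0 < e -> exists d, 0 < d /\ forall y, Rabs (y - x) < d -> Rabs (f y - f x) < e.
Proof.
split.
- intros H e He. destruct (proj1 (filterlim_locally _ _) H (mkposreal e He)) as [d Hd].
  exists d; split; [apply cond_pos|]; intros y Hy; apply (Hd y Hy).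
- intros H; apply filterlim_locally; intros e.
  destruct (H e (cond_pos e)) as [d [d0 Hd]]; exists (mkposreal d d0).
  intros y Hy; apply Hd, Hy.
Qed.

Lemma is_derive_R (f : R -> R) (x l : R) : is_derive f x l <->
  forall e, 0 < e -> exists d, 0 < d /\ forall y, y <> x -> Rabs (y - x) < d ->
    Rabs (f y - f x - l * (y - x)) <= e * Rabs (y - x).
Proof.
rewrite is_derive_Reals; split.
- intros H e He; destruct (H e He) as [d Hd]; exists d; split; [apply cond_pos|].
  intros y N Hy. assert (N' : y - x <> 0) by lra.
  specialize (Hd (y - x) N' Hy). replace (x + (y - x)) with y in Hd by lra.
  replace (f y - f x - l * (y - x)) with (((f y - f x) / (y - x) - l) * (y - x)) by (field; lra).
  rewrite Rabs_mult; apply Rmult_le_compat_r; [apply Rabs_pos|lra].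
- intros H e He; destruct (H (e / 2)) as [d [d0 Hd]]; [lra|]; exists (mkposreal d d0).
  intros h N Hh; simpl in Hh. assert (N' : x + h <> x) by lra.
  specialize (Hd (x + h) N'). replace (x + h - x) with h in Hd by lra.
  specialize (Hd Hh).
  replace ((f (x + h) - f x) / h - l) with ((f (x + h) - f x - l * h) / h) by (field; lra).
  unfold Rdiv; rewrite Rabs_mult, Rabs_inv.
  assert (0 < Rabs h) by (apply Rabs_pos_lt; lra).
  apply Rle_lt_trans with (e / 2 * Rabs h * / Rabs h).
  + apply Rmult_le_compat_r; [left; apply Rinv_0_lt_compat; lra|lra].
  + field_simplify; lra.
Qed.

(** The mean value theorem on either side of [s] writes the difference quotient as a value of [g]
    near [s]. This recovers derivatives at the turning point, where the formulas defining them
    divide by [0]. *)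
Lemma is_derive_limit (f g : R -> R) (al s om l : R) : al < s < om ->
  continuous f s ->
  (forall x, al < x < om -> x <> s -> is_derive f x (g x)) ->
  is_lim g s l -> is_derive f s l.
Proof.
intros Hs Cs Hd Hl; apply is_derive_R; intros e He.
destruct (proj1 (is_lim_R g s l) Hl e He) as [d [d0 Hd']].
exists (Rmin d (Rmin (s - al) (om - s))); split.
{ repeat apply Rmin_glb_lt; lra. }
intros y N Hy.
assert (H1 := Rmin_l d (Rmin (s - al) (om - s))).
assert (H2 := Rmin_r d (Rmin (s - al) (om - s))).
assert (H3 := Rmin_l (s - al) (om - s)).
assert (H4 := Rmin_r (s - al) (om - s)).
assert (Hy' : Rabs (y - s) < d /\ - (s - al) < y - s < om - s).
{ split; [lra|]. apply Rabs_def2 in Hy; lra. }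
destruct Hy' as [Y1 Y2].
assert (K : exists c, c <> s /\ Rabs (c - s) < d /\ f y - f s = g c * (y - s)).
{ destruct (Rlt_le_dec s y) as [L|L].
  - destruct (mvt f g s y L) as [c [P E]].
    + intros x [[Hx|Hx] Hx2]; [|rewrite <- Hx; exact Cs].
      apply is_derive_continuous with (g x), Hd; lra.
    + intros x Hx; apply Hd; lra.
    + exists c; repeat split; [lra| |lra].
      rewrite Rabs_pos_eq by lra; rewrite Rabs_pos_eq in Y1 by lra; lra.
  - assert (L' : y < s) by lra.
    destruct (mvt f g y s L') as [c [P E]].
    + intros x [Hx [Hx2|Hx2]]; [|rewrite Hx2; exact Cs].
      apply is_derive_continuous with (g x), Hd; lra.
    + intros x Hx; apply Hd; lra.
    + exists c; repeat split; [lra| |lra].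
      rewrite Rabs_left in Y1 |- * by lra; lra. }
destruct K as [c [Nc [Hc E]]].
rewrite E. replace (g c * (y - s) - l * (y - s)) with ((g c - l) * (y - s)) by ring.
rewrite Rabs_mult. apply Rmult_le_compat_r; [apply Rabs_pos|].
left; apply Hd'; auto.
Qed.

(** Fills a removable singularity: the symbols below are quotients that are meaningless at the
    turning point but have limits there. *)
Definition patch (f : R -> R) (s l x : R) : R := if Req_EM_T x s then l else f x.

Lemma patch_neq f s l x : x <> s -> patch f s l x = f x.
Proof. intros N; unfold patch; destruct (Req_EM_T x s); tauto. Qed.
Lemma patch_eq f s l : patch f s l s = l.
Proof. unfold patch; destruct (Req_EM_T s s); tauto. Qed.

Lemma locally_neq (s x : R) : x <> s -> locally x (fun y => y <> s).
Proof.
intros N. assert (H : 0 < Rabs (x - s)) by (apply Rabs_pos_lt; lra).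
exists (mkposreal _ H); intros y Hy E; subst y.
unfold ball in Hy; simpl in Hy; unfold AbsRing_ball, abs, minus, plus, opp in Hy; simpl in Hy.
replace (s + - x) with (-(x - s)) in Hy by ring; rewrite Rabs_Ropp in Hy; lra.
Qed.

Lemma patch_continuous f (s l : R) : is_lim f s l -> continuous (patch f s l) s.
Proof.
intros H; apply continuous_R; intros e He.
destruct (proj1 (is_lim_R f s l) H e He) as [d [d0 Hd]]; exists d; split; auto.
intros y Hy; rewrite patch_eq; unfold patch; destruct (Req_EM_T y s).
- rewrite Rminus_diag, Rabs_R0; lra.
- apply Hd; auto.
Qed.

Lemma patch_locally f s l x : x <> s -> locally x (fun y => f y = patch f s l y).
Proof.
intros N; generalize (locally_neq s x N); apply filter_imp; intros y Hy.
symmetry; apply patch_neq, Hy.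
Qed.

Lemma is_lim_ext_neq (f g : R -> R) (s l al om : R) : al < s < om ->
  (forall x, al < x < om -> x <> s -> f x = g x) -> is_lim f s l -> is_lim g s l.
Proof.
intros Hs E H; apply is_lim_R; intros e He.
destruct (proj1 (is_lim_R f s l) H e He) as [d [d0 Hd]].
exists (Rmin d (Rmin (s - al) (om - s))); split.
{ repeat apply Rmin_glb_lt; lra. }
intros y Hy N.
assert (H1 := Rmin_l d (Rmin (s - al) (om - s))).
assert (H2 := Rmin_r d (Rmin (s - al) (om - s))).
assert (H3 := Rmin_l (s - al) (om - s)).
assert (H4 := Rmin_r (s - al) (om - s)).
rewrite <- E; auto; [apply Hd; auto; lra|].
apply Rabs_def2 in Hy; lra.
Qed.

Lemma patch_derive f g (s l l1 al om : R) : al < s < om ->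
  (forall x, al < x < om -> x <> s -> is_derive f x (g x)) ->
  is_lim f s l -> is_lim g s l1 ->
  forall x, al < x < om -> is_derive (patch f s l) x (patch g s l1 x).
Proof.
intros Hs Hd Hf Hg x Hx.
assert (K : forall y, al < y < om -> y <> s -> is_derive (patch f s l) y (patch g s l1 y)).
{ intros y Hy N; rewrite (patch_neq g) by auto.
  apply is_derive_ext_loc with f; [apply patch_locally, N|auto]. }
destruct (Req_EM_T x s) as [->|N]; [|auto].
apply is_derive_limit with (patch g s l1) al om; auto.
- apply patch_continuous; auto.
- rewrite patch_eq. apply is_lim_ext_neq with g al om; auto.
  intros y _ N; rewrite patch_neq; auto.
Qed.

Lemma is_lim_bound (f : R -> R) (s l K al om : R) : al < s < om ->
  (forall x, al < x < om -> x <> s -> Rabs (f x) <= K) -> is_lim f s l -> Rabs l <= K.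
Proof.
intros Hs B H. destruct (Rle_lt_dec (Rabs l) K) as [|C]; auto; exfalso.
destruct (proj1 (is_lim_R f s l) H (Rabs l - K)) as [d [d0 Hd]]; [lra|].
assert (M : 0 < Rmin d (om - s)) by (apply Rmin_glb_lt; lra).
assert (H1 := Rmin_l d (om - s)). assert (H2 := Rmin_r d (om - s)).
set (y := s + Rmin d (om - s) / 2).
assert (Y : Rabs (f y - l) < Rabs l - K).
{ apply Hd; unfold y; [|lra].
  replace (s + _ / 2 - s) with (Rmin d (om - s) / 2) by ring; rewrite Rabs_pos_eq; lra. }
assert (Y2 : Rabs (f y) <= K) by (apply B; unfold y; lra).
assert (T := Rabs_triang (f y) (l - f y)). replace (f y + (l - f y)) with l in T by ring.
rewrite Rabs_minus_sym in Y; lra.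
Qed.

(** * The equation [(t - s) y' + a y = b] near its singular point *)

(** With the integrating factor, [(t - s)^a * (y - B / a)] has derivative
    [(t - s)^(a - 1) * (b - B) <= 0], and it tends to [0] at [s] because [(t - s) * y] does and
    [a >= 1]. The limit hypothesis is what excludes the homogeneous solution [(t - s)^(-a)]. *)
Lemma rs_right_upper (a s t0 B : R) (y y1 b : R -> R) : 1 <= a -> s < t0 ->
  (forall t, s < t <= t0 -> is_derive y t (y1 t) /\ (t - s) * y1 t + a * y t = b t) ->
  (forall e, 0 < e -> exists d, 0 < d /\ forall t, s < t < s + d -> t <= t0 -> Rabs ((t - s) * y t) < e) ->
  (forall t, s < t < t0 -> b t <= B) -> y t0 <= B / a.
Proof.
intros Ha Ht Hd Hl Hb.
destruct (Rle_lt_dec (y t0) (B / a)) as [|C]; auto; exfalso.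
set (g := fun t => Rpower (t - s) a * (y t - B / a)).
assert (Dg : forall t, s < t <= t0 -> is_derive g t (Rpower (t - s) (a - 1) * (b t - B))).
{ intros t T; destruct (Hd t T) as [H1 H2]; unfold g, Rpower.
  assert (E : exp (a * ln (t - s)) = exp ((a - 1) * ln (t - s)) * (t - s)).
  { rewrite <- (exp_ln (t - s)) at 3 by lra. rewrite <- exp_plus; f_equal; ring. }
  apply is_derive_ext with (fun t => exp (a * ln (t - s)) * y t - exp (a * ln (t - s)) * (B / a)).
  { intros; simpl; ring. }
  evar_last.
  - apply (is_derive_minus (fun t => exp (a * ln (t - s)) * y t) (fun t => exp (a * ln (t - s)) * (B / a))).
    + apply (is_derive_mult (fun t => exp (a * ln (t - s))) y t); [|exact H1|intros; apply Rmult_comm].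
      auto_derive; [lra|reflexivity].
    + auto_derive; [lra|reflexivity].
  - unfold minus, plus, opp, mult; simpl.
    change (t + - s) with (t - s); rewrite <- H2, E; field; split; lra. }
assert (G0 : 0 < g t0).
{ unfold g; apply Rmult_lt_0_compat; [apply exp_pos|lra]. }
assert (Gm : forall t, s < t < t0 -> g t0 <= g t).
{ intros t T.
  assert (K : - g t <= - g t0).
  { apply (incr_weak (fun t => - g t) (fun t => - (Rpower (t - s) (a - 1) * (b t - B)))); [lra| | |].
    - intros x Hx; apply (continuous_opp g), is_derive_continuous with (Rpower (x - s) (a - 1) * (b x - B)), Dg; lra.
    - intros x Hx; apply (is_derive_opp g), Dg; lra.
    - intros x Hx. assert (0 < Rpower (x - s) (a - 1)) by apply exp_pos.
      assert (b x <= B) by (apply Hb; lra). nra. }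
  lra. }
destruct (Hl (g t0 / 2)) as [d [d0 Hd']]; [lra|].
set (K := Rabs (B / a) + 1). assert (K0 : 1 <= K) by (unfold K; assert (T := Rabs_pos (B / a)); lra).
(* At [t - s = m / 2] the terms [(t - s) * y] and [(t - s) * B / a] use up at most a half and a
   quarter of [g t0]; [m <= 1] keeps [(t - s)^(a - 1)] at most [1]. *)
set (m := Rmin (Rmin d (t0 - s)) (Rmin 1 (g t0 / (2 * K)))).
assert (M0 : 0 < m).
{ unfold m; repeat apply Rmin_glb_lt; try lra. apply Rdiv_lt_0_compat; lra. }
assert (M1 : m <= d) by (unfold m; eapply Rle_trans; [apply Rmin_l|apply Rmin_l]).
assert (M2 : m <= t0 - s) by (unfold m; eapply Rle_trans; [apply Rmin_l|apply Rmin_r]).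
assert (M3 : m <= 1) by (unfold m; eapply Rle_trans; [apply Rmin_r|apply Rmin_l]).
assert (M4 : m <= g t0 / (2 * K)) by (unfold m; eapply Rle_trans; [apply Rmin_r|apply Rmin_r]).
set (t := s + m / 2).
assert (T1 : s < t < t0) by (unfold t; lra).
specialize (Gm t T1).
assert (Y : Rabs ((t - s) * y t) < g t0 / 2) by (apply Hd'; unfold t; lra).
assert (E : g t = Rpower (t - s) (a - 1) * ((t - s) * (y t - B / a))).
{ unfold g. replace (Rpower (t - s) a) with (Rpower (t - s) (a - 1) * (t - s)); [ring|].
  rewrite <- (Rpower_1 (t - s)) at 2 by lra. rewrite <- Rpower_plus; f_equal; ring. }
assert (R1 : 0 < Rpower (t - s) (a - 1) <= 1).
{ split; [apply exp_pos|]. unfold Rpower. apply Rle_trans with (exp 0); [|rewrite exp_0; lra].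
  destruct (Rle_lt_or_eq_dec _ _ Ha) as [Q|Q].
  - left; apply exp_increasing. assert (ln (t - s) < 0).
    { rewrite <- ln_1; apply ln_increasing; unfold t; lra. } assert (0 < (a - 1) * - ln (t - s)) by (apply Rmult_lt_0_compat; lra). lra.
  - right; f_equal; rewrite <- Q; ring. }
assert (U : (t - s) * (y t - B / a) < g t0).
{ replace ((t - s) * (y t - B / a)) with ((t - s) * y t - (t - s) * (B / a)) by ring.
  assert (A1 := Rle_abs ((t - s) * y t)). assert (A2 := Rle_abs (- (B / a))). rewrite Rabs_Ropp in A2.
  assert (T2 : 0 < t - s <= m / 2) by (unfold t; lra).
  assert (- ((t - s) * (B / a)) <= (t - s) * K) by (unfold K; nra).
  assert ((t - s) * K <= g t0 / 4).
  { apply Rle_trans with (g t0 / (2 * K) / 2 * K); [apply Rmult_le_compat_r; lra|right; field; lra]. }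
  lra. }
rewrite E in Gm.
destruct (Rle_lt_dec ((t - s) * (y t - B / a)) 0); nra.
Qed.

Lemma rs_right (a s t0 b0 eta : R) (y y1 b : R -> R) : 1 <= a -> s < t0 ->
  (forall t, s < t <= t0 -> is_derive y t (y1 t) /\ (t - s) * y1 t + a * y t = b t) ->
  (forall e, 0 < e -> exists d, 0 < d /\ forall t, s < t < s + d -> t <= t0 -> Rabs ((t - s) * y t) < e) ->
  (forall t, s < t < t0 -> Rabs (b t - b0) <= eta) -> Rabs (y t0 - b0 / a) <= eta / a.
Proof.
intros Ha Ht Hd Hl Hb.
assert (H1 : y t0 <= (b0 + eta) / a).
{ apply (rs_right_upper a s t0 _ y y1 b); auto.
  intros t T; specialize (Hb t T); apply Rabs_le_between in Hb; lra. }
assert (H2 : - y t0 <= (- b0 + eta) / a).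
{ apply (rs_right_upper a s t0 _ (fun t => - y t) (fun t => - y1 t) (fun t => - b t)); auto.
  - intros t T; destruct (Hd t T) as [D E]; split; [apply (is_derive_opp y), D|lra].
  - intros e He; destruct (Hl e He) as [d [d0 Hd']]; exists d; split; auto.
    intros t T1 T2; replace ((t - s) * - y t) with (- ((t - s) * y t)) by ring.
    rewrite Rabs_Ropp; auto.
  - intros t T; specialize (Hb t T); apply Rabs_le_between in Hb; lra. }
apply Rabs_le; lra.
Qed.

(** The equation keeps its form under the reflection [t -> 2 * s - t], which reduces the left side
    of [s] to the right one. *)
Lemma rs_bound (a s t0 b0 eta al om : R) (y y1 b : R -> R) : 1 <= a ->
  al < s < om -> al < t0 < om -> t0 <> s ->
  (forall t, al < t < om -> t <> s -> is_derive y t (y1 t) /\ (t - s) * y1 t + a * y t = b t) ->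
  is_lim (fun t => (t - s) * y t) s 0 ->
  (forall t, Rmin s t0 < t < Rmax s t0 -> Rabs (b t - b0) <= eta) ->
  Rabs (y t0 - b0 / a) <= eta / a.
Proof.
intros Ha Hs H0 N Hd Hl Hb.
assert (Hl' := proj1 (is_lim_R _ _ _) Hl).
destruct (Rlt_le_dec s t0) as [L|L].
- apply (rs_right a s t0 b0 eta y y1 b); auto.
  + intros t T; apply Hd; lra.
  + intros e He; destruct (Hl' e He) as [d [d0 Hd']]; exists d; split; auto.
    intros t T1 T2; specialize (Hd' t); rewrite Rminus_0_r in Hd'; apply Hd'; [rewrite Rabs_pos_eq|]; lra.
  + intros t T; apply Hb; rewrite Rmin_left, Rmax_right; lra.
- assert (E : y t0 = (fun u => y (2 * s - u)) (2 * s - t0)) by (simpl; f_equal; ring).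
  rewrite E.
  apply (rs_right a s (2 * s - t0) b0 eta (fun u => y (2 * s - u)) (fun u => - y1 (2 * s - u)) (fun u => b (2 * s - u))); auto; [lra| | |].
  + intros t T; destruct (Hd (2 * s - t)) as [D Q]; [lra|lra|]. split; [|rewrite <- Q; ring].
    evar_last.
    * apply (is_derive_comp y (fun u => 2 * s - u)); [exact D|]. auto_derive; [auto|reflexivity].
    * unfold scal; simpl; unfold mult; simpl; ring.
  + intros e He; destruct (Hl' e He) as [d [d0 Hd']]; exists d; split; auto.
    intros t T1 T2; specialize (Hd' (2 * s - t)); rewrite Rminus_0_r in Hd'.
    replace ((t - s) * y (2 * s - t)) with (- ((2 * s - t - s) * y (2 * s - t))) by ring.
    rewrite Rabs_Ropp; apply Hd'; [rewrite Rabs_left|]; lra.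
  + intros t T; apply Hb; rewrite Rmin_right, Rmax_left; lra.
Qed.

Lemma rs_lim (a s b0 al om : R) (y y1 b : R -> R) : 1 <= a ->
  al < s < om ->
  (forall t, al < t < om -> t <> s -> is_derive y t (y1 t) /\ (t - s) * y1 t + a * y t = b t) ->
  is_lim (fun t => (t - s) * y t) s 0 ->
  is_lim b s b0 -> is_lim y s (b0 / a).
Proof.
intros Ha Hs Hd Hl Hb; apply is_lim_R; intros e He.
destruct (proj1 (is_lim_R _ _ _) Hb (e * a / 2)) as [d [d0 Hd']]; [nra|].
exists (Rmin d (Rmin (s - al) (om - s))); split.
{ repeat apply Rmin_glb_lt; lra. }
intros t Ht N.
assert (H1 := Rmin_l d (Rmin (s - al) (om - s))).
assert (H2 := Rmin_r d (Rmin (s - al) (om - s))).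
assert (H3 := Rmin_l (s - al) (om - s)).
assert (H4 := Rmin_r (s - al) (om - s)).
assert (T : al < t < om) by (apply Rabs_def2 in Ht; lra).
apply Rle_lt_trans with ((e * a / 2) / a).
- apply (rs_bound a s t b0 (e * a / 2) al om y y1 b); auto.
  intros u U. left; apply Hd'.
  + apply Rabs_def2 in Ht. apply Rabs_def1; unfold Rmin, Rmax in U; destruct (Rle_dec s t); lra.
  + unfold Rmin, Rmax in U; destruct (Rle_dec s t); lra.
- field_simplify; lra.
Qed.

Section RegularSingular.

Variables (a s al om : R) (y b b' : R -> R).
Hypothesis a1 : 1 <= a.
Hypothesis Hs : al < s < om.
Let y1 t := (b t - a * y t) / (t - s).
Hypothesis Hd : forall t, al < t < om -> t <> s -> is_derive y t (y1 t).
Hypothesis Hl : is_lim (fun t => (t - s) * y t) s 0.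
Hypothesis Hb : forall t, al < t < om -> t <> s -> is_derive b t (b' t).
Variable b0 : R.
Hypothesis Hb0 : is_lim b s b0.

Lemma rs_y_lim : is_lim y s (b0 / a).
Proof.
apply (rs_lim a s b0 al om y y1 b); auto.
intros t T N; split; auto. unfold y1; field; lra.
Qed.

(** Differentiating the equation reproduces it with [a + 1] and [b'] in place of [a] and [b], so the
    estimates can be iterated to higher derivatives of [y]. *)
Lemma rs_y1_derive t : al < t < om -> t <> s ->
  is_derive y1 t ((b' t - (a + 1) * y1 t) / (t - s)).
Proof.
intros T N; unfold y1.
evar_last.
- apply (is_derive_div (fun t => b t - a * y t) (fun t => t - s)).
  + apply (is_derive_minus b (fun t => a * y t)); [apply Hb; auto|].
    apply (is_derive_scal y t a), Hd; auto.
  + auto_derive; [auto|reflexivity].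
  + lra.
- unfold minus, plus, opp; simpl; unfold y1, scal; simpl; unfold mult; simpl. field; lra.
Qed.

(** Since [(t - s) * y1 = b - a * y] tends to [b0 - a * (b0 / a)], the regularity condition passes
    from [y] to its derivative. *)
Lemma rs_y1_lim0 : is_lim (fun t => (t - s) * y1 t) s 0.
Proof.
apply is_lim_ext_neq with (fun t => b t - a * y t) al om; auto.
{ intros t T N; unfold y1; field; lra. }
evar_last.
- apply (is_lim_minus b (fun t => a * y t) s b0 (a * (b0 / a))); [exact Hb0| |].
  + apply (is_lim_scal_l y a s (b0 / a)), rs_y_lim.
  + reflexivity.
- simpl; f_equal; field; lra.
Qed.

Lemma rs_y1_bound t K : al < t < om -> t <> s ->
  (forall r, Rmin s t < r < Rmax s t -> Rabs (b' r) <= K) -> Rabs (y1 t) <= K / (a + 1).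
Proof.
intros T N B.
replace (y1 t) with (y1 t - 0 / (a + 1)) by (field; lra).
apply (rs_bound (a + 1) s t 0 K al om y1 (fun t => (b' t - (a + 1) * y1 t) / (t - s)) b'); auto; [lra| |apply rs_y1_lim0|].
- intros u U M; split; [apply rs_y1_derive; auto|field; lra].
- intros u U; rewrite Rminus_0_r; auto.
Qed.

Lemma rs_y1_lim (b1 : R) : is_lim b' s b1 -> is_lim y1 s (b1 / (a + 1)).
Proof.
intros B.
apply (rs_lim (a + 1) s b1 al om y1 (fun t => (b' t - (a + 1) * y1 t) / (t - s)) b'); auto; [lra| |apply rs_y1_lim0].
intros u U M; split; [apply rs_y1_derive; auto|field; lra].
Qed.

End RegularSingular.

(** * Sturm comparison *)

Lemma continuous_Ropp (x : R) : continuous Ropp x.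
Proof. apply is_derive_continuous with (-1); auto_derive; auto; ring. Qed.

Lemma last_zero (f : R -> R) (a c : R) : a <= c ->
  (forall x, a <= x <= c -> continuous f x) -> f a = 0 -> f c <> 0 ->
  exists z, a <= z < c /\ f z = 0 /\ forall x, z < x <= c -> f x <> 0.
Proof.
intros ac Hc fa fc.
set (E := fun x => a <= x <= c /\ f x = 0).
destruct (completeness E) as [m [Hu Hl]].
{ exists c; intros x [Hx _]; lra. }
{ exists a; split; [lra|auto]. }
assert (Ma : a <= m) by (apply Hu; split; [lra|auto]).
assert (Mc : m <= c) by (apply Hl; intros x [Hx _]; lra).
assert (Fm : f m = 0).
{ apply NNPP; intros N.
  destruct (proj1 (continuous_R f m) (Hc m (conj Ma Mc)) (Rabs (f m))) as [d [d0 Hd]].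
  { apply Rabs_pos_lt; auto. }
  assert (B : m <= m - d / 2); [|lra].
  apply Hl; intros x [Hx Ex].
  destruct (Rle_lt_dec x (m - d / 2)) as [|L]; auto; exfalso.
  assert (x <= m) by (apply Hu; split; auto).
  assert (K := Hd x). rewrite Ex in K.
  replace (0 - f m) with (- f m) in K by ring; rewrite Rabs_Ropp in K.
  apply (Rlt_irrefl (Rabs (f m))), K, Rabs_def1; lra. }
exists m; split; [split; auto|split; auto].
- destruct Mc as [|E1]; auto. rewrite E1 in Fm; contradiction.
- intros x Hx Ex. assert (x <= m) by (apply Hu; split; [lra|auto]). lra.
Qed.

Lemma first_zero (f : R -> R) (c b : R) : c <= b ->
  (forall x, c <= x <= b -> continuous f x) -> f b = 0 -> f c <> 0 ->
  exists z, c < z <= b /\ f z = 0 /\ forall x, c <= x < z -> f x <> 0.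
Proof.
intros cb Hc fb fc.
destruct (last_zero (fun x => f (- x)) (- b) (- c)) as [z [Z1 [Z2 Z3]]].
- lra.
- intros x Hx; apply (continuous_comp Ropp f); [apply continuous_Ropp|].
  apply Hc; lra.
- rewrite Ropp_involutive; auto.
- rewrite Ropp_involutive; auto.
- exists (- z); split; [lra|split; auto].
  intros x Hx. specialize (Z3 (- x)); rewrite Ropp_involutive in Z3; apply Z3; lra.
Qed.

Lemma nonzero_sign (f : R -> R) (a b : R) :
  (forall x, a < x < b -> continuous f x) -> (forall x, a < x < b -> f x <> 0) ->
  (forall x, a < x < b -> 0 < f x) \/ (forall x, a < x < b -> 0 < - f x).
Proof.
intros Hc Hn.
destruct (classic (exists u, a < u < b /\ f u < 0)) as [[u [Hu Fu]]|N].
- right; intros x Hx; destruct (Rlt_le_dec (f x) 0) as [|L]; [lra|exfalso].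
  assert (Fx : 0 < f x) by (specialize (Hn x Hx); lra).
  destruct (Rtotal_order u x) as [L1|[L1|L1]].
  + destruct (Ranalysis5.IVT_interv f u x) as [z [Z1 Z2]]; auto.
    * intros w Hw; apply continuous_pt, Hc; lra.
    * apply (Hn z); auto; lra.
  + subst; lra.
  + destruct (Ranalysis5.IVT_interv (fun y => - f y) x u) as [z [Z1 Z2]]; auto; try lra.
    * intros w Hw; apply continuous_pt, (continuous_opp f), Hc; lra.
    * apply (Hn z); lra.
- left; intros x Hx; destruct (Rlt_le_dec 0 (f x)); auto; exfalso.
  apply N; exists x; split; auto. specialize (Hn x Hx); lra.
Qed.

Section Sturm.

Variables (f f1 g g1 K : R -> R) (s Xm : R).
Let W x := f1 x * g x - f x * g1 x.

(** [f] and [g] stand for solutions of second order equations whose potentials differ by [K]; only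
    the Wronskian is recorded. The exceptional point [s] is the turning point, where second
    derivatives are not controlled, and the last clause is the boundary condition at [0] that equal
    parity provides. *)
Definition sturm_pair (f f1 g g1 K : R -> R) (s Xm : R) :=
  (forall x, 0 < x < Xm -> is_derive f x (f1 x) /\ is_derive g x (g1 x) /\
     continuous f1 x /\ continuous g1 x) /\
  (forall x, 0 < x < Xm -> x <> s -> 0 < K x /\
     is_derive (fun x => f1 x * g x - f x * g1 x) x (K x * (f x * g x))) /\
  (forall e, 0 < e -> exists d, 0 < d /\ forall x, 0 < x < d ->
     Rabs (f1 x * g x - f x * g1 x) < e).

Lemma sturm_pair_W_continuous x : sturm_pair f f1 g g1 K s Xm -> 0 < x < Xm -> continuous W x.
Proof.
intros [H _] Hx; destruct (H x Hx) as [D1 [D2 [C1 C2]]].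
apply (continuous_minus (fun x => f1 x * g x) (fun x => f x * g1 x)).
- apply (continuous_mult f1 g); auto; eapply is_derive_continuous; eauto.
- apply (continuous_mult f g1); auto; eapply is_derive_continuous; eauto.
Qed.

(** The Wronskian increases strictly, yet is almost nonnegative near the left end and almost
    nonpositive near the right end. The ends are only approached, since at [0] the functions carry
    no information. *)
Lemma sturm_pos a b : sturm_pair f f1 g g1 K s Xm -> 0 <= a < b -> b <= Xm ->
  (forall x, a < x < b -> 0 < f x) -> (forall x, a < x < b -> 0 < g x) ->
  (forall e y, 0 < e -> a < y < b -> exists x, a < x < y /\ - e <= W x) ->
  (forall e y, 0 < e -> a < y < b -> exists x, y < x < b /\ W x <= e) -> False.
Proof.
intros S ab bX Pf Pg HL HR.
assert (In : forall x y, a < x -> x < y -> y < b -> W x < W y).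
{ intros x y H1 H2 H3.
  apply (incr_strict_except W (fun x => K x * (f x * g x)) x y s); auto.
  - intros z Hz; apply sturm_pair_W_continuous; auto; lra.
  - intros z Hz N; apply S; auto; lra.
  - intros z Hz N. assert (0 < K z) by (apply S; auto; lra).
    assert (0 < f z) by (apply Pf; lra). assert (0 < g z) by (apply Pg; lra).
    repeat apply Rmult_lt_0_compat; auto. }
set (x1 := a + (b - a) / 3). set (x2 := a + 2 * (b - a) / 3).
assert (I := In x1 x2 ltac:(unfold x1; lra) ltac:(unfold x1, x2; lra) ltac:(unfold x2; lra)).
assert (W1 : 0 <= W x1).
{ apply Rnot_lt_le; intros N. destruct (HL (- W x1) x1) as [x [Hx Wx]]; [lra|unfold x1; lra|].
  assert (W x < W x1) by (apply In; unfold x1 in *; lra). lra. }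
assert (W2 : W x2 <= 0).
{ apply Rnot_lt_le; intros N. destruct (HR (W x2) x2) as [x [Hx Wx]]; [lra|unfold x2; lra|].
  assert (W x2 < W x) by (apply In; unfold x2 in *; lra). lra. }
lra.
Qed.

End Sturm.

Lemma sturm_pair_opp_l f f1 g g1 K s Xm : sturm_pair f f1 g g1 K s Xm ->
  sturm_pair (fun x => - f x) (fun x => - f1 x) g g1 K s Xm.
Proof.
intros [H1 [H2 H3]]; split; [|split].
- intros x Hx; destruct (H1 x Hx) as [D1 [D2 [C1 C2]]]; refine (conj _ (conj _ (conj _ _))); auto.
  + apply (is_derive_opp f); auto.
  + apply (continuous_opp f1); auto.
- intros x Hx N; destruct (H2 x Hx N) as [P D]; split; auto.
  apply is_derive_ext with (fun x => - (f1 x * g x - f x * g1 x)); [intros; simpl; ring|].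
  replace (K x * (- f x * g x)) with (- (K x * (f x * g x))) by ring.
  apply (is_derive_opp (fun x => f1 x * g x - f x * g1 x)); auto.
- intros e He; destruct (H3 e He) as [d [d0 Hd]]; exists d; split; auto; intros x Hx.
  replace (- f1 x * g x - - f x * g1 x) with (- (f1 x * g x - f x * g1 x)) by ring.
  rewrite Rabs_Ropp; auto.
Qed.

Lemma sturm_pair_opp_r f f1 g g1 K s Xm : sturm_pair f f1 g g1 K s Xm ->
  sturm_pair f f1 (fun x => - g x) (fun x => - g1 x) K s Xm.
Proof.
intros [H1 [H2 H3]]; split; [|split].
- intros x Hx; destruct (H1 x Hx) as [D1 [D2 [C1 C2]]]; refine (conj _ (conj _ (conj _ _))); auto.
  + apply (is_derive_opp g); auto.
  + apply (continuous_opp g1); auto.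
- intros x Hx N; destruct (H2 x Hx N) as [P D]; split; auto.
  apply is_derive_ext with (fun x => - (f1 x * g x - f x * g1 x)); [intros; simpl; ring|].
  replace (K x * (f x * - g x)) with (- (K x * (f x * g x))) by ring.
  apply (is_derive_opp (fun x => f1 x * g x - f x * g1 x)); auto.
- intros e He; destruct (H3 e He) as [d [d0 Hd]]; exists d; split; auto; intros x Hx.
  replace (f1 x * - g x - f x * - g1 x) with (- (f1 x * g x - f x * g1 x)) by ring.
  rewrite Rabs_Ropp; auto.
Qed.

Definition sturm_left (f : R -> R) (Xm u : R) := u = 0 \/ (0 < u < Xm /\ f u = 0).
(** The inequality says that [f1 / f < g1 / g] at [v]. For two decaying functions it stands in for a
    zero of [f] at infinity. *)
Definition sturm_right (f f1 g g1 : R -> R) (Xm v : R) := 0 < v < Xm /\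
  (f v = 0 \/ (f1 v * g v - f v * g1 v) * (f v * g v) < 0).

Lemma zero_slope_right f (f1 : R -> R) a b : a < b -> is_derive f a (f1 a) -> f a = 0 ->
  (forall x, a < x < b -> 0 < f x) -> 0 <= f1 a.
Proof.
intros ab D Fa P; apply Rnot_lt_le; intros N.
destruct (proj1 (is_derive_R _ _ _) D (- f1 a / 2)) as [d [d0 Hd]]; [lra|].
set (m := Rmin d (b - a)). assert (0 < m) by (apply Rmin_glb_lt; lra).
assert (m <= d) by apply Rmin_l. assert (m <= b - a) by apply Rmin_r.
specialize (Hd (a + m / 2)). rewrite Fa in Hd.
replace (a + m / 2 - a) with (m / 2) in Hd by ring. rewrite (Rabs_pos_eq (m / 2)) in Hd by lra.
assert (Q : Rabs (f (a + m / 2) - 0 - f1 a * (m / 2)) <= - f1 a / 2 * (m / 2)) by (apply Hd; lra).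
assert (0 < f (a + m / 2)) by (apply P; lra).
apply Rabs_le_between in Q; nra.
Qed.

Lemma zero_slope_left f (f1 : R -> R) a b : a < b -> is_derive f b (f1 b) -> f b = 0 ->
  (forall x, a < x < b -> 0 < f x) -> f1 b <= 0.
Proof.
intros ab D Fb P.
assert (D' : is_derive (fun x => f (- x)) (- b) (- f1 b)).
{ evar_last.
  - apply (is_derive_comp f Ropp); [rewrite Ropp_involutive; exact D|].
    auto_derive; [auto|reflexivity].
  - unfold scal; simpl; unfold mult; simpl; ring. }
assert (0 <= - f1 b); [|lra].
replace (- f1 b) with ((fun x => - f1 (- x)) (- b)) by (rewrite Ropp_involutive; auto).
apply (zero_slope_right (fun x => f (- x)) (fun x => - f1 (- x)) (- b) (- a)); [lra| | |].
- cbv beta; rewrite Ropp_involutive; exact D'.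
- rewrite Ropp_involutive; auto.
- intros x Hx; apply P; lra.
Qed.

Lemma continuous_nonneg_left (g : R -> R) a b : a < b -> continuous g a ->
  (forall x, a < x < b -> 0 < g x) -> 0 <= g a.
Proof.
intros ab C P; apply Rnot_lt_le; intros N.
destruct (proj1 (continuous_R _ _) C (- g a)) as [d [d0 Hd]]; [lra|].
set (m := Rmin d (b - a)). assert (0 < m) by (apply Rmin_glb_lt; lra).
assert (m <= d) by apply Rmin_l. assert (m <= b - a) by apply Rmin_r.
specialize (Hd (a + m / 2)). replace (a + m / 2 - a) with (m / 2) in Hd by ring.
rewrite (Rabs_pos_eq (m / 2)) in Hd by lra.
assert (Q : Rabs (g (a + m / 2) - g a) < - g a) by (apply Hd; lra).
assert (0 < g (a + m / 2)) by (apply P; lra). apply Rabs_def2 in Q; lra.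
Qed.

Lemma continuous_nonneg_right (g : R -> R) a b : a < b -> continuous g b ->
  (forall x, a < x < b -> 0 < g x) -> 0 <= g b.
Proof.
intros ab C P. replace (g b) with (g (- - b)) by (rewrite Ropp_involutive; auto).
apply continuous_nonneg_left with (g := fun x => g (- x)) (b := - a); [lra| |].
- apply (continuous_comp Ropp g); [apply continuous_Ropp|].
  rewrite Ropp_involutive; auto.
- intros x Hx; apply P; lra.
Qed.

(** At a zero [a] of [f] the Wronskian is [f1 a * g a >= 0]; at the right end it is [<= 0], either
    by the slope of [f] at a zero or by the prescribed sign. *)
Lemma sturm_interval_pos f f1 g g1 K s Xm a b : sturm_pair f f1 g g1 K s Xm -> a < b ->
  sturm_left f Xm a -> sturm_right f f1 g g1 Xm b ->
  (forall x, a < x < b -> 0 < f x) -> (forall x, a < x < b -> 0 < g x) -> False.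
Proof.
intros S ab HL [Hb HR] Pf Pg.
assert (a0 : 0 <= a) by (destruct HL; lra).
apply (sturm_pos f f1 g g1 K s Xm a b); auto; try lra.
- intros e y He Hy; destruct HL as [->|[Ha Fa]].
  + destruct S as [_ [_ S]]; destruct (S e He) as [d [d0 Hd]].
    set (m := Rmin d y). assert (0 < m) by (apply Rmin_glb_lt; lra).
    assert (m <= d) by apply Rmin_l. assert (m <= y) by apply Rmin_r.
    exists (m / 2); split; [lra|].
    assert (Q := Hd (m / 2) ltac:(lra)); apply Rabs_def2 in Q; lra.
  + assert (C := sturm_pair_W_continuous f f1 g g1 K s Xm a S Ha). cbv beta in C.
    destruct (proj1 (continuous_R _ _) C e He) as [d [d0 Hd]].
    set (m := Rmin d (y - a)). assert (0 < m) by (apply Rmin_glb_lt; lra).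
    assert (m <= d) by apply Rmin_l. assert (m <= y - a) by apply Rmin_r.
    exists (a + m / 2); split; [lra|].
    assert (Q := Hd (a + m / 2)). replace (a + m / 2 - a) with (m / 2) in Q by ring.
    rewrite (Rabs_pos_eq (m / 2)) in Q by lra. specialize (Q ltac:(lra)).
    destruct S as [S _]; destruct (S a Ha) as [D1 [D2 [C1 C2]]].
    assert (0 <= f1 a) by (apply zero_slope_right with f b; auto).
    assert (0 <= g a) by (apply continuous_nonneg_left with b; auto; eapply is_derive_continuous; eauto).
    rewrite Fa in Q. apply Rabs_def2 in Q. assert (0 <= f1 a * g a) by (apply Rmult_le_pos; auto). lra.
- intros e y He Hy.
  assert (C := sturm_pair_W_continuous f f1 g g1 K s Xm b S Hb). cbv beta in C.
  destruct (proj1 (continuous_R _ _) C e He) as [d [d0 Hd]].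
  set (m := Rmin d (b - y)). assert (0 < m) by (apply Rmin_glb_lt; lra).
  assert (m <= d) by apply Rmin_l. assert (m <= b - y) by apply Rmin_r.
  exists (b - m / 2); split; [lra|].
  assert (Q := Hd (b - m / 2)). replace (b - m / 2 - b) with (- (m / 2)) in Q by ring.
  rewrite Rabs_Ropp, (Rabs_pos_eq (m / 2)) in Q by lra. specialize (Q ltac:(lra)).
  destruct S as [S _]; destruct (S b Hb) as [D1 [D2 [C1 C2]]].
  assert (0 <= f b) by (apply continuous_nonneg_right with a; auto; eapply is_derive_continuous; eauto).
  assert (0 <= g b) by (apply continuous_nonneg_right with a; auto; eapply is_derive_continuous; eauto).
  apply Rabs_def2 in Q.
  destruct HR as [Fb|HR].
  + assert (f1 b <= 0) by (apply zero_slope_left with f a; auto).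
    rewrite Fb in Q. assert (f1 b * g b <= 0) by nra. lra.
  +
    apply Rnot_lt_le; intros N. assert (0 <= f b * g b) by (apply Rmult_le_pos; auto). nra.
Qed.

Lemma sturm_interval f f1 g g1 K s Xm a b : sturm_pair f f1 g g1 K s Xm -> a < b ->
  sturm_left f Xm a -> sturm_right f f1 g g1 Xm b ->
  (forall x, a < x < b -> f x <> 0) -> exists z, a < z < b /\ g z = 0.
Proof.
intros S ab HL HR Nf; apply NNPP; intros NE.
assert (Ng : forall x, a < x < b -> g x <> 0).
{ intros x Hx E; apply NE; exists x; auto. }
assert (a0 : 0 <= a) by (destruct HL; lra).
assert (b0 : b < Xm) by (destruct HR; lra).
destruct (nonzero_sign f a b) as [Pf|Pf]; auto.
{ intros x Hx; apply is_derive_continuous with (f1 x), S; lra. }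
- destruct (nonzero_sign g a b) as [Pg|Pg]; auto.
  { intros x Hx; apply is_derive_continuous with (g1 x), S; lra. }
  + apply (sturm_interval_pos f f1 g g1 K s Xm a b); auto.
  + apply (sturm_interval_pos f f1 (fun x => - g x) (fun x => - g1 x) K s Xm a b); auto.
    * apply sturm_pair_opp_r, S.
    * destruct HR as [Hb HR]; split; auto. destruct HR; [left; auto|right; nra].
- destruct (nonzero_sign g a b) as [Pg|Pg]; auto.
  { intros x Hx; apply is_derive_continuous with (g1 x), S; lra. }
  + apply (sturm_interval_pos (fun x => - f x) (fun x => - f1 x) g g1 K s Xm a b); auto.
    * apply sturm_pair_opp_l, S.
    * destruct HL as [HL|[HL1 HL2]]; [left; auto|right; split; auto; lra].
    * destruct HR as [Hb HR]; split; auto. destruct HR; [left; lra|right; nra].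
  + apply (sturm_interval_pos (fun x => - f x) (fun x => - f1 x) (fun x => - g x) (fun x => - g1 x) K s Xm a b); auto.
    * apply sturm_pair_opp_l, sturm_pair_opp_r, S.
    * destruct HL as [HL|[HL1 HL2]]; [left; auto|right; split; auto; lra].
    * destruct HR as [Hb HR]; split; auto. destruct HR; [left; lra|right; nra].
Qed.

Lemma simple_zeros_nonzero f f1 (a b : R) : a < b ->
  (forall x, a < x < b -> is_derive f x (f1 x)) ->
  (forall x, a < x < b -> f x = 0 -> f1 x <> 0) -> exists c, a < c < b /\ f c <> 0.
Proof.
intros ab D N; apply NNPP; intros NE.
assert (Z : forall x, a < x < b -> f x = 0).
{ intros x Hx; apply NNPP; intros E; apply NE; exists x; auto. }
set (x := (a + b) / 2). assert (Hx : a < x < b) by (unfold x; lra).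
apply (N x Hx (Z x Hx)).
destruct (Req_dec (f1 x) 0) as [|E]; auto; exfalso.
destruct (proj1 (is_derive_R _ _ _) (D x Hx) (Rabs (f1 x) / 2)) as [d [d0 Hd]].
{ assert (0 < Rabs (f1 x)) by (apply Rabs_pos_lt; auto). lra. }
set (m := Rmin d (b - x)). assert (0 < m) by (apply Rmin_glb_lt; lra).
assert (m <= d) by apply Rmin_l. assert (m <= b - x) by apply Rmin_r.
specialize (Hd (x + m / 2)). rewrite (Z x Hx), (Z (x + m / 2)) in Hd by lra.
replace (x + m / 2 - x) with (m / 2) in Hd by ring. rewrite (Rabs_pos_eq (m / 2)) in Hd by lra.
replace (0 - 0 - f1 x * (m / 2)) with (- (f1 x * (m / 2))) in Hd by ring.
rewrite Rabs_Ropp, Rabs_mult, (Rabs_pos_eq (m / 2)) in Hd by lra.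
specialize (Hd ltac:(lra) ltac:(lra)).
assert (0 < Rabs (f1 x)) by (apply Rabs_pos_lt; auto). nra.
Qed.

(** [f] may vanish between [u] and [v]. Its zeros being simple, some [c] has [f c <> 0], and the
    nearest zeros on each side of [c], or else [u] and [v] themselves, bound an interval free of
    zeros of [f]. *)
Lemma sturm_between f f1 g g1 K s Xm u v : sturm_pair f f1 g g1 K s Xm -> u < v ->
  (forall x, 0 < x < Xm -> f x = 0 -> f1 x <> 0) ->
  sturm_left f Xm u -> sturm_right f f1 g g1 Xm v -> exists z, u < z < v /\ g z = 0.
Proof.
intros S uv N HL HR.
assert (u0 : 0 <= u) by (destruct HL; lra).
assert (v0 : v < Xm) by (destruct HR; lra).
assert (C : forall x, 0 < x < Xm -> continuous f x).
{ intros x Hx; apply is_derive_continuous with (f1 x), S; lra. }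
destruct (simple_zeros_nonzero f f1 u v uv) as [c [Hc Fc]].
{ intros x Hx; apply S; lra. }
{ intros x Hx; apply N; lra. }
assert (EL : exists u', u <= u' < c /\ sturm_left f Xm u' /\ forall x, u' < x <= c -> f x <> 0).
{ destruct (classic (exists z, u < z < c /\ f z = 0)) as [[z [Hz Fz]]|NE].
  - destruct (last_zero f z c) as [w [W1 [W2 W3]]]; auto; try lra.
    { intros x Hx; apply C; lra. }
    exists w; split; [lra|split; auto]. right; split; auto; lra.
  - exists u; split; [lra|split; auto]. intros x [X1 [X2|X2]] E; [|subst; auto].
    apply NE; exists x; split; auto. }
assert (ER : exists v', c < v' <= v /\ sturm_right f f1 g g1 Xm v' /\ forall x, c <= x < v' -> f x <> 0).
{ destruct (classic (exists z, c < z < v /\ f z = 0)) as [[z [Hz Fz]]|NE].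
  - destruct (first_zero f c z) as [w [W1 [W2 W3]]]; auto; try lra.
    { intros x Hx; apply C; lra. }
    exists w; split; [lra|split; auto]. split; [lra|left; auto].
  - exists v; split; [lra|split; auto]. intros x [[X1|X1] X2] E; [|subst; auto].
    apply NE; exists x; split; auto. }
destruct EL as [u' [U1 [U2 U3]]]. destruct ER as [v' [V1 [V2 V3]]].
destruct (sturm_interval f f1 g g1 K s Xm u' v') as [z [Z1 Z2]]; auto; try lra.
{ intros x Hx; destruct (Rle_lt_dec x c); [apply U3|apply V3]; lra. }
exists z; split; auto; lra.
Qed.

(** At least [n] zeros, chained from the largest down: the recursion moves only the right end, which
    suits both interlacing and Rolle. *)
Fixpoint has_zeros (f : R -> R) (a b : R) (n : nat) : Prop :=
  match n with
  | O => True
  | S n => exists z, a < z < b /\ f z = 0 /\ has_zeros f a z n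
  end.

Lemma has_zeros_mono f a b b' n : b <= b' -> has_zeros f a b n -> has_zeros f a b' n.
Proof.
destruct n; simpl; auto; intros Hb [z [Hz H]]; exists z; split; auto; lra.
Qed.

Lemma has_zeros_interlace_aux f g a b n z :
  (forall u v, f v = 0 -> a <= u < v -> v < b -> (u = a \/ f u = 0) -> exists w, u < w < v /\ g w = 0) ->
  a < z < b -> f z = 0 -> has_zeros f a z n -> has_zeros g a z (S n).
Proof.
intros H; revert z; induction n as [|n IH]; intros z Hz Fz Hn.
- destruct (H a z) as [w [W1 W2]]; auto; try lra. exists w; simpl; auto.
- destruct Hn as [z' [Z1 [Z2 Z3]]].
  destruct (H z' z) as [w [W1 W2]]; auto; try lra.
  exists w; split; [lra|split; auto].
  apply has_zeros_mono with z'; [lra|]. apply IH; auto; lra.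
Qed.

(** The point [0], the [n] zeros and [X] bound [n + 1] intervals, each containing a zero of [g]; the
    sign condition at [X] makes the last interval count. *)
Lemma sturm_count f f1 g g1 K s Xm X n : sturm_pair f f1 g g1 K s Xm -> 0 < X < Xm ->
  (forall x, 0 < x < Xm -> f x = 0 -> f1 x <> 0) ->
  (f1 X * g X - f X * g1 X) * (f X * g X) < 0 ->
  has_zeros f 0 X n -> has_zeros g 0 X (S n).
Proof.
intros S HX N HR Hn.
assert (B : forall u v, 0 <= u < v -> v <= X -> (u = 0 \/ f u = 0) -> (v = X \/ f v = 0) ->
  exists w, u < w < v /\ g w = 0).
{ intros u v Hu Hv Lu Lv. apply (sturm_between f f1 g g1 K s Xm u v); auto; try lra.
  - destruct (Req_dec u 0) as [|U]; [left; auto|right]. split; [lra|destruct Lu; tauto].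
  - split; [lra|]. destruct Lv as [->|]; auto. }
destruct n as [|n].
- destruct (B 0 X) as [w [W1 W2]]; auto; try lra. exists w; simpl; auto.
- destruct Hn as [z [Z1 [Z2 Z3]]].
  destruct (B z X) as [w [W1 W2]]; auto; try lra.
  exists w; split; [lra|split; auto].
  apply has_zeros_mono with z; [lra|].
  apply has_zeros_interlace_aux with f X; auto.
  intros u v Fv Huv Hv Fu; apply B; auto; lra.
Qed.

(** * Hermite functions *)

Lemma has_zeros_restrict f a b b' n :
  (forall z, a < z < b -> f z = 0 -> z < b') -> has_zeros f a b n -> has_zeros f a b' n.
Proof.
destruct n; simpl; auto; intros H [z [Hz [Fz Hn]]]; exists z; split; auto.
split; [lra|auto].
Qed.

Lemma has_zeros_ext f g a b n :
  (forall z, a < z < b -> f z = 0 -> g z = 0) -> has_zeros f a b n -> has_zeros g a b n.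
Proof.
revert b; induction n as [|n IH]; intros b H; simpl; auto.
intros [z [Hz [Fz Hn]]]; exists z; split; auto. split; auto.
apply IH; auto; intros w Hw; apply H; lra.
Qed.

Lemma rolle (f f1 : R -> R) a b : a < b -> (forall x, is_derive f x (f1 x)) ->
  f a = 0 -> f b = 0 -> exists c, a < c < b /\ f1 c = 0.
Proof.
intros ab D Fa Fb. destruct (mvt f f1 a b ab) as [c [Hc E]]; auto.
{ intros x _; apply is_derive_continuous with (f1 x); auto. }
exists c; split; auto. rewrite Fa, Fb in E. nra.
Qed.

Lemma has_zeros_derive_aux (f f1 : R -> R) a b n : (forall x, is_derive f x (f1 x)) ->
  f b = 0 -> has_zeros f a b n -> has_zeros f1 a b n.
Proof.
intros D; revert b; induction n as [|n IH]; intros b Fb; simpl; auto.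
intros [z [Hz [Fz Hn]]].
destruct (rolle f f1 z b) as [c [Hc Fc]]; auto; try lra.
exists c; split; [lra|split; auto]. apply has_zeros_mono with z; [lra|auto].
Qed.

Lemma has_zeros_derive (f f1 : R -> R) a b n : (forall x, is_derive f x (f1 x)) ->
  has_zeros f a b (S n) -> has_zeros f1 a b n.
Proof.
intros D [z [Hz [Fz Hn]]]. apply has_zeros_mono with z; [lra|].
apply has_zeros_derive_aux with f; auto.
Qed.

(** The additional zero at the left end makes up for the one that Rolle would otherwise cost. *)
Lemma has_zeros_derive0 (f f1 : R -> R) a b n : (forall x, is_derive f x (f1 x)) ->
  f a = 0 -> has_zeros f a b n -> has_zeros f1 a b n.
Proof.
intros D Fa; revert b; induction n as [|n IH]; intros b; simpl; auto.
intros [z [Hz [Fz Hn]]].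
destruct n as [|n].
- destruct (rolle f f1 a z) as [c [Hc Fc]]; auto; try lra.
  exists c; simpl; split; auto; lra.
- destruct Hn as [z' [Hz' [Fz' Hn]]].
  destruct (rolle f f1 z' z) as [c [Hc Fc]]; auto; try lra.
  exists c; split; [lra|split; auto].
  apply IH. exists z'; split; [lra|auto].
Qed.

Fixpoint hermite (k : nat) (y : R) : R :=
  match k with
  | O => 1
  | S j => match j with
           | O => 2 * y
           | S i => 2 * y * hermite j y - 2 * INR j * hermite i y
           end
  end.

Definition hermite1 (k : nat) (y : R) : R :=
  match k with O => 0 | S j => 2 * INR k * hermite j y end.

Lemma hermite_rec k y : hermite (S k) y = 2 * y * hermite k y - hermite1 k y.
Proof. destruct k; simpl; [ring|reflexivity]. Qed.

Lemma hermite_derive k y : is_derive (hermite k) y (hermite1 k y).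
Proof.
enough (H : is_derive (hermite k) y (hermite1 k y) /\ is_derive (hermite (S k)) y (hermite1 (S k) y)) by tauto.
induction k as [|k [IH1 IH2]].
- split; simpl.
  + apply (is_derive_const 1).
  + auto_derive; [auto|simpl; ring].
- split; auto.
  apply is_derive_ext with (fun y => 2 * y * hermite (S k) y - 2 * INR (S k) * hermite k y); [reflexivity|].
  evar_last.
  + apply (is_derive_minus (fun y => 2 * y * hermite (S k) y) (fun y => 2 * INR (S k) * hermite k y)).
    * apply (is_derive_mult (fun y => 2 * y) (hermite (S k)) y).
      -- auto_derive; [auto|reflexivity].
      -- exact IH2.
      -- intros; apply Rmult_comm.
    * apply (is_derive_scal (hermite k) y (2 * INR (S k))), IH1.
  + unfold minus, plus, opp, mult, scal; cbn -[INR hermite hermite1]. unfold mult; cbn -[INR hermite hermite1].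
    assert (E := hermite_rec k y). unfold hermite1 at 1 3. rewrite E.
    rewrite !S_INR. ring.
Qed.

Lemma hermite1_derive k y : is_derive (hermite1 k) y (2 * y * hermite1 k y - 2 * INR k * hermite k y).
Proof.
destruct k as [|k].
- evar_last; [apply (is_derive_const 0)|]. unfold zero; simpl; ring.
- apply is_derive_ext with (fun y => 2 * INR (S k) * hermite k y); [reflexivity|].
  evar_last.
  + apply (is_derive_scal (hermite k) y (2 * INR (S k))), hermite_derive.
  + rewrite hermite_rec; cbn -[INR hermite]; unfold hermite1; ring.
Qed.

Lemma hermite_no_common k y : hermite k y = 0 -> hermite (S k) y = 0 -> False.
Proof.
induction k as [|k IH]; intros H0 H1; [simpl in H0; lra|].
apply IH; auto. rewrite hermite_rec, H0 in H1. unfold hermite1 in H1.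
assert (0 < INR (S k)) by (apply lt_0_INR; lia).
destruct (Rmult_integral (2 * INR (S k)) (hermite k y)); lra.
Qed.

(** In the three-term recursion the subtracted term is at most [(y - bt) * hermite (S k) y], because
    [2 * (k + 1) <= (y - bt) * (y + bt)]. After multiplication by the Gaussian, [bt] becomes a rate
    of decay. *)
Lemma hermite_growth (y bt : R) (k : nat) : 0 < y -> 0 <= bt -> 2 * INR k + bt ^ 2 <= y ^ 2 ->
  0 < hermite k y /\ (y + bt) * hermite k y <= hermite (S k) y.
Proof.
intros Hy Hb; induction k as [|k IH]; intros H.
- simpl in *. split; [lra|]. assert (bt <= y) by nra. lra.
- rewrite S_INR in H. destruct IH as [I1 I2]; [lra|].
  assert (P : 0 < hermite (S k) y) by (assert (0 < (y + bt) * hermite k y) by (apply Rmult_lt_0_compat; lra); lra).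
  split; auto.
  rewrite (hermite_rec (S k)); unfold hermite1. rewrite S_INR.
  assert (Q : 2 * (INR k + 1) * hermite k y <= (y - bt) * hermite (S k) y).
  { assert (0 <= INR k) by apply pos_INR. assert (bt <= y) by nra.
    apply Rle_trans with ((y - bt) * ((y + bt) * hermite k y)).
    - rewrite <- Rmult_assoc. apply Rmult_le_compat_r; nra.
    - apply Rmult_le_compat_l; lra. }
  lra.
Qed.

Lemma hermite1_bounds (y bt : R) (k : nat) : 0 < y -> 0 <= bt -> 2 * INR k + bt ^ 2 <= y ^ 2 ->
  0 <= hermite1 k y <= (y - bt) * hermite k y.
Proof.
intros Hy Hb H.
assert (H1 : 0 <= hermite1 k y).
{ destruct k as [|k]; simpl hermite1; [lra|].
  rewrite S_INR in H. destruct (hermite_growth y bt k) as [I1 I2]; auto; [lra|].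
  assert (0 <= INR (S k)) by apply pos_INR. change (0 <= 2 * INR (S k) * hermite k y). nra. }
split; auto.
destruct (hermite_growth y bt k) as [I1 I2]; auto. rewrite hermite_rec in I2. lra.
Qed.

Lemma hermite_parity n : hermite (2 * n + 1) 0 = 0 /\ hermite1 (2 * n) 0 = 0.
Proof.
assert (H : forall n, hermite (2 * n + 1) 0 = 0).
{ clear n; intros n; induction n as [|m IH]; [simpl; ring|].
  replace (2 * S m + 1)%nat with (S (S (2 * m + 1))) by lia.
  rewrite hermite_rec. unfold hermite1. rewrite IH. ring. }
split; auto. destruct n as [|n]; [reflexivity|].
replace (2 * S n)%nat with (S (2 * n + 1)) by lia. unfold hermite1. rewrite H. ring.
Qed.

(** Rolle, alternating between the parities: the derivative is a positive multiple of the previous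
    Hermite polynomial; an odd one vanishes at [0], so it has no more positive zeros than its
    derivative, and an even one has at most one more. *)
Lemma hermite_zeros_le n : (forall b m, has_zeros (hermite (2 * n)) 0 b m -> (m <= n)%nat) /\
  (forall b m, has_zeros (hermite (2 * n + 1)) 0 b m -> (m <= n)%nat).
Proof.
assert (S1 : forall n, (forall b m, has_zeros (hermite (2 * n)) 0 b m -> (m <= n)%nat) ->
   forall b m, has_zeros (hermite (2 * n + 1)) 0 b m -> (m <= n)%nat).
{ intros k Hk b m Hm. apply (Hk b m).
  apply has_zeros_ext with (hermite1 (2 * k + 1)).
  - replace (2 * k + 1)%nat with (S (2 * k)) by lia. unfold hermite1. intros z _ Ez.
    assert (0 < INR (S (2 * k))) by (apply lt_0_INR; lia).
    destruct (Rmult_integral (2 * INR (S (2 * k))) (hermite (2 * k) z)); auto; lra.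
  - apply has_zeros_derive0 with (hermite (2 * k + 1)); auto.
    + intros x; apply hermite_derive.
    + apply hermite_parity. }
induction n as [|n [IH1 IH2]].
- assert (Z : forall b m, has_zeros (hermite (2 * 0)) 0 b m -> (m <= 0)%nat).
  { intros b [|m] H; [lia|]. destruct H as [z [_ [Fz _]]]. simpl in Fz; lra. }
  split; [exact Z|apply S1, Z].
- assert (Z : forall b m, has_zeros (hermite (2 * S n)) 0 b m -> (m <= S n)%nat).
  { intros b [|m] Hm; [lia|]. apply le_n_S, (IH2 b m).
    apply has_zeros_ext with (hermite1 (2 * S n)).
    - replace (2 * S n)%nat with (S (2 * n + 1)) by lia. unfold hermite1. intros z _ Ez.
      assert (0 < INR (S (2 * n + 1))) by (apply lt_0_INR; lia).
      destruct (Rmult_integral (2 * INR (S (2 * n + 1))) (hermite (2 * n + 1) z)); auto; lra.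
    - apply has_zeros_derive with (hermite (2 * S n)); auto. intros x; apply hermite_derive. }
  split; [exact Z|apply S1, Z].
Qed.

Definition psi (k : nat) (y : R) : R := hermite k y * exp (- y ^ 2 / 2).
Definition psi1 (k : nat) (y : R) : R := (hermite1 k y - y * hermite k y) * exp (- y ^ 2 / 2).

Lemma gauss_derive y : is_derive (fun y => exp (- y ^ 2 / 2)) y (- y * exp (- y ^ 2 / 2)).
Proof. auto_derive; auto. unfold Rdiv; simpl; field. Qed.

Lemma psi_derive k y : is_derive (psi k) y (psi1 k y).
Proof.
evar_last.
- apply (is_derive_mult (hermite k) (fun y => exp (- y ^ 2 / 2)) y).
  + apply hermite_derive.
  + apply gauss_derive.
  + intros; apply Rmult_comm.
- unfold psi1, plus, mult; simpl; ring.
Qed.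

Lemma psi1_derive k y : is_derive (psi1 k) y ((y ^ 2 - (2 * INR k + 1)) * psi k y).
Proof.
evar_last.
- apply (is_derive_mult (fun y => hermite1 k y - y * hermite k y) (fun y => exp (- y ^ 2 / 2)) y).
  + apply (is_derive_minus (hermite1 k) (fun y => y * hermite k y)).
    * apply hermite1_derive.
    * apply (is_derive_mult (fun y => y) (hermite k) y).
      -- apply (is_derive_id y).
      -- apply hermite_derive.
      -- intros; apply Rmult_comm.
  + apply gauss_derive.
  + intros; apply Rmult_comm.
- unfold psi, minus, plus, opp, mult, one; simpl; ring.
Qed.

Lemma psi_zero k y : psi k y = 0 <-> hermite k y = 0.
Proof.
unfold psi; assert (0 < exp (- y ^ 2 / 2)) by apply exp_pos. split; intros E.
- destruct (Rmult_integral _ _ E); auto; lra.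
- rewrite E; ring.
Qed.

Lemma psi_simple k y : psi k y = 0 -> psi1 k y <> 0.
Proof.
intros E E1. apply psi_zero in E. unfold psi1 in E1. rewrite E in E1.
assert (0 < exp (- y ^ 2 / 2)) by apply exp_pos.
destruct (Rmult_integral _ _ E1); [|lra].
apply (hermite_no_common k y); auto. rewrite hermite_rec, E; lra.
Qed.

Lemma psi_tail (y bt : R) (k : nat) : 0 < y -> 0 <= bt -> 2 * INR k + bt ^ 2 <= y ^ 2 ->
  0 < psi k y /\ - y * psi k y <= psi1 k y <= - bt * psi k y.
Proof.
intros Hy Hb H. destruct (hermite_growth y bt k) as [P _]; auto.
destruct (hermite1_bounds y bt k) as [B1 B2]; auto.
assert (0 < exp (- y ^ 2 / 2)) by apply exp_pos. unfold psi, psi1.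
split; [apply Rmult_lt_0_compat; auto|].
split.
- rewrite <- Rmult_assoc. apply Rmult_le_compat_r; lra.
- rewrite <- Rmult_assoc. apply Rmult_le_compat_r; lra.
Qed.

Lemma psi_at0 n p : (p <= 1)%nat -> (p = 1%nat -> psi (2 * n + p) 0 = 0) /\ (p = 0%nat -> psi1 (2 * n + p) 0 = 0).
Proof.
intros Hp; destruct (hermite_parity n) as [H1 H2]; split; intros ->.
- apply psi_zero, H1.
- unfold psi1. rewrite Nat.add_0_r, H2. ring.
Qed.

Lemma psi_wronskian_0 n m p : (p <= 1)%nat ->
  psi1 (2 * n + p) 0 * psi (2 * m + p) 0 - psi (2 * n + p) 0 * psi1 (2 * m + p) 0 = 0.
Proof.
intros Hp. destruct (psi_at0 n p Hp) as [A1 A2]. destruct (psi_at0 m p Hp) as [B1 B2].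
destruct p as [|[|p]]; [| |lia].
- rewrite A2, B2; auto; ring.
- rewrite A1, B1; auto; ring.
Qed.

(** The constant [4] is the gap between the eigenvalues [2 * k + 1] of consecutive indices of equal
    parity. *)
Lemma psi_sturm_pair n p Xm : (p <= 1)%nat ->
  sturm_pair (psi (2 * n + p)) (psi1 (2 * n + p)) (psi (2 * S n + p)) (psi1 (2 * S n + p)) (fun _ => 4) 0 Xm.
Proof.
intros Hp.
assert (DW : forall x, is_derive (fun x => psi1 (2 * n + p) x * psi (2 * S n + p) x - psi (2 * n + p) x * psi1 (2 * S n + p) x) x
   (4 * (psi (2 * n + p) x * psi (2 * S n + p) x))).
{ intros x; evar_last.
  - apply (is_derive_minus (fun x => psi1 (2 * n + p) x * psi (2 * S n + p) x) (fun x => psi (2 * n + p) x * psi1 (2 * S n + p) x)).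
    + apply (is_derive_mult (psi1 (2 * n + p)) (psi (2 * S n + p)) x); [apply psi1_derive|apply psi_derive|intros; apply Rmult_comm].
    + apply (is_derive_mult (psi (2 * n + p)) (psi1 (2 * S n + p)) x); [apply psi_derive|apply psi1_derive|intros; apply Rmult_comm].
  - unfold minus, plus, opp, mult; cbn -[psi psi1 INR Nat.mul].
    replace (2 * S n + p)%nat with (S (S (2 * n + p))) by lia. rewrite !S_INR. ring. }
split; [|split].
- intros x _; refine (conj _ (conj _ (conj _ _))).
  + apply psi_derive.
  + apply psi_derive.
  + eapply is_derive_continuous, psi1_derive.
  + eapply is_derive_continuous, psi1_derive.
- intros x _ _; split; [lra|apply DW].
- intros e He. assert (C := is_derive_continuous _ _ _ (DW 0)).
  destruct (proj1 (continuous_R _ _) C e He) as [d [d0 Hd]]; exists d; split; auto.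
  intros x Hx. rewrite (psi_wronskian_0 n (S n) p Hp) in Hd.
  specialize (Hd x). rewrite !Rminus_0_r in Hd. apply Hd; rewrite Rabs_pos_eq; lra.
Qed.

(** Supplies the right end for comparing two levels: far out, the higher Hermite function decays
    more slowly than the lower one. *)
Lemma psi_ratio_end (k : nat) : exists X, 0 < X /\ 2 * INR k <= X ^ 2 /\
  0 < psi k X /\ 0 < psi (S (S k)) X /\ psi1 k X * psi (S (S k)) X - psi k X * psi1 (S (S k)) X < 0.
Proof.
set (q := INR k). assert (q0 : 0 <= q) by apply pos_INR.
(* As [(X - bt) * (X + bt) = 2 * q], a large [bt] brings [X] close to [bt]; [q + 3] suffices for
   [(X - bt) * (2 * X) < 2 * (q + 2)], to which the sign of the Wronskian reduces. *)
set (bt := q + 3). set (X := sqrt (2 * q + bt ^ 2)).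
assert (HX2 : X ^ 2 = 2 * q + bt ^ 2) by (unfold X; apply pow2_sqrt; unfold bt; nra).
assert (HX : 0 < X) by (apply sqrt_lt_R0; unfold bt; nra).
assert (E2 : INR (S (S k)) = q + 2) by (rewrite !S_INR; unfold q; ring).
assert (E1 : INR (S k) = q + 1) by (rewrite !S_INR; unfold q; ring).
assert (B0 : 3 <= bt) by (unfold bt; lra).
exists X; split; auto. split; [nra|].
assert (B9 : 9 <= bt ^ 2) by nra.
destruct (psi_tail X 0 k) as [P0 _]; try (fold q; lra).
destruct (psi_tail X 0 (S (S k))) as [P2 _]; try (rewrite ?E2; lra).
split; auto. split; auto.
destruct (hermite_growth X bt k) as [G0 G0']; try (fold q; lra).
destruct (hermite_growth X 0 (S k)) as [G1 G1']; try (rewrite ?E1; lra).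
destruct (hermite1_bounds X bt k) as [D1 D2]; try (fold q; lra).
assert (D3 : hermite1 (S (S k)) X = 2 * (q + 2) * hermite (S k) X) by (unfold hermite1; rewrite E2; ring).
assert (D4 : hermite (S (S k)) X <= 2 * X * hermite (S k) X).
{ rewrite hermite_rec. destruct (hermite1_bounds X 0 (S k)) as [D _]; try (rewrite ?E1; lra); lra. }
unfold psi, psi1.
assert (0 < exp (- X ^ 2 / 2)) by apply exp_pos. set (e := exp (- X ^ 2 / 2)) in *.
replace (_ - _) with ((hermite1 k X * hermite (S (S k)) X - hermite k X * hermite1 (S (S k)) X) * (e * e)) by ring.
assert (0 < e * e) by nra.
enough (hermite1 k X * hermite (S (S k)) X - hermite k X * hermite1 (S (S k)) X < 0) by nra.
rewrite D3.
assert (S1 : hermite1 k X * hermite (S (S k)) X <= ((X - bt) * hermite k X) * (2 * X * hermite (S k) X)).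
{ apply Rmult_le_compat; lra. }
assert (S2 : (X - bt) * (2 * X) < 2 * (q + 2)).
{ assert (Q : (X - bt) * (X + bt) = 2 * q) by nra.
  apply Rmult_lt_reg_r with (X + bt); [lra|].
  replace ((X - bt) * (2 * X) * (X + bt)) with ((X - bt) * (X + bt) * (2 * X)) by ring.
  rewrite Q. destruct (Rle_lt_dec q 2); unfold bt in *; nra. }
assert (0 < hermite k X * hermite (S k) X) by (apply Rmult_lt_0_compat; auto).
replace (hermite k X * (2 * (q + 2) * hermite (S k) X)) with (2 * (q + 2) * (hermite k X * hermite (S k) X)) by ring.
replace ((X - bt) * hermite k X * (2 * X * hermite (S k) X)) with ((X - bt) * (2 * X) * (hermite k X * hermite (S k) X)) in S1 by ring.
nra.
Qed.

(** Induction by Sturm comparison of the levels [k] and [k + 2]. The zeros are first found in some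
    [(0, X)]; none satisfies [2 * k <= y^2], so all of them lie below [B]. *)
Lemma hermite_zeros_ge n p B : (p <= 1)%nat -> 0 < B -> 2 * INR (2 * n + p) <= B ^ 2 ->
  has_zeros (hermite (2 * n + p)) 0 B n.
Proof.
intros Hp. revert B; induction n as [|n IH]; intros B HB HB2; [exact I|].
destruct (psi_ratio_end (2 * n + p)) as [X [X0 [XX [P0 [P2 HW]]]]].
replace (S (S (2 * n + p))) with (2 * S n + p)%nat in * by lia.
apply has_zeros_restrict with X.
{ intros z Hz Fz. apply Rnot_le_lt; intros N.
  destruct (hermite_growth z 0 (2 * S n + p)) as [G _]; try lra. simpl (0 ^ 2). nra. }
apply has_zeros_ext with (psi (2 * S n + p)).
{ intros z _; apply psi_zero. }
apply (sturm_count (psi (2 * n + p)) (psi1 (2 * n + p)) _ (psi1 (2 * S n + p)) (fun _ => 4) 0 (X + 1)).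
- apply psi_sturm_pair; auto.
- lra.
- intros x _; apply psi_simple.
- assert (0 < psi (2 * n + p) X * psi (2 * S n + p) X) by nra. nra.
- apply has_zeros_ext with (hermite (2 * n + p)); [intros z _; apply psi_zero|].
  apply IH; auto.
Qed.

Lemma hermite_zeros_le_parity n p b m : (p <= 1)%nat ->
  has_zeros (hermite (2 * n + p)) 0 b m -> (m <= n)%nat.
Proof.
intros Hp; destruct (hermite_zeros_le n) as [H1 H2]; destruct p as [|[|p]]; [| |lia].
- rewrite Nat.add_0_r; apply H1.
- apply H2.
Qed.

(** * Integrals of continuous functions *)

Section ContinuousIntegral.

Variables (f g : R -> R).
Hypothesis Cf : forall x, continuous f x.
Hypothesis Cg : forall x, continuous g x.

Lemma rint_ex a b : ex_RInt f a b.
Proof. apply (@ex_RInt_continuous R_CompleteNormedModule); intros; apply Cf. Qed.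

Lemma rint_chasles a b c : RInt f a c = RInt f a b + RInt f b c.
Proof.
symmetry; apply (@RInt_Chasles R_CompleteNormedModule f a b c);
  apply (@ex_RInt_continuous R_CompleteNormedModule); intros; apply Cf.
Qed.

Lemma rint_derive a x : is_derive (fun x => RInt f a x) x (f x).
Proof.
apply (is_derive_RInt f (fun x => RInt f a x) a x); [|apply Cf].
exists (mkposreal 1 Rlt_0_1); intros y _.
apply (@RInt_correct R_CompleteNormedModule), (@ex_RInt_continuous R_CompleteNormedModule); intros; apply Cf.
Qed.

Lemma rint_lower a b m : a <= b -> (forall x, a < x < b -> m <= f x) -> m * (b - a) <= RInt f a b.
Proof.
intros ab H. replace (m * (b - a)) with (RInt (fun _ => m) a b).
- apply RInt_le; auto; [apply ex_RInt_const|].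
  apply (@ex_RInt_continuous R_CompleteNormedModule); intros; apply Cf.
- rewrite RInt_const; unfold scal; simpl; unfold mult; simpl; ring.
Qed.

Lemma rint_upper a b m : a <= b -> (forall x, a < x < b -> f x <= m) -> RInt f a b <= m * (b - a).
Proof.
intros ab H. replace (m * (b - a)) with (RInt (fun _ => m) a b).
- apply RInt_le; auto; [|apply ex_RInt_const].
  apply (@ex_RInt_continuous R_CompleteNormedModule); intros; apply Cf.
- rewrite RInt_const; unfold scal; simpl; unfold mult; simpl; ring.
Qed.

Lemma rint_le_scal k a b : a <= b -> (forall x, a < x < b -> f x <= k * g x) ->
  RInt f a b <= k * RInt g a b.
Proof.
intros ab H.
assert (E : ex_RInt g a b) by (apply (@ex_RInt_continuous R_CompleteNormedModule); intros; apply Cg).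
change (k * RInt g a b) with (scal k (RInt g a b)).
rewrite <- (RInt_scal (V := R_CompleteNormedModule) g a b k) by exact E.
apply RInt_le; auto.
- apply (@ex_RInt_continuous R_CompleteNormedModule); intros; apply Cf.
- apply (@ex_RInt_scal R_CompleteNormedModule); exact E.
Qed.

Lemma rint_ge_scal k a b : a <= b -> (forall x, a < x < b -> k * g x <= f x) ->
  k * RInt g a b <= RInt f a b.
Proof.
intros ab H.
assert (E : ex_RInt g a b) by (apply (@ex_RInt_continuous R_CompleteNormedModule); intros; apply Cg).
change (k * RInt g a b) with (scal k (RInt g a b)).
rewrite <- (RInt_scal (V := R_CompleteNormedModule) g a b k) by exact E.
apply RInt_le; auto.
- apply (@ex_RInt_scal R_CompleteNormedModule); exact E.
- apply (@ex_RInt_continuous R_CompleteNormedModule); intros; apply Cf.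
Qed.

End ContinuousIntegral.

(** * Implicitly defined functions *)

Lemma inverse_derive (F y H : R -> R) (x0 l h : R) :
  is_derive F (y x0) l -> l <> 0 -> is_derive H x0 h -> continuous y x0 ->
  locally x0 (fun x => F (y x) = H x) -> is_derive y x0 (h / l).
Proof.
intros DF l0 DH Cy [d1 E1].
assert (E1' : forall x, Rabs (x - x0) < d1 -> F (y x) = H x) by (intros x Hx; apply E1; exact Hx).
apply is_derive_R; intros e He.
assert (al : 0 < Rabs l) by (apply Rabs_pos_lt; auto).
set (hl := Rabs (h / l)). assert (hl0 : 0 <= hl) by apply Rabs_pos.
set (e1 := Rmin (Rabs l / 2) (Rabs l * e / (4 * (hl + 1)))).
set (e2 := Rmin (Rabs l) (Rabs l * e / 4)).
assert (e10 : 0 < e1).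
{ unfold e1; apply Rmin_glb_lt; [lra|]. apply Rdiv_lt_0_compat; nra. }
assert (e20 : 0 < e2).
{ unfold e2; apply Rmin_glb_lt; [lra|]. nra. }
destruct (proj1 (is_derive_R _ _ _) DF e1 e10) as [dF [dF0 HF]].
destruct (proj1 (is_derive_R _ _ _) DH e2 e20) as [dH [dH0 HH]].
destruct (proj1 (continuous_R _ _) Cy dF dF0) as [dy [dy0 Hy]].
exists (Rmin d1 (Rmin dH dy)); split.
{ repeat apply Rmin_glb_lt; auto; apply cond_pos. }
intros x N Hx.
assert (B1 := Rmin_l d1 (Rmin dH dy)). assert (B2 := Rmin_r d1 (Rmin dH dy)).
assert (B3 := Rmin_l dH dy). assert (B4 := Rmin_r dH dy).
assert (Q0 : F (y x) = H x) by (apply E1'; lra).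
assert (Q1 : F (y x0) = H x0).
{ apply E1'. rewrite Rminus_diag, Rabs_R0. apply cond_pos. }
set (dx := y x - y x0). set (k := x - x0) in *.
assert (R1 : Rabs (H x - H x0 - l * dx) <= e1 * Rabs dx).
{ destruct (Req_dec (y x) (y x0)) as [E|E].
  - unfold dx; rewrite <- Q0, <- Q1, E, !Rminus_diag, Rmult_0_r, Rminus_diag, Rabs_R0; lra.
  - rewrite <- Q0, <- Q1; apply HF; auto. apply Hy; fold k; lra. }
assert (R2 : Rabs (H x - H x0 - h * k) <= e2 * Rabs k) by (apply HH; auto; fold k; lra).
assert (R3 : Rabs (h * k - l * dx) <= e1 * Rabs dx + e2 * Rabs k).
{ replace (h * k - l * dx) with ((H x - H x0 - l * dx) - (H x - H x0 - h * k)) by ring.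
  eapply Rle_trans; [apply Rabs_triang|]. rewrite Rabs_Ropp; lra. }
assert (R4 : Rabs l * Rabs (dx - h / l * k) <= e1 * Rabs dx + e2 * Rabs k).
{ rewrite <- Rabs_mult. replace (l * (dx - h / l * k)) with (- (h * k - l * dx)) by (field; auto).
  rewrite Rabs_Ropp; auto. }
assert (R5 : Rabs dx <= Rabs (dx - h / l * k) + hl * Rabs k).
{ unfold hl; rewrite <- Rabs_mult. eapply Rle_trans; [|apply Rabs_triang]. right; f_equal; ring. }
assert (M1 : e1 <= Rabs l / 2) by apply Rmin_l.
assert (M2 : e1 <= Rabs l * e / (4 * (hl + 1))) by apply Rmin_r.
assert (M3 : e2 <= Rabs l * e / 4) by apply Rmin_r.
set (D := Rabs (dx - h / l * k)) in *. assert (D0 : 0 <= D) by apply Rabs_pos.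
assert (k0 : 0 <= Rabs k) by apply Rabs_pos.
assert (M4 : e1 * hl <= Rabs l * e / 4).
{ apply Rle_trans with (Rabs l * e / (4 * (hl + 1)) * (hl + 1)); [|right; field; lra].
  apply Rmult_le_compat; lra. }
assert (Rabs l * D <= Rabs l * (e * Rabs k)) by nra.
apply Rmult_le_reg_l with (Rabs l); auto.
Qed.

Lemma inverse_continuous (F y H : R -> R) (x0 : R) :
  (forall u v, 0 <= u < v -> F u < F v) -> 0 < y x0 ->
  locally x0 (fun x => 0 <= y x /\ F (y x) = H x) -> continuous H x0 -> continuous y x0.
Proof.
intros HF Hy [d1 E1] CH; apply continuous_R; intros e He.
assert (E1' : forall x, Rabs (x - x0) < d1 -> 0 <= y x /\ F (y x) = H x) by (intros x Hx; apply E1; exact Hx).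
assert (E0 : F (y x0) = H x0) by (apply E1'; rewrite Rminus_diag, Rabs_R0; apply cond_pos).
set (m := Rmin e (y x0)). assert (m0 : 0 < m) by (apply Rmin_glb_lt; auto).
assert (m <= e) by apply Rmin_l. assert (m <= y x0) by apply Rmin_r.
assert (F1 := HF (y x0 - m / 2) (y x0) ltac:(lra)). assert (F2 := HF (y x0) (y x0 + m / 2) ltac:(lra)).
set (mm := Rmin (F (y x0) - F (y x0 - m / 2)) (F (y x0 + m / 2) - F (y x0))).
assert (mm0 : 0 < mm) by (apply Rmin_glb_lt; lra).
assert (mm <= F (y x0) - F (y x0 - m / 2)) by apply Rmin_l.
assert (mm <= F (y x0 + m / 2) - F (y x0)) by apply Rmin_r.
destruct (proj1 (continuous_R _ _) CH mm mm0) as [d [d0 Hd]].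
exists (Rmin d1 d); split; [apply Rmin_glb_lt; auto; apply cond_pos|].
intros x Hx. assert (B1 := Rmin_l d1 d). assert (B2 := Rmin_r d1 d).
destruct (E1' x ltac:(lra)) as [Y0 EY]. specialize (Hd x ltac:(lra)).
rewrite <- EY, <- E0 in Hd. apply Rabs_def2 in Hd.
apply Rabs_def1.
- apply Rnot_le_lt; intros N. assert (F (y x0 + m / 2) < F (y x)) by (apply HF; lra). lra.
- apply Rnot_le_lt; intros N. assert (F (y x) < F (y x0 - m / 2)) by (apply HF; lra). lra.
Qed.

(** * Straightening the action *)

(* Retypes over [R] an equation whose type Coquelicot left as a normed module, where [ring] and [field] fail. *)
Ltac real_eq := match goal with |- ?a = ?b => apply (Rplus_eq_reg_l 0 a b) end.

(** The integrand of the action for an oscillator with turning points [-xs] and [xs]. The absolute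
    value continues it into the forbidden region, so that one integral defines the change of
    variable on both sides. *)
Definition jac (xs u : R) : R := sqrt (Rabs (xs ^ 2 - u ^ 2)).

Lemma jac_continuous xs u : continuous (jac xs) u.
Proof.
unfold jac. apply (continuous_comp (fun u => Rabs (xs ^ 2 - u ^ 2)) sqrt).
- apply (continuous_comp (fun u => xs ^ 2 - u ^ 2) Rabs).
  + apply is_derive_continuous with (- (2 * u)). auto_derive; auto; ring.
  + apply continuous_pt, Rcontinuity_abs.
- apply continuous_sqrt.
Qed.

Lemma jac_sqr xs u : jac xs u * jac xs u = Rabs (xs ^ 2 - u ^ 2).
Proof. apply sqrt_sqrt, Rabs_pos. Qed.

Lemma jac_nonneg xs u : 0 <= jac xs u.
Proof. apply sqrt_pos. Qed.

Lemma jac_pos xs u : 0 < xs -> 0 <= u -> u <> xs -> 0 < jac xs u.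
Proof. intros H1 H2 N; apply sqrt_lt_R0, Rabs_pos_lt; nra. Qed.

Lemma jac_decr xs u v : 0 <= u <= v -> v <= xs -> jac xs v <= jac xs u.
Proof. intros H1 H2; apply sqrt_le_1_alt. rewrite !Rabs_pos_eq; nra. Qed.

Lemma jac_incr xs u v : 0 <= xs <= u -> u <= v -> jac xs u <= jac xs v.
Proof. intros H1 H2; apply sqrt_le_1_alt. rewrite !Rabs_left1; nra. Qed.

Lemma jac_ge_left xs u : 0 <= u <= xs -> xs - u <= jac xs u.
Proof.
intros H; rewrite <- (sqrt_pow2 (xs - u)) by lra. apply sqrt_le_1_alt.
rewrite Rabs_pos_eq; nra.
Qed.

Lemma jac_le_left xs u : 0 <= u <= xs -> jac xs u <= xs.
Proof.
intros H; rewrite <- (sqrt_pow2 xs) at 2 by lra. apply sqrt_le_1_alt.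
rewrite Rabs_pos_eq; nra.
Qed.

Lemma jac_ge1 xs u : 0 < xs -> xs + 1 <= u -> 1 <= jac xs u.
Proof.
intros H1 H2; rewrite <- sqrt_1. apply sqrt_le_1_alt. rewrite Rabs_left1; nra.
Qed.

Section Geometry.

Variables (xs X g0 g1 L : R) (q G : R -> R).
Hypothesis xs0 : 0 < xs < X.
Hypothesis g00 : 0 < g0.
Hypothesis L0 : 0 <= L.
Hypothesis Cq : forall u, continuous q u.
Hypothesis HG : forall t, 0 < t < X ^ 2 -> g0 <= G t <= g1.
Hypothesis HL : forall t r, 0 < t < X ^ 2 -> 0 < r < X ^ 2 -> Rabs (G t - G r) <= L * Rabs (t - r).
Hypothesis Hq : forall u, 0 < u < X -> q u = G (u ^ 2) * jac xs u.

Let J := jac xs.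
Let CJ : forall u, continuous J u := jac_continuous xs.
(** Chosen so that the straightening map fixes [xs]: the oscillator of energy [c * xs^2] has the
    same action between the turning points as [q]. *)
Definition action_ratio := RInt q 0 xs / RInt (jac xs) 0 xs.
Let c := action_ratio.
Let lam := g0 / g1.
(** [g1 / g0] bounds the distortion of integrals under straightening. The factor [2] is needed near
    [0], where the integral of [J] up to [y] is only known to exceed [xs * y / 2]. *)
Definition kap := 1 + 2 * (g1 / g0).
Definition lc := L / g0.

Lemma sq_in u : 0 < u < X -> 0 < u ^ 2 < X ^ 2.
Proof. intros H; split; nra. Qed.

Lemma g01 : g0 <= g1.
Proof. destruct (HG (xs ^ 2)); [apply sq_in; lra|lra]. Qed.

Lemma rint_jac_pos a b : 0 <= a < b -> 0 < RInt J a b.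
Proof.
intros H.
assert (D : forall x, is_derive (fun x => RInt J a x) x (J x)) by (intros x; apply rint_derive, CJ).
replace 0 with (RInt J a a) by apply (@RInt_point R_CompleteNormedModule).
apply (incr_strict_except (fun x => RInt J a x) J a b xs); try tauto.
- intros x _; eapply is_derive_continuous, D.
- intros x _ _; apply D.
- intros x Hx N; apply jac_pos; lra.
Qed.

Lemma rint_jac_incr u v : 0 <= u < v -> RInt J 0 u < RInt J 0 v.
Proof.
intros H. rewrite (rint_chasles J CJ 0 u v). assert (0 < RInt J u v) by (apply rint_jac_pos; auto). lra.
Qed.

Lemma c_range : g0 <= c <= g1.
Proof.
assert (P : 0 < RInt J 0 xs) by (apply rint_jac_pos; lra).
assert (H1 : g0 * RInt J 0 xs <= RInt q 0 xs).
{ apply rint_ge_scal; auto; [lra|]. intros x Hx; rewrite Hq by lra.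
  apply Rmult_le_compat_r; [apply jac_nonneg|apply HG, sq_in; lra]. }
assert (H2 : RInt q 0 xs <= g1 * RInt J 0 xs).
{ apply rint_le_scal; auto; [lra|]. intros x Hx; rewrite Hq by lra.
  apply Rmult_le_compat_r; [apply jac_nonneg|apply HG, sq_in; lra]. }
unfold c, action_ratio; split.
- apply Rle_div_r; auto.
- apply Rle_div_l; auto.
Qed.

Lemma c_mult : c * RInt J 0 xs = RInt q 0 xs.
Proof.
assert (P : 0 < RInt J 0 xs) by (apply rint_jac_pos; lra).
unfold c, action_ratio, J in *; field; lra.
Qed.

(** [c] is the mean of [G (u^2)] over [[0, xs]] with weight [J], so it differs from [G t] by at most
    the oscillation of [G]. *)
Lemma G_near_c t : 0 < t < X ^ 2 -> Rabs (G t - c) <= L * Rmax t (xs ^ 2).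
Proof.
intros Ht. set (d := L * Rmax t (xs ^ 2)).
assert (P : 0 < RInt J 0 xs) by (apply rint_jac_pos; lra).
assert (HB : forall u, 0 < u < xs -> Rabs (G t - G (u ^ 2)) <= d).
{ intros u Hu. assert (S := sq_in u ltac:(lra)). eapply Rle_trans; [apply HL; auto|].
  apply Rmult_le_compat_l; auto. assert (u ^ 2 <= xs ^ 2) by nra.
  assert (A1 := Rmax_l t (xs ^ 2)). assert (A2 := Rmax_r t (xs ^ 2)). apply Rabs_le; lra. }
assert (H1 : (G t - d) * RInt J 0 xs <= RInt q 0 xs).
{ apply rint_ge_scal; auto; [lra|]. intros x Hx; rewrite Hq by lra.
  apply Rmult_le_compat_r; [apply jac_nonneg|]. specialize (HB x Hx); apply Rabs_le_between in HB; lra. }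
assert (H2 : RInt q 0 xs <= (G t + d) * RInt J 0 xs).
{ apply rint_le_scal; auto; [lra|]. intros x Hx; rewrite Hq by lra.
  apply Rmult_le_compat_r; [apply jac_nonneg|]. specialize (HB x Hx); apply Rabs_le_between in HB; lra. }
rewrite <- c_mult in H1, H2. apply Rabs_le. split.
- assert (c <= G t + d) by (apply Rmult_le_reg_r with (RInt J 0 xs); auto). lra.
- assert (G t - d <= c) by (apply Rmult_le_reg_r with (RInt J 0 xs); auto). lra.
Qed.

Lemma Gc_near_1 t : 0 < t < X ^ 2 -> Rabs (G t / c - 1) <= lc * Rmax t (xs ^ 2).
Proof.
intros Ht. assert (R := c_range). assert (Q := G_near_c t Ht).
replace (G t / c - 1) with ((G t - c) / c) by (real_eq; field; lra).
unfold Rdiv at 1; rewrite Rabs_mult, Rabs_inv, (Rabs_pos_eq c) by lra.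
apply Rle_trans with (L * Rmax t (xs ^ 2) * / g0).
- apply Rmult_le_compat; auto; [apply Rabs_pos|left; apply Rinv_0_lt_compat; lra|apply Rinv_le_contravar; lra].
- unfold lc, Rdiv; right; ring.
Qed.

Lemma kap_ge : 3 <= kap /\ g1 / g0 <= kap - 1.
Proof.
unfold kap. assert (1 <= g1 / g0).
{ apply Rmult_le_reg_r with g0; auto. assert (E := g01). unfold Rdiv; rewrite Rmult_assoc, Rinv_l; lra. }
lra.
Qed.

Lemma qc_le u : 0 < u < X -> q u <= g1 / g0 * (c * J u) /\ J u <= g1 / g0 * / c * q u.
Proof.
intros Hu. rewrite Hq by auto. assert (R := c_range). destruct (HG (u ^ 2) (sq_in u Hu)) as [A B].
assert (JP := jac_nonneg xs u).
assert (1 <= g1 / g0) by (destruct kap_ge as [_ K]; unfold kap in *; apply Rmult_le_reg_r with g0; auto; unfold Rdiv; rewrite Rmult_assoc, Rinv_l; lra).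
split.
- rewrite <- Rmult_assoc. apply Rmult_le_compat_r; auto.
  apply Rle_trans with (g1 / g0 * g0); [unfold Rdiv; rewrite Rmult_assoc, Rinv_l; lra|].
  apply Rmult_le_compat_l; lra.
- rewrite <- Rmult_assoc. rewrite <- (Rmult_1_l (J u)) at 1. apply Rmult_le_compat_r; auto.
  apply Rmult_le_reg_r with (c * g0); [nra|].
  replace (g1 / g0 * / c * G (u ^ 2) * (c * g0)) with (g1 * G (u ^ 2)) by (real_eq; field; lra). nra.
Qed.

(* The points [x] and [xt x] correspond under the map that straightens [q] into [c * J]. *)
Variable xt : R -> R.
Hypothesis Hxt : forall x, 0 <= x < X -> 0 <= xt x /\ RInt J 0 (xt x) = RInt q 0 x / c.

Lemma c_pos : 0 < c.
Proof. assert (R := c_range); lra. Qed.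

Lemma rint_q_pos a b : 0 <= a < b -> b <= X -> 0 < RInt q a b.
Proof.
intros H HX.
apply Rlt_le_trans with (g0 * RInt J a b).
- apply Rmult_lt_0_compat; auto; apply rint_jac_pos; auto.
- apply rint_ge_scal; auto; [lra|]. intros x Hx; rewrite Hq by lra.
  apply Rmult_le_compat_r; [apply jac_nonneg|apply HG, sq_in; lra].
Qed.

Lemma xt_0 : xt 0 = 0.
Proof.
destruct (Hxt 0) as [H1 H2]; [lra|]. rewrite (@RInt_point R_CompleteNormedModule) in H2. change zero with 0 in H2.
destruct H1 as [H1|H1]; auto. exfalso.
assert (0 < RInt J 0 (xt 0)) by (apply rint_jac_pos; lra).
unfold Rdiv in H2; rewrite Rmult_0_l in H2; lra.
Qed.

Lemma xt_xs : xt xs = xs.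
Proof.
destruct (Hxt xs) as [H1 H2]; [lra|]. rewrite <- c_mult in H2.
assert (P := c_pos). replace (c * RInt J 0 xs / c) with (RInt J 0 xs) in H2 by (real_eq; field; lra).
destruct (Rtotal_order (xt xs) xs) as [H|[H|H]]; auto; exfalso.
- assert (RInt J 0 (xt xs) < RInt J 0 xs) by (apply rint_jac_incr; lra). lra.
- assert (RInt J 0 xs < RInt J 0 (xt xs)) by (apply rint_jac_incr; lra). lra.
Qed.

Lemma xt_incr x y : 0 <= x < y -> y < X -> xt x < xt y.
Proof.
intros H HX. destruct (Hxt x) as [A1 A2]; [lra|]. destruct (Hxt y) as [B1 B2]; [lra|].
assert (P := c_pos).
assert (RInt J 0 (xt x) < RInt J 0 (xt y)).
{ rewrite A2, B2. unfold Rdiv; apply Rmult_lt_compat_r; [apply Rinv_0_lt_compat; auto|].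
  rewrite (rint_chasles q Cq 0 x y). assert (0 < RInt q x y) by (apply rint_q_pos; lra). lra. }
apply Rnot_le_lt; intros [N|N].
- assert (RInt J 0 (xt y) < RInt J 0 (xt x)) by (apply rint_jac_incr; lra). lra.
- rewrite N in *; lra.
Qed.

Lemma xt_pos x : 0 < x < X -> 0 < xt x.
Proof. intros H; rewrite <- xt_0; apply xt_incr; lra. Qed.

Lemma xt_diff x y : 0 <= x < X -> 0 <= y < X -> RInt J (xt x) (xt y) = RInt q x y / c.
Proof.
intros Hx Hy. destruct (Hxt x Hx) as [A1 A2]. destruct (Hxt y Hy) as [B1 B2].
assert (E1 := rint_chasles J CJ 0 (xt x) (xt y)). assert (E2 := rint_chasles q Cq 0 x y).
replace (RInt q x y) with (RInt q 0 y - RInt q 0 x) by lra.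
unfold Rdiv in *; rewrite Rmult_minus_distr_r. lra.
Qed.

Lemma xt_int_ratio a b : 0 <= a <= b -> b < X ->
  RInt J (xt a) (xt b) <= g1 / g0 * RInt J a b /\ RInt J a b <= g1 / g0 * RInt J (xt a) (xt b).
Proof.
intros H HX. rewrite xt_diff by lra. assert (P := c_pos). split.
- apply Rmult_le_reg_l with c; auto. replace (c * (RInt q a b / c)) with (RInt q a b) by (real_eq; field; lra).
  replace (c * (g1 / g0 * RInt J a b)) with ((g1 / g0 * c) * RInt J a b) by (real_eq; ring).
  apply rint_le_scal; auto; [lra|]. intros x Hx; rewrite Rmult_assoc; apply qc_le; lra.
- replace (g1 / g0 * (RInt q a b / c)) with (g1 / g0 * / c * RInt q a b) by (real_eq; unfold Rdiv; ring).
  apply rint_le_scal; auto; [lra|]. intros x Hx; apply qc_le; lra.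
Qed.

(** [J] increases beyond [xs], so it is at least [J x] after [x] and at most [J x] before:
    comparable integrals force comparable lengths. *)
Lemma ratio_right x y : xs < x -> xs < y -> RInt J xs y <= g1 / g0 * RInt J xs x ->
  y - xs <= kap * (x - xs).
Proof.
intros Hx Hy H. destruct kap_ge as [K1 K2].
destruct (Rle_lt_dec y x) as [Q|Q]; [nra|].
rewrite (rint_chasles J CJ xs x y) in H.
assert (A : J x * (y - x) <= RInt J x y).
{ apply rint_lower; auto; [lra|]. intros u Hu; apply jac_incr; lra. }
assert (B : RInt J xs x <= J x * (x - xs)).
{ apply rint_upper; auto; [lra|]. intros u Hu; apply jac_incr; lra. }
assert (C : 0 < J x) by (apply jac_pos; lra).
assert (D : 0 < RInt J xs x) by (apply rint_jac_pos; lra).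
nra.
Qed.

Lemma ratio_left x y : 0 <= x < xs -> 0 <= y < xs -> RInt J y xs <= g1 / g0 * RInt J x xs ->
  xs - y <= kap * (xs - x).
Proof.
intros Hx Hy H. destruct kap_ge as [K1 K2].
destruct (Rle_lt_dec x y) as [Q|Q]; [nra|].
rewrite (rint_chasles J CJ y x xs) in H.
assert (A : J x * (x - y) <= RInt J y x).
{ apply rint_lower; auto; [lra|]. intros u Hu; apply jac_decr; lra. }
assert (B : RInt J x xs <= J x * (xs - x)).
{ apply rint_upper; auto; [lra|]. intros u Hu; apply jac_decr; lra. }
assert (C : 0 < J x) by (apply jac_pos; lra).
assert (D : 0 < RInt J x xs) by (apply rint_jac_pos; lra).
nra.
Qed.

Lemma ratio_zero x y : 0 < x < xs -> 0 < y < xs -> RInt J 0 y <= g1 / g0 * RInt J 0 x -> y <= kap * x.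
Proof.
intros Hx Hy H. destruct kap_ge as [K1 K2].
assert (B : RInt J 0 x <= xs * (x - 0)).
{ apply rint_upper; auto; [lra|]. intros u Hu; apply jac_le_left; lra. }
assert (A : xs * y / 2 <= RInt J 0 y).
{ apply Rle_trans with (xs * y - y ^ 2 / 2); [nra|].
  replace (xs * y - y ^ 2 / 2) with (RInt (fun u => xs - u) 0 y).
  - apply RInt_le; [lra| | |].
    + apply rint_ex. intros u; apply is_derive_continuous with (-1); auto_derive; auto; ring.
    + apply rint_ex; auto.
    + intros u Hu; apply jac_ge_left; lra.
  - apply is_RInt_unique. evar_last.
    + apply (is_RInt_derive (fun u => xs * u - u ^ 2 / 2) (fun u => xs - u)).
      * intros u _; auto_derive; auto; simpl; field.
      * intros u _; apply is_derive_continuous with (-1); auto_derive; auto; ring.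
    + unfold minus, plus, opp; simpl; field. }
unfold kap in *.
assert (xs * y <= xs * (2 * (g1 / g0) * x)) by nra.
assert (y <= 2 * (g1 / g0) * x) by (apply Rmult_le_reg_l with xs; lra).
lra.
Qed.

Lemma xt_ratio x : 0 < x < X -> x <= kap * xt x /\ xt x <= kap * x.
Proof.
intros Hx. destruct kap_ge as [K1 K2]. assert (P := xt_pos x Hx). assert (Exs := xt_xs).
destruct (Rtotal_order x xs) as [H|[->|H]].
- assert (xt x < xs) by (rewrite <- Exs; apply xt_incr; lra).
  destruct (xt_int_ratio 0 x) as [A B]; try lra. rewrite xt_0 in A, B.
  split; apply ratio_zero; auto; lra.
- rewrite Exs; split; nra.
- assert (xs < xt x) by (rewrite <- Exs; apply xt_incr; lra).
  destruct (xt_int_ratio xs x) as [A B]; try lra. rewrite Exs in A, B.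
  assert (R1 := ratio_right x (xt x) H H0 A). assert (R2 := ratio_right (xt x) x H0 H B). split; nra.
Qed.

Lemma xt_ratio_sub x : 0 < x < X ->
  Rabs (xt x - xs) <= kap * Rabs (x - xs) /\ Rabs (x - xs) <= kap * Rabs (xt x - xs).
Proof.
intros Hx. assert (P := xt_pos x Hx). assert (Exs := xt_xs).
destruct (Rtotal_order x xs) as [H|[->|H]].
- assert (xt x < xs) by (rewrite <- Exs; apply xt_incr; lra).
  destruct (xt_int_ratio x xs) as [A B]; try lra. rewrite Exs in A, B.
  rewrite !Rabs_left by lra.
  assert (R1 := ratio_left x (xt x) ltac:(lra) ltac:(lra) A).
  assert (R2 := ratio_left (xt x) x ltac:(lra) ltac:(lra) B). lra.
- rewrite Exs, Rminus_diag, Rabs_R0; lra.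
- assert (xs < xt x) by (rewrite <- Exs; apply xt_incr; lra).
  destruct (xt_int_ratio xs x) as [A B]; try lra. rewrite Exs in A, B.
  rewrite !Rabs_pos_eq by lra.
  assert (R1 := ratio_right x (xt x) H H0 A). assert (R2 := ratio_right (xt x) x H0 H B). lra.
Qed.

Lemma sq_ratio_aux x y : 0 < x -> 0 < y -> y <= kap * x ->
  Rabs (y - xs) <= kap * Rabs (x - xs) -> Rabs (xs ^ 2 - y ^ 2) <= kap ^ 2 * Rabs (xs ^ 2 - x ^ 2).
Proof.
intros Hx Hy H1 H2. destruct kap_ge as [K1 K2].
replace (xs ^ 2 - y ^ 2) with (- (y - xs) * (xs + y)) by (real_eq; ring).
replace (xs ^ 2 - x ^ 2) with (- (x - xs) * (xs + x)) by (real_eq; ring).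
rewrite !Rabs_mult, !Rabs_Ropp, !(Rabs_pos_eq (xs + _)) by lra.
replace (kap ^ 2 * (Rabs (x - xs) * (xs + x))) with ((kap * Rabs (x - xs)) * (kap * (xs + x))) by (real_eq; ring).
apply Rmult_le_compat; auto; [apply Rabs_pos|lra|nra].
Qed.

Lemma xt_sq_ratio x : 0 < x < X ->
  Rabs (xs ^ 2 - xt x ^ 2) <= kap ^ 2 * Rabs (xs ^ 2 - x ^ 2) /\
  Rabs (xs ^ 2 - x ^ 2) <= kap ^ 2 * Rabs (xs ^ 2 - xt x ^ 2).
Proof.
intros Hx. assert (P := xt_pos x Hx).
destruct (xt_ratio x Hx) as [R1 R2]. destruct (xt_ratio_sub x Hx) as [S1 S2].
split; apply sq_ratio_aux; auto; lra.
Qed.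

Lemma jac_xt x : 0 < x < X -> J x <= kap * J (xt x).
Proof.
intros Hx. destruct (xt_sq_ratio x Hx) as [_ R]. destruct kap_ge as [K1 K2].
unfold J, jac. rewrite <- (sqrt_pow2 kap) by lra. rewrite <- sqrt_mult_alt by nra.
apply sqrt_le_1_alt; auto.
Qed.

(** [x] and [xt x] lie on the same side of [xs], where [J] is monotone. Its smallest value between
    them is thus taken at an end, and both end values are at least [J x / kap]. *)
Lemma jac_between x u : 0 < x < X -> Rmin x (xt x) < u < Rmax x (xt x) -> / kap * J x <= J u.
Proof.
intros Hx Hu. assert (P := xt_pos x Hx). assert (JX := jac_xt x Hx). destruct kap_ge as [K1 K2].
assert (Exs := xt_xs). assert (JP := jac_nonneg xs x). fold J in JP.
assert (Kx : / kap * J x <= J x).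
{ rewrite <- (Rmult_1_l (J x)) at 2. apply Rmult_le_compat_r; auto.
  rewrite <- Rinv_1. apply Rinv_le_contravar; lra. }
assert (Ky : / kap * J x <= J (xt x)).
{ apply Rmult_le_reg_l with kap; [lra|]. rewrite <- Rmult_assoc, Rinv_r; lra. }
unfold Rmin, Rmax in Hu.
destruct (Rtotal_order x xs) as [H|[->|H]].
- assert (xt x < xs) by (rewrite <- Exs; apply xt_incr; lra).
  destruct (Rle_dec x (xt x)).
  + eapply Rle_trans; [apply Ky|apply jac_decr; lra].
  + eapply Rle_trans; [apply Kx|apply jac_decr; lra].
- rewrite Exs in Hu; destruct (Rle_dec xs xs); lra.
- assert (xs < xt x) by (rewrite <- Exs; apply xt_incr; lra).
  destruct (Rle_dec x (xt x)).
  + eapply Rle_trans; [apply Kx|apply jac_incr; lra].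
  + eapply Rle_trans; [apply Ky|apply jac_incr; lra].
Qed.

Lemma xt_dist_int x : 0 < x < X -> / kap * J x * Rabs (xt x - x) <= Rabs (RInt J x (xt x)).
Proof.
intros Hx. assert (B := jac_between x). unfold Rmin, Rmax in B. destruct kap_ge as [K1 K2].
destruct (Rle_dec x (xt x)) as [Q|Q].
- assert (E : / kap * J x * (xt x - x) <= RInt J x (xt x)) by (apply rint_lower; auto).
  rewrite (Rabs_pos_eq (xt x - x)) by lra. eapply Rle_trans; [apply E|apply Rle_abs].
- assert (E : / kap * J x * (x - xt x) <= RInt J (xt x) x) by (apply rint_lower; auto; lra).
  assert (RInt J x (xt x) = - RInt J (xt x) x).
  { assert (Z := rint_chasles J CJ x (xt x) x). rewrite (@RInt_point R_CompleteNormedModule) in Z.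
    change zero with 0 in Z. lra. }
  rewrite H, Rabs_Ropp, Rabs_left by lra. eapply Rle_trans; [|apply Rle_abs]. lra.
Qed.

Lemma qc_sub a b d : 0 <= a <= b -> b < X ->
  (forall u, a < u < b -> lc * Rmax (u ^ 2) (xs ^ 2) <= d) ->
  Rabs (RInt q a b / c - RInt J a b) <= d * RInt J a b.
Proof.
intros H HX Hd. assert (P := c_pos).
assert (B : forall u, a < u < b -> Rabs (G (u ^ 2) / c - 1) <= d).
{ intros u Hu; eapply Rle_trans; [apply Gc_near_1, sq_in; lra|auto]. }
assert (U : RInt q a b <= (c * (1 + d)) * RInt J a b).
{ apply rint_le_scal; auto; [lra|]. intros x Hx; rewrite Hq by lra.
  apply Rmult_le_compat_r; [apply jac_nonneg|]. specialize (B x Hx); apply Rabs_le_between in B.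
  apply Rmult_le_reg_l with (/ c); [apply Rinv_0_lt_compat; auto|].
  rewrite <- Rmult_assoc, Rinv_l by lra. unfold Rdiv in B. lra. }
assert (Lw : (c * (1 - d)) * RInt J a b <= RInt q a b).
{ apply rint_ge_scal; auto; [lra|]. intros x Hx; rewrite Hq by lra.
  apply Rmult_le_compat_r; [apply jac_nonneg|]. specialize (B x Hx); apply Rabs_le_between in B.
  apply Rmult_le_reg_l with (/ c); [apply Rinv_0_lt_compat; auto|].
  rewrite <- Rmult_assoc, Rinv_l by lra. unfold Rdiv in B. lra. }
apply Rabs_le.
assert (I : 0 < / c) by (apply Rinv_0_lt_compat; auto).
split.
- assert (Q : / c * (c * (1 - d) * RInt J a b) <= / c * RInt q a b) by (apply Rmult_le_compat_l; lra).
  replace (/ c * (c * (1 - d) * RInt J a b)) with ((1 - d) * RInt J a b) in Q by (real_eq; field; lra).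
  unfold Rdiv; lra.
- assert (Q : / c * RInt q a b <= / c * (c * (1 + d) * RInt J a b)) by (apply Rmult_le_compat_l; lra).
  replace (/ c * (c * (1 + d) * RInt J a b)) with ((1 + d) * RInt J a b) in Q by (real_eq; field; lra).
  unfold Rdiv; lra.
Qed.

Lemma lc_nonneg : 0 <= lc.
Proof. unfold lc; apply Rmult_le_pos; auto. left; apply Rinv_0_lt_compat; auto. Qed.

(** The displacement vanishes at both fixed points [0] and [xs] of [xt]. Keeping both factors is
    what later makes quotients by [t] and by [t - s] bounded uniformly in [xs]. *)
Lemma xt_near x : 0 < x < X -> Rabs (xt x - x) <= 4 * kap * lc * x * Rabs (xs ^ 2 - x ^ 2).
Proof.
intros Hx. destruct kap_ge as [K1 K2]. assert (Exs := xt_xs).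
assert (L0' := lc_nonneg).
assert (KL : 0 <= kap * lc) by (apply Rmult_le_pos; lra).
assert (KLx : 0 <= kap * lc * x) by (apply Rmult_le_pos; lra).
assert (D := xt_dist_int x Hx).
assert (F : forall y, 0 <= y -> x <> xs -> Rabs (RInt J x (xt x)) <= J x * y -> Rabs (xt x - x) <= kap * y).
{ intros y Hy N Q. assert (JP : 0 < J x) by (apply jac_pos; lra).
  assert (Z : / kap * J x * Rabs (xt x - x) <= J x * y) by lra.
  apply Rmult_le_reg_l with (/ kap * J x); [apply Rmult_lt_0_compat; auto; apply Rinv_0_lt_compat; lra|].
  replace (/ kap * J x * (kap * y)) with (J x * y) by (real_eq; field; lra). auto. }
assert (Z0 : RInt J x (xt x) = RInt q 0 x / c - RInt J 0 x).
{ destruct (Hxt x) as [_ E]; [lra|]. assert (C := rint_chasles J CJ 0 x (xt x)). lra. }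
assert (Zx : RInt J x (xt x) = - (RInt q x xs / c - RInt J x xs)).
{ assert (C1 := rint_chasles J CJ x (xt x) xs). assert (C2 := xt_diff x xs ltac:(lra) ltac:(lra)).
  rewrite Exs in C2. lra. }
destruct (Rtotal_order x xs) as [H|[->|H]].
- rewrite (Rabs_pos_eq (xs ^ 2 - x ^ 2)) by nra.
  destruct (Rle_lt_dec x (xs / 2)) as [S|S].
  + (* near the origin the error integral is small relative to [x] itself, so compare from [0], not from [xs] *)
    assert (Q : Rabs (RInt J x (xt x)) <= lc * xs ^ 2 * RInt J 0 x).
    { rewrite Z0; apply qc_sub; try lra. intros u Hu; rewrite Rmax_right by nra; lra. }
    assert (B : RInt J 0 x <= xs * (x - 0)).
    { apply rint_upper; auto; [lra|]. intros u Hu; apply jac_le_left; lra. }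
    assert (JX : xs / 2 <= J x) by (assert (Z := jac_ge_left xs x ltac:(lra)); fold J in Z; lra).
    assert (W : Rabs (xt x - x) <= kap * (lc * xs ^ 2 * (2 * x))).
    { assert (LL1 : 0 <= lc * xs ^ 2) by (apply Rmult_le_pos; [auto|apply pow2_ge_0]).
      apply F; [apply Rmult_le_pos; lra|lra|]. eapply Rle_trans; [apply Q|].
      assert (xs * x <= J x * (2 * x)) by nra.
      assert (lc * xs ^ 2 * RInt J 0 x <= lc * xs ^ 2 * (J x * (2 * x))) by (apply Rmult_le_compat_l; lra). lra. }
    eapply Rle_trans; [apply W|].
    replace (kap * (lc * xs ^ 2 * (2 * x))) with (2 * kap * lc * x * xs ^ 2) by (real_eq; ring).
    replace (4 * kap * lc * x * (xs ^ 2 - x ^ 2)) with (2 * kap * lc * x * (2 * (xs ^ 2 - x ^ 2))) by (real_eq; ring).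
    apply Rmult_le_compat_l; [lra|nra].
  + assert (Q : Rabs (RInt J x (xt x)) <= lc * xs ^ 2 * RInt J x xs).
    { rewrite Zx, Rabs_Ropp; apply qc_sub; try lra. intros u Hu; rewrite Rmax_right by nra; lra. }
    assert (B : RInt J x xs <= J x * (xs - x)).
    { apply rint_upper; auto; [lra|]. intros u Hu; apply jac_decr; lra. }
    assert (W : Rabs (xt x - x) <= kap * (lc * xs ^ 2 * (xs - x))).
    { assert (LL1 : 0 <= lc * xs ^ 2) by (apply Rmult_le_pos; [auto|apply pow2_ge_0]).
      apply F; [apply Rmult_le_pos; lra|lra|]. eapply Rle_trans; [apply Q|].
      assert (lc * xs ^ 2 * RInt J x xs <= lc * xs ^ 2 * (J x * (xs - x))) by (apply Rmult_le_compat_l; lra). lra. }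
    eapply Rle_trans; [apply W|].
    replace (kap * (lc * xs ^ 2 * (xs - x))) with (kap * lc * (xs * (xs * (xs - x)))) by (real_eq; ring).
    replace (4 * kap * lc * x * (xs ^ 2 - x ^ 2)) with (kap * lc * (4 * x * ((xs + x) * (xs - x)))) by (real_eq; ring).
    apply Rmult_le_compat_l; [lra|].
    apply Rmult_le_compat; try nra.
- rewrite Exs, Rminus_diag, Rabs_R0. rewrite Rminus_diag, Rabs_R0; lra.
- rewrite (Rabs_left (xs ^ 2 - x ^ 2)) by nra.
  assert (Q : Rabs (RInt J x (xt x)) <= lc * x ^ 2 * RInt J xs x).
  { assert (E : RInt J x (xt x) = RInt q xs x / c - RInt J xs x).
    { assert (C1 := rint_chasles J CJ xs x (xt x)). assert (C2 := xt_diff xs x ltac:(lra) ltac:(lra)).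
      rewrite Exs in C2. lra. }
    rewrite E; apply qc_sub; try lra. intros u Hu. apply Rmult_le_compat_l; auto.
    apply Rmax_lub; nra. }
  assert (B : RInt J xs x <= J x * (x - xs)).
  { apply rint_upper; auto; [lra|]. intros u Hu; apply jac_incr; lra. }
  assert (W : Rabs (xt x - x) <= kap * (lc * x ^ 2 * (x - xs))).
  { assert (LL : 0 <= lc * x ^ 2) by nra.
      apply F; [apply Rmult_le_pos; lra|lra|]. eapply Rle_trans; [apply Q|].
    assert (lc * x ^ 2 * RInt J xs x <= lc * x ^ 2 * (J x * (x - xs))) by (apply Rmult_le_compat_l; lra). lra. }
  eapply Rle_trans; [apply W|].
  replace (kap * (lc * x ^ 2 * (x - xs))) with (kap * lc * x * (x * (x - xs))) by (real_eq; ring).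
  replace (4 * kap * lc * x * - (xs ^ 2 - x ^ 2)) with (kap * lc * x * (4 * ((x + xs) * (x - xs)))) by (real_eq; ring).
  apply Rmult_le_compat_l; [lra|nra].
Qed.

Lemma xt_continuous x : 0 < x < X -> continuous xt x.
Proof.
intros Hx. assert (DQ : is_derive (fun x => RInt q 0 x) x (q x)) by (apply rint_derive, Cq).
apply (inverse_continuous (fun v => RInt J 0 v) xt (fun x => RInt q 0 x / c)).
- apply rint_jac_incr.
- apply xt_pos; auto.
- set (m := Rmin x (X - x)). assert (m0 : 0 < m) by (apply Rmin_glb_lt; lra).
  exists (mkposreal m m0); intros y Hy. assert (Hy' : Rabs (y - x) < m) by exact Hy.
  assert (m <= x) by apply Rmin_l. assert (m <= X - x) by apply Rmin_r.
  apply Rabs_def2 in Hy'. apply Hxt; lra.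
- apply is_derive_continuous with (q x * / c).
  apply (is_derive_scal_l (fun x => RInt q 0 x) x (q x) (/ c)); exact DQ.
Qed.

Lemma xt_derive x : 0 < x < X -> x <> xs -> is_derive xt x (q x / (c * J (xt x))).
Proof.
intros Hx N. assert (P := c_pos).
assert (Ny : xt x <> xs).
{ intros E. destruct (Rtotal_order x xs) as [H|[H|H]]; auto; assert (Exs := xt_xs).
  - assert (xt x < xt xs) by (apply xt_incr; lra). lra.
  - assert (xt xs < xt x) by (apply xt_incr; lra). lra. }
assert (JP : 0 < J (xt x)) by (apply jac_pos; [lra|left; apply xt_pos; auto|auto]).
replace (q x / (c * J (xt x))) with ((q x * / c) / J (xt x)) by (real_eq; field; lra).
apply (inverse_derive (fun v => RInt J 0 v) xt (fun x => RInt q 0 x / c)).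
- apply rint_derive, CJ.
- lra.
- apply (is_derive_scal_l (fun x => RInt q 0 x) x (q x) (/ c)). apply rint_derive, Cq.
- apply xt_continuous; auto.
- set (m := Rmin x (X - x)). assert (m0 : 0 < m) by (apply Rmin_glb_lt; lra).
  exists (mkposreal m m0); intros y Hy. assert (Hy' : Rabs (y - x) < m) by exact Hy.
  assert (m <= x) by apply Rmin_l. assert (m <= X - x) by apply Rmin_r.
  apply Rabs_def2 in Hy'. apply Hxt; lra.
Qed.

End Geometry.

(** * The Langer symbol *)

(** Only the existence of limits matters: they fill the removable singularity at [s], and their size
    follows from the bounds nearby. *)
Definition has_lim (f : R -> R) (s : R) := exists l : R, is_lim f s l.

Lemma has_lim_const k s : has_lim (fun _ => k) s.
Proof. exists k; apply is_lim_const. Qed.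

Lemma has_lim_continuous f s : continuous f s -> has_lim f s.
Proof. intros H; exists (f s); apply is_lim_continuity, continuous_pt, H. Qed.

Lemma has_lim_plus f g s : has_lim f s -> has_lim g s -> has_lim (fun t => f t + g t) s.
Proof. intros [a A] [b B]; exists (a + b); apply is_lim_plus'; auto. Qed.

Lemma has_lim_minus f g s : has_lim f s -> has_lim g s -> has_lim (fun t => f t - g t) s.
Proof. intros [a A] [b B]; exists (a - b); apply is_lim_minus'; auto. Qed.

Lemma has_lim_mult f g s : has_lim f s -> has_lim g s -> has_lim (fun t => f t * g t) s.
Proof. intros [a A] [b B]; exists (a * b); apply (is_lim_mult f g s a b); simpl; auto. Qed.

Lemma is_lim_ge (f : R -> R) (s l k al om : R) : al < s < om ->
  (forall x, al < x < om -> x <> s -> k <= f x) -> is_lim f s l -> k <= l.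
Proof.
intros Hs B H. apply Rnot_lt_le; intros C.
destruct (proj1 (is_lim_R f s l) H (k - l)) as [d [d0 Hd]]; [lra|].
assert (M : 0 < Rmin d (om - s)) by (apply Rmin_glb_lt; lra).
assert (H1 := Rmin_l d (om - s)). assert (H2 := Rmin_r d (om - s)).
set (y := s + Rmin d (om - s) / 2).
assert (Y : Rabs (f y - l) < k - l).
{ apply Hd; unfold y; [|lra].
  replace (s + _ / 2 - s) with (Rmin d (om - s) / 2) by ring; rewrite Rabs_pos_eq; lra. }
assert (Y2 : k <= f y) by (apply B; unfold y; lra).
apply Rabs_def2 in Y; lra.
Qed.

Lemma has_lim_inv f (s k al om : R) : al < s < om -> 0 < k ->
  (forall x, al < x < om -> x <> s -> k <= f x) -> has_lim f s -> has_lim (fun t => / f t) s.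
Proof.
intros Hs Hk B [l H]. assert (k <= l) by (apply (is_lim_ge f s l k al om); auto).
exists (/ l). apply (is_lim_inv f s l H). intros E; apply Rbar_finite_eq in E; lra.
Qed.

Lemma has_lim_ext f g (s al om : R) : al < s < om ->
  (forall x, al < x < om -> x <> s -> f x = g x) -> has_lim f s -> has_lim g s.
Proof. intros Hs E [l H]; exists l; apply is_lim_ext_neq with f al om; auto. Qed.

Lemma has_lim_comp f g (s k al om : R) : al < s < om -> 0 < k ->
  (forall x, al < x < om -> x <> s -> k <= g x) ->
  (forall y, k <= y -> continuous f y) -> has_lim g s -> has_lim (fun t => f (g t)) s.
Proof.
intros Hs Hk B C [l H]. assert (k <= l) by (apply (is_lim_ge g s l k al om); auto).
exists (f l). apply is_lim_comp_continuous; [auto|apply C; lra].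
Qed.

Lemma abs_mult_le a b A B : Rabs a <= A -> Rabs b <= B -> Rabs (a * b) <= A * B.
Proof. intros; rewrite Rabs_mult; apply Rmult_le_compat; auto; apply Rabs_pos. Qed.

Lemma abs_plus_le a b A B : Rabs a <= A -> Rabs b <= B -> Rabs (a + b) <= A + B.
Proof. intros; eapply Rle_trans; [apply Rabs_triang|lra]. Qed.

Lemma abs_minus_le a b A B : Rabs a <= A -> Rabs b <= B -> Rabs (a - b) <= A + B.
Proof. intros; unfold Rminus; apply abs_plus_le; auto. rewrite Rabs_Ropp; auto. Qed.

Lemma abs_pos_le a A : 0 <= a <= A -> Rabs a <= A.
Proof. intros; rewrite Rabs_pos_eq; lra. Qed.

Section Symbol.

Variables (xs X g0 g1 L L2 kp K c : R) (G G1 G2 xt : R -> R).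
Let s := xs ^ 2.
Hypothesis xs0 : 0 < xs < X.
Hypothesis g00 : 0 < g0 <= g1.
Hypothesis L0 : 0 <= L.
Hypothesis L20 : 0 <= L2.
Hypothesis K0 : 0 <= K.
Hypothesis kp3 : 3 <= kp.
Hypothesis HG : forall t, 0 < t < X ^ 2 -> g0 <= G t <= g1 /\ is_derive G t (G1 t) /\ Rabs (G1 t) <= L.
Hypothesis HG1s : continuous G1 s.
Hypothesis HG1 : forall t, 0 < t < X ^ 2 -> t <> s -> is_derive G1 t (G2 t) /\ Rabs (t * G2 t) <= L2.
Hypothesis Hc : g0 <= c <= g1.
Hypothesis HGc : forall t, 0 < t < X ^ 2 -> Rabs (G t / c - 1) <= K * Rmax t s.
Hypothesis Hxt : forall x, 0 < x < X -> 0 < xt x /\ x <= kp * xt x /\ xt x <= kp * x /\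
  Rabs (s - xt x ^ 2) <= kp ^ 2 * Rabs (s - x ^ 2) /\
  Rabs (s - x ^ 2) <= kp ^ 2 * Rabs (s - xt x ^ 2) /\
  Rabs (xt x ^ 2 - x ^ 2) <= K * x ^ 2 * Rabs (s - x ^ 2) /\
  continuous xt x.
Hypothesis Hxts : forall x, 0 < x < X -> (x < xs -> xt x < xs) /\ (xs < x -> xs < xt x).
Hypothesis xtxs : xt xs = xs.
Hypothesis Dxt : forall x, 0 < x < X -> x <> xs ->
  is_derive xt x (G (x ^ 2) * jac xs x / (c * jac xs (xt x))).

(** With [zeta t = xt (sqrt t)^2], the quotients [nu^2 = zeta / t] and [pp = (s - zeta) / (s - t)]
    are the divided differences of [zeta] at its fixed points [0] and [s]. *)
Definition nu t := xt (sqrt t) / sqrt t.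
Definition pp t := (s - xt (sqrt t) ^ 2) / (s - t).
Definition sp t := sqrt (pp t).
Definition mm t := G t / c * nu t.
Definition nu1 t := (mm t / sp t - nu t ^ 2) / (2 * t * nu t).
Definition mm1 t := G1 t / c * nu t + G t / c * nu1 t.
Definition pp1 t := (mm t / sp t - pp t) / (t - s).
Definition sp1 t := pp1 t / (2 * sp t).
(** [pp] satisfies the nonlinear equation [(t - s) * pp' + pp = mm / sqrt pp]. Its power [3 / 2]
    satisfies a linear one, [(t - s) * yy' + 3 / 2 * yy = 3 / 2 * mm], to which the regular singular
    estimates apply. *)
Definition yy t := pp t * sp t.

Lemma s_in : 0 < s < X ^ 2.
Proof. unfold s; split; nra. Qed.

Lemma sqrt_in t : 0 < t < X ^ 2 -> 0 < sqrt t < X /\ sqrt t ^ 2 = t.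
Proof.
intros H; split; [split|].
- apply sqrt_lt_R0; lra.
- rewrite <- (sqrt_pow2 X) by lra. apply sqrt_lt_1_alt; lra.
- apply pow2_sqrt; lra.
Qed.

Lemma sqrt_neq t : 0 < t < X ^ 2 -> t <> s -> sqrt t <> xs.
Proof. intros H N E; apply N; unfold s; rewrite <- E; symmetry; apply pow2_sqrt; lra. Qed.

Lemma nu_range t : 0 < t < X ^ 2 -> 0 < nu t <= kp /\ 0 < / nu t <= kp.
Proof.
intros H. destruct (sqrt_in t H) as [S1 S2]. destruct (Hxt (sqrt t) S1) as [A [B [C _]]].
assert (P : 0 < nu t) by (apply Rdiv_lt_0_compat; lra).
split; split; auto.
- unfold nu. apply Rle_div_l; lra.
- apply Rinv_0_lt_compat; auto.
- unfold nu. unfold Rdiv. rewrite Rinv_mult, Rinv_inv, Rmult_comm. apply Rle_div_l; lra.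
Qed.

Lemma pp_range t : 0 < t < X ^ 2 -> t <> s -> 0 < pp t <= kp ^ 2 /\ 0 < / pp t <= kp ^ 2.
Proof.
intros H N. destruct (sqrt_in t H) as [S1 S2]. destruct (Hxt (sqrt t) S1) as [A [_ [_ [C [D _]]]]].
rewrite S2 in C, D. destruct (Hxts (sqrt t) S1) as [E1 E2]. assert (N' := sqrt_neq t H N).
assert (P : 0 < pp t).
{ unfold pp. destruct (Rtotal_order (sqrt t) xs) as [Q|[Q|Q]]; [| lra |].
  - specialize (E1 Q). apply Rdiv_lt_0_compat; unfold s; nra.
  - specialize (E2 Q). replace ((s - xt (sqrt t) ^ 2) / (s - t)) with ((xt (sqrt t) ^ 2 - s) / (t - s)) by (field; lra).
    apply Rdiv_lt_0_compat; unfold s; nra. }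
assert (AP : 0 < Rabs (s - t)) by (apply Rabs_pos_lt; lra).
assert (B1 : pp t <= kp ^ 2).
{ rewrite <- (Rabs_pos_eq (pp t)) by lra. unfold pp, Rdiv; rewrite Rabs_mult, Rabs_inv. apply Rle_div_l; auto. }
assert (B2 : / pp t <= kp ^ 2).
{ rewrite <- (Rabs_pos_eq (/ pp t)) by (left; apply Rinv_0_lt_compat; auto).
  unfold pp, Rdiv. rewrite Rinv_mult, Rinv_inv, Rmult_comm, Rabs_mult, Rabs_inv.
  apply Rle_div_l; auto. apply Rabs_pos_lt. intros Z. unfold pp in P. rewrite Z in P. unfold Rdiv in P. lra. }
repeat split; auto. apply Rinv_0_lt_compat; auto.
Qed.

Lemma sp_sqr t : 0 < t < X ^ 2 -> t <> s -> sp t * sp t = pp t.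
Proof. intros H N; apply sqrt_sqrt; destruct (pp_range t H N); lra. Qed.

Lemma sp_range t : 0 < t < X ^ 2 -> t <> s -> 0 < sp t <= kp /\ 0 < / sp t <= kp.
Proof.
intros H N. destruct (pp_range t H N) as [[P1 P2] [P3 P4]].
assert (A : 0 < sp t) by (apply sqrt_lt_R0; auto).
assert (I : 0 < / sp t) by (apply Rinv_0_lt_compat; auto).
repeat split; auto.
- unfold sp. rewrite <- (sqrt_pow2 kp) by lra. apply sqrt_le_1_alt; auto.
- rewrite <- (sp_sqr t H N), Rinv_mult in P4. nra.
Qed.

Lemma nu_near_1 t : 0 < t < X ^ 2 -> Rabs (nu t ^ 2 - 1) <= K * Rabs (s - t).
Proof.
intros H. destruct (sqrt_in t H) as [S1 S2]. destruct (Hxt (sqrt t) S1) as [_ [_ [_ [_ [_ [C _]]]]]].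
rewrite S2 in C. unfold nu.
replace ((xt (sqrt t) / sqrt t) ^ 2 - 1) with ((xt (sqrt t) ^ 2 - t) / t).
- unfold Rdiv; rewrite Rabs_mult, Rabs_inv, (Rabs_pos_eq t) by lra. apply Rle_div_l; lra.
- rewrite <- S2 at 2 3. field. lra.
Qed.

Lemma pp_near_1 t : 0 < t < X ^ 2 -> t <> s -> Rabs (pp t - 1) <= K * t.
Proof.
intros H N. destruct (sqrt_in t H) as [S1 S2]. destruct (Hxt (sqrt t) S1) as [_ [_ [_ [_ [_ [C _]]]]]].
rewrite S2 in C. unfold pp.
replace ((s - xt (sqrt t) ^ 2) / (s - t) - 1) with (- (xt (sqrt t) ^ 2 - t) / (s - t)) by (field; lra).
unfold Rdiv; rewrite Rabs_mult, Rabs_inv, Rabs_Ropp. apply Rle_div_l; auto. apply Rabs_pos_lt; lra.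
Qed.

Lemma sqr_near_1 a e : 0 < a -> Rabs (a ^ 2 - 1) <= e -> Rabs (a - 1) <= e.
Proof.
intros Ha H. replace (a ^ 2 - 1) with ((a - 1) * (a + 1)) in H by ring. rewrite Rabs_mult in H.
rewrite (Rabs_pos_eq (a + 1)) in H by lra. assert (0 <= Rabs (a - 1)) by apply Rabs_pos. nra.
Qed.

Lemma max_bounds t : 0 < t -> t <= Rmax t s /\ s <= Rmax t s /\ Rabs (s - t) <= Rmax t s.
Proof.
intros H. assert (S := s_in). assert (A := Rmax_l t s). assert (B := Rmax_r t s).
repeat split; auto. apply Rabs_le; lra.
Qed.

Definition ka := (kp * (K * kp + K) + kp * K) + K.

(** All the factors are within a multiple of [Rmax t s] of [1]. The numerators of [nu1] and [pp1]
    are differences of such quantities, hence of size [Rmax t s] as well. *)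
Lemma mm_sp_near_1 t : 0 < t < X ^ 2 -> t <> s -> Rabs (mm t / sp t - 1) <= (ka - K) * Rmax t s.
Proof.
intros H N. destruct (nu_range t H) as [[N1 N2] _]. destruct (sp_range t H N) as [[P1 P2] [P3 P4]].
destruct (max_bounds t) as [M1 [M2 M3]]; [lra|]. assert (B := sqr_near_1 (nu t) _ N1 (nu_near_1 t H)).
assert (C : Rabs (sp t - 1) <= K * t).
{ apply sqr_near_1; auto. replace (sp t ^ 2) with (pp t) by (rewrite <- sp_sqr by auto; ring). apply pp_near_1; auto. }
set (m := Rmax t s) in *.
assert (B' : Rabs (nu t - 1) <= K * m) by (eapply Rle_trans; [apply B|apply Rmult_le_compat_l; auto]).
assert (C' : Rabs (sp t - 1) <= K * m) by (eapply Rle_trans; [apply C|apply Rmult_le_compat_l; auto]).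
assert (D : Rabs (mm t - 1) <= K * m * kp + K * m).
{ unfold mm. replace (G t / c * nu t - 1) with ((G t / c - 1) * nu t + (nu t - 1)) by ring.
  apply abs_plus_le; auto. apply abs_mult_le; auto. apply abs_pos_le; lra. }
replace (mm t / sp t - 1) with (/ sp t * (mm t - 1) - / sp t * (sp t - 1)) by (field; lra).
replace ((ka - K) * m) with (kp * (K * m * kp + K * m) + kp * (K * m)) by (unfold ka; ring).
apply abs_minus_le; apply abs_mult_le; auto; apply abs_pos_le; lra.
Qed.

Lemma mm_sp_pp t : 0 < t < X ^ 2 -> t <> s -> Rabs (mm t / sp t - pp t) <= ka * Rmax t s.
Proof.
intros H N. assert (A := mm_sp_near_1 t H N). assert (B := pp_near_1 t H N).
destruct (max_bounds t) as [M1 [M2 M3]]; [lra|].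
replace (mm t / sp t - pp t) with ((mm t / sp t - 1) - (pp t - 1)) by ring.
replace (ka * Rmax t s) with ((ka - K) * Rmax t s + K * Rmax t s) by ring.
apply abs_minus_le; auto. eapply Rle_trans; [apply B|apply Rmult_le_compat_l; auto].
Qed.

Lemma mm_sp_nu t : 0 < t < X ^ 2 -> t <> s -> Rabs (mm t / sp t - nu t ^ 2) <= ka * Rmax t s.
Proof.
intros H N. assert (A := mm_sp_near_1 t H N). assert (B := nu_near_1 t H).
destruct (max_bounds t) as [M1 [M2 M3]]; [lra|].
replace (mm t / sp t - nu t ^ 2) with ((mm t / sp t - 1) - (nu t ^ 2 - 1)) by ring.
replace (ka * Rmax t s) with ((ka - K) * Rmax t s + K * Rmax t s) by ring.
apply abs_minus_le; auto. eapply Rle_trans; [apply B|apply Rmult_le_compat_l; auto].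
Qed.

Lemma ka_nonneg : 0 <= ka.
Proof. unfold ka. nra. Qed.

(* Since [zeta = t * nu^2] and [s - zeta = pp * (s - t)], everything follows from [zeta' = mm / sp]. *)
Lemma zeta_derive t : 0 < t < X ^ 2 -> t <> s ->
  is_derive (fun t => xt (sqrt t) ^ 2) t (mm t / sp t).
Proof.
intros H N. destruct (sqrt_in t H) as [S1 S2]. assert (N' := sqrt_neq t H N).
assert (D := Dxt (sqrt t) S1 N'). rewrite S2 in D.
destruct (sp_range t H N) as [[P1 _] _]. destruct (Hxt (sqrt t) S1) as [Y0 _].
assert (Js : jac xs (xt (sqrt t)) = sp t * jac xs (sqrt t)).
{ unfold jac, sp. rewrite <- sqrt_mult_alt by (destruct (pp_range t H N); lra). f_equal. rewrite S2.
  rewrite <- (Rabs_pos_eq (pp t)) by (destruct (pp_range t H N); lra). rewrite <- Rabs_mult. f_equal.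
  unfold pp, s. field. fold s; lra. }
assert (J0 : 0 < jac xs (sqrt t)) by (apply jac_pos; lra).
evar_last.
- apply (is_derive_comp (fun y => y ^ 2) (fun t => xt (sqrt t))).
  + instantiate (1 := 2 * xt (sqrt t)). auto_derive; auto. ring.
  + apply (is_derive_comp xt sqrt); [exact D|].
    instantiate (1 := / (2 * sqrt t)). apply is_derive_Reals, derivable_pt_lim_sqrt; lra.
- unfold scal; simpl; unfold mult; simpl. rewrite Js. unfold mm, nu. field.
  repeat split; lra.
Qed.

Lemma nu_sqr t : 0 < t < X ^ 2 -> nu t ^ 2 = xt (sqrt t) ^ 2 / t.
Proof.
intros H. destruct (sqrt_in t H) as [S1 S2]. unfold nu.
replace (xt (sqrt t) ^ 2 / t) with (xt (sqrt t) ^ 2 / sqrt t ^ 2) by (rewrite S2; reflexivity). field. lra.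
Qed.

Lemma locally_in t : 0 < t < X ^ 2 -> t <> s -> locally t (fun r => 0 < r < X ^ 2 /\ r <> s).
Proof.
intros H N. apply filter_and; [|apply locally_neq; auto].
apply filter_and.
- apply (open_gt 0 t); lra.
- apply (open_lt (X ^ 2) t); lra.
Qed.

Lemma nu_derive t : 0 < t < X ^ 2 -> t <> s -> is_derive nu t (nu1 t).
Proof.
intros H N. destruct (nu_range t H) as [[N1 N2] _].
apply is_derive_ext_loc with (fun t => sqrt (xt (sqrt t) ^ 2 / t)).
{ generalize (locally_in t H N); apply filter_imp; intros r [Hr _].
  rewrite <- nu_sqr by auto. apply sqrt_pow2. destruct (nu_range r Hr); lra. }
evar_last.
- apply (is_derive_comp sqrt (fun t => xt (sqrt t) ^ 2 / t)).
  + apply is_derive_Reals, derivable_pt_lim_sqrt. rewrite <- nu_sqr by auto. nra.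
  + apply (is_derive_div (fun t => xt (sqrt t) ^ 2) (fun t => t)); [apply zeta_derive; auto|apply (is_derive_id t)|lra].
- rewrite <- nu_sqr, sqrt_pow2 by (auto; lra).
  unfold scal, minus, plus, opp, one; simpl; unfold mult; simpl.
  assert (E := nu_sqr t H). simpl in E.
  assert (E2 : xt (sqrt t) * (xt (sqrt t) * 1) = nu t * nu t * t).
  { replace (nu t * nu t) with (nu t * (nu t * 1)) by ring. rewrite E. field. lra. }
  rewrite E2. unfold nu1. destruct (sp_range t H N) as [[P1 _] _]. field. repeat split; lra.
Qed.

Lemma pp_derive t : 0 < t < X ^ 2 -> t <> s -> is_derive pp t (pp1 t).
Proof.
intros H N. unfold pp at 1. evar_last.
- apply (is_derive_div (fun t => s - xt (sqrt t) ^ 2) (fun t => s - t)).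
  + apply (is_derive_minus (fun _ => s) (fun t => xt (sqrt t) ^ 2)); [apply (is_derive_const s)|apply zeta_derive; auto].
  + instantiate (1 := -1). auto_derive; auto; ring.
  + lra.
- unfold minus, plus, opp, zero; simpl. unfold pp1, pp. destruct (sp_range t H N) as [[P1 _] _].
  field. repeat split; lra.
Qed.

Lemma sp_derive t : 0 < t < X ^ 2 -> t <> s -> is_derive sp t (sp1 t).
Proof.
intros H N. destruct (pp_range t H N) as [[P1 _] _]. unfold sp at 1. evar_last.
- apply (is_derive_comp sqrt pp); [apply is_derive_Reals, derivable_pt_lim_sqrt; auto|apply pp_derive; auto].
- unfold scal; simpl; unfold mult; simpl. unfold sp1, sp. field. apply Rgt_not_eq, sqrt_lt_R0; auto.
Qed.

Lemma mm_derive t : 0 < t < X ^ 2 -> t <> s -> is_derive mm t (mm1 t).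
Proof.
intros H N. destruct (HG t H) as [_ [D _]]. evar_last.
- apply (is_derive_mult (fun t => G t / c) nu t).
  + apply (is_derive_scal_l G t (G1 t) (/ c)); exact D.
  + apply nu_derive; auto.
  + intros; apply Rmult_comm.
- unfold plus, mult, scal; simpl; unfold mult; simpl. unfold mm1; field; lra.
Qed.

Definition kn := ka * kp.
Definition km := L / g0 * kp + g1 / g0 * kn.

Lemma cinv : 0 < / c <= / g0.
Proof. split; [apply Rinv_0_lt_compat; lra|apply Rinv_le_contravar; lra]. Qed.

Lemma Gc_le t : 0 < t < X ^ 2 -> Rabs (G t / c) <= g1 / g0.
Proof. intros H; destruct (HG t H) as [[A B] _]. assert (C := cinv). apply abs_mult_le; apply abs_pos_le; lra. Qed.

Lemma G1c_le t : 0 < t < X ^ 2 -> Rabs (G1 t / c) <= L / g0.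
Proof. intros H; destruct (HG t H) as [_ [_ A]]. assert (C := cinv). apply abs_mult_le; auto; apply abs_pos_le; lra. Qed.

Lemma nu1_bound t : 0 < t < X ^ 2 -> t <> s -> Rabs (t * nu1 t) <= kn * Rmax t s.
Proof.
intros H N. destruct (nu_range t H) as [[N1 N2] [N3 N4]].
replace (t * nu1 t) with ((mm t / sp t - nu t ^ 2) * (/ nu t / 2)) by (unfold nu1; field; repeat split; try lra; destruct (sp_range t H N); lra).
replace (kn * Rmax t s) with (ka * Rmax t s * kp) by (unfold kn; ring).
apply abs_mult_le; [apply mm_sp_nu; auto|apply abs_pos_le; lra].
Qed.

Lemma km_nonneg : 0 <= kn /\ 0 <= km /\ 0 <= L / g0 /\ 0 < g1 / g0.
Proof.
assert (A := ka_nonneg). assert (0 <= kn) by (unfold kn; nra).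
assert (0 <= L / g0) by (apply Rmult_le_pos; auto; left; apply Rinv_0_lt_compat; lra).
assert (0 < g1 / g0) by (apply Rdiv_lt_0_compat; lra).
repeat split; auto. unfold km. nra.
Qed.

Lemma mm1_bound t : 0 < t < X ^ 2 -> t <> s -> Rabs (t * mm1 t) <= km * Rmax t s.
Proof.
intros H N. destruct (nu_range t H) as [[N1 N2] [N3 N4]]. destruct (max_bounds t) as [M1 [M2 M3]]; [lra|].
destruct km_nonneg as [Q1 [Q2 [Q3 Q4]]].
replace (t * mm1 t) with (G1 t / c * nu t * t + G t / c * (t * nu1 t)) by (unfold mm1; ring).
replace (km * Rmax t s) with (L / g0 * kp * Rmax t s + g1 / g0 * (kn * Rmax t s)) by (unfold km; ring).
apply abs_plus_le.
- apply abs_mult_le; [|apply abs_pos_le; lra]. apply abs_mult_le; [apply G1c_le; auto|apply abs_pos_le; lra].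
- apply abs_mult_le; [apply Gc_le; auto|apply nu1_bound; auto].
Qed.

Lemma max_near t : s / 2 <= t -> Rmax t s <= 2 * t.
Proof. intros H; assert (S := s_in); apply Rmax_lub; lra. Qed.

(** For [t >= s / 2] the size [Rmax t s] is at most [2 * t], so division by [t] is harmless
    there. *)
Lemma near_div t y k : s / 2 <= t -> 0 < t -> 0 <= k -> Rabs (t * y) <= k * Rmax t s -> Rabs y <= 2 * k.
Proof.
intros Hs H Hk B. assert (M := max_near t Hs). rewrite Rabs_mult, (Rabs_pos_eq t) in B by lra.
apply Rmult_le_reg_l with t; auto. nra.
Qed.

Lemma yy_near t : 0 < t < X ^ 2 -> t <> s -> is_derive yy t ((3 / 2 * mm t - 3 / 2 * yy t) / (t - s)).
Proof.
intros H N. destruct (sp_range t H N) as [[P1 _] _]. assert (E := sp_sqr t H N). evar_last.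
- apply (is_derive_mult pp sp t); [apply pp_derive; auto|apply sp_derive; auto|intros; apply Rmult_comm].
- unfold plus, mult; simpl. unfold sp1, pp1, yy. rewrite <- E. field. repeat split; lra.
Qed.

Lemma yy_lim0 : is_lim (fun t => (t - s) * yy t) s 0.
Proof.
apply is_lim_R; intros e He. assert (S := s_in).
set (B := kp ^ 2 * kp + 1). assert (B0 : 0 < B) by (unfold B; nra).
exists (Rmin (e / B) (Rmin s (X ^ 2 - s))); split.
{ repeat apply Rmin_glb_lt; try lra. apply Rdiv_lt_0_compat; auto. }
intros t Ht N.
assert (A1 := Rmin_l (e / B) (Rmin s (X ^ 2 - s))). assert (A2 := Rmin_r (e / B) (Rmin s (X ^ 2 - s))).
assert (A3 := Rmin_l s (X ^ 2 - s)). assert (A4 := Rmin_r s (X ^ 2 - s)).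
assert (Hs : 0 < t < X ^ 2) by (apply Rabs_def2 in Ht; lra).
rewrite Rminus_0_r. destruct (pp_range t Hs N) as [P _]. destruct (sp_range t Hs N) as [Q _].
assert (Y : Rabs (yy t) <= kp ^ 2 * kp) by (apply abs_mult_le; apply abs_pos_le; lra).
rewrite Rabs_mult. apply Rle_lt_trans with (Rabs (t - s) * B).
- apply Rmult_le_compat_l; [apply Rabs_pos|unfold B; lra].
- assert (T : Rabs (t - s) < e / B) by lra. apply Rmult_lt_compat_r with (r := B) in T; auto.
  unfold Rdiv in T. rewrite Rmult_assoc, Rinv_l in T; lra.
Qed.

Lemma nu_lim : has_lim nu s.
Proof.
apply has_lim_continuous. unfold nu. assert (S := s_in). destruct (sqrt_in s S) as [S1 S2].
apply (continuous_mult (fun t => xt (sqrt t)) (fun t => / sqrt t)).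
- apply (continuous_comp sqrt xt); [apply continuous_sqrt|apply Hxt; auto].
- apply is_derive_continuous with (- / (2 * sqrt s) / sqrt s ^ 2).
  apply (is_derive_inv sqrt s); [|lra]. apply is_derive_Reals, derivable_pt_lim_sqrt; lra.
Qed.

Lemma G_lim : has_lim G s /\ has_lim G1 s.
Proof.
split; [|apply has_lim_continuous, HG1s]. apply has_lim_continuous, is_derive_continuous with (G1 s), HG, s_in.
Qed.

Lemma mm_lim : has_lim mm s.
Proof.
unfold mm. apply has_lim_mult; [|apply nu_lim]. apply has_lim_mult; [apply G_lim|apply has_lim_const].
Qed.

Lemma yy_lim : has_lim yy s.
Proof.
destruct (has_lim_mult _ _ s (has_lim_const (3 / 2) s) mm_lim) as [b0 B0].
exists (b0 / (3 / 2)). apply (rs_y_lim (3 / 2) s 0 (X ^ 2) yy (fun t => 3 / 2 * mm t)); auto; [lra|apply s_in| |apply yy_lim0].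
intros t H N; apply yy_near; auto.
Qed.

(** Only [yy] obeys a linear equation, so its limit comes first and [sp] is recovered as its cube
    root. *)
Lemma sp_lim : has_lim sp s.
Proof.
assert (S := s_in).
apply has_lim_ext with (fun t => Rpower (yy t) (1 / 3)) 0 (X ^ 2); auto.
{ intros t H N. destruct (sp_range t H N) as [[P1 _] _]. unfold yy. rewrite <- (sp_sqr t H N).
  replace (sp t * sp t * sp t) with (sp t ^ 3) by ring. rewrite <- Rpower_pow by auto.
  rewrite Rpower_mult. replace (INR 3 * (1 / 3)) with 1 by (simpl; field). apply Rpower_1; auto. }
apply (has_lim_comp (fun y => Rpower y (1 / 3)) yy s (/ kp ^ 2 * / kp) 0 (X ^ 2)); auto.
- apply Rmult_lt_0_compat; apply Rinv_0_lt_compat; nra.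
- intros t H N. destruct (sp_range t H N) as [[P1 P2] [P3 P4]]. destruct (pp_range t H N) as [[Q1 Q2] [Q3 Q4]].
  unfold yy. apply Rmult_le_compat; try (left; apply Rinv_0_lt_compat; nra).
  + rewrite <- (Rinv_inv (pp t)). apply Rinv_le_contravar; auto.
  + rewrite <- (Rinv_inv (sp t)). apply Rinv_le_contravar; auto.
- intros y Hy. assert (0 < / kp ^ 2 * / kp) by (apply Rmult_lt_0_compat; apply Rinv_0_lt_compat; nra).
  apply is_derive_continuous with (1 / 3 * / y * Rpower y (1 / 3)). unfold Rpower. auto_derive; [lra|]. field; lra.
- apply yy_lim.
Qed.

Lemma inv_ge a k : 0 < a -> / a <= k -> / k <= a.
Proof. intros H1 H2. rewrite <- (Rinv_inv a). apply Rinv_le_contravar; auto. apply Rinv_0_lt_compat; auto. Qed.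

Lemma sp_inv_lim : has_lim (fun t => / sp t) s.
Proof.
apply (has_lim_inv sp s (/ kp) 0 (X ^ 2)); [apply s_in|apply Rinv_0_lt_compat; lra| |apply sp_lim].
intros t H N. destruct (sp_range t H N) as [[P1 P2] [P3 P4]]. apply inv_ge; auto.
Qed.

Lemma nu_inv_lim : has_lim (fun t => / (2 * t * nu t)) s.
Proof.
assert (S := s_in).
apply (has_lim_inv (fun t => 2 * t * nu t) s (s * / kp) (s / 2) (X ^ 2)); [lra|apply Rmult_lt_0_compat; [lra|apply Rinv_0_lt_compat; lra]| |].
- intros t H N. destruct (nu_range t) as [[P1 P2] [P3 P4]]; [lra|].
  apply Rmult_le_compat; try lra; [left; apply Rinv_0_lt_compat; lra|apply inv_ge; auto].
- apply has_lim_mult; [|apply nu_lim]. apply has_lim_continuous, is_derive_continuous with 2. auto_derive; auto; ring.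
Qed.

Lemma mm1_lim : has_lim mm1 s.
Proof.
assert (N1 : has_lim nu1 s).
{ unfold nu1. apply has_lim_mult; [|apply nu_inv_lim].
  apply has_lim_minus.
  - apply has_lim_mult; [apply mm_lim|apply sp_inv_lim].
  - apply has_lim_mult; [apply nu_lim|]. apply has_lim_mult; [apply nu_lim|apply has_lim_const]. }
unfold mm1. apply has_lim_plus; apply has_lim_mult; auto; try apply nu_lim; apply has_lim_mult; try apply has_lim_const; apply G_lim.
Qed.

Lemma yy1_bound t : 0 < t < X ^ 2 -> t <> s -> s / 2 <= t ->
  Rabs ((3 / 2 * mm t - 3 / 2 * yy t) / (t - s)) <= 3 / 2 * (2 * km).
Proof.
intros H N Hs. assert (S := s_in). destruct km_nonneg as [_ [Q _]].
destruct (has_lim_mult _ _ s (has_lim_const (3 / 2) s) mm_lim) as [b0 B0].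
apply Rle_trans with (3 / 2 * (2 * km) / (3 / 2 + 1)).
- apply (rs_y1_bound (3 / 2) s 0 (X ^ 2) yy (fun t => 3 / 2 * mm t) (fun t => 3 / 2 * mm1 t)) with (b0 := b0); auto; try lra.
  + intros r Hr Nr; apply yy_near; auto.
  + apply yy_lim0.
  + intros r Hr Nr; apply (is_derive_scal mm r (3 / 2)), mm_derive; auto.
  + intros r Hr. assert (Hr' : 0 < r < X ^ 2 /\ r <> s /\ s / 2 <= r).
    { unfold Rmin, Rmax in Hr; destruct (Rle_dec s t); lra. }
    apply abs_mult_le; [apply abs_pos_le; lra|]. apply near_div with r; try lra. apply mm1_bound; tauto.
- apply Rle_div_l; lra.
Qed.

Definition kp1 := 2 * ka + kp * (2 * km).

(** Outside [(s / 2, 2 * s)] the distance to [s] is comparable to [Rmax t s], so [t - s] can be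
    divided out directly; the singular equation is needed only near [s]. *)
Lemma far_dist t : 0 < t -> (t <= s / 2 \/ 2 * s <= t) -> Rmax t s <= 2 * Rabs (t - s).
Proof.
intros H [Q|Q]; assert (S := s_in).
- rewrite Rabs_left by lra. apply Rmax_lub; lra.
- rewrite Rabs_pos_eq by lra. apply Rmax_lub; lra.
Qed.

Lemma far_div t y k : 0 < t -> t <> s -> (t <= s / 2 \/ 2 * s <= t) -> 0 <= k -> Rabs y <= k * Rmax t s ->
  Rabs (y / (t - s)) <= 2 * k.
Proof.
intros H N Q Hk B. assert (D := far_dist t H Q). assert (P : 0 < Rabs (t - s)) by (apply Rabs_pos_lt; lra).
unfold Rdiv; rewrite Rabs_mult, Rabs_inv. apply Rle_div_l; auto. nra.
Qed.

Lemma pp1_yy t : 0 < t < X ^ 2 -> t <> s -> pp1 t = 2 / 3 * / sp t * ((3 / 2 * mm t - 3 / 2 * yy t) / (t - s)).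
Proof.
intros H N. destruct (sp_range t H N) as [[P1 _] _]. unfold pp1, yy. rewrite <- (sp_sqr t H N). field. repeat split; lra.
Qed.

Lemma pp1_bound t : 0 < t < X ^ 2 -> t <> s -> Rabs (pp1 t) <= kp1.
Proof.
intros H N. destruct km_nonneg as [_ [Q _]]. assert (A := ka_nonneg). destruct (sp_range t H N) as [[P1 P2] [P3 P4]].
destruct (Rle_lt_dec (s / 2) t) as [Hs|Hs].
- rewrite pp1_yy by auto. apply Rle_trans with (2 / 3 * kp * (3 / 2 * (2 * km))); [|unfold kp1; nra].
  apply abs_mult_le; [|apply yy1_bound; auto]. apply abs_pos_le; lra.
- apply Rle_trans with (2 * ka); [|unfold kp1; nra]. apply far_div; auto; try lra. apply mm_sp_pp; auto.
Qed.

Lemma yy1_lim : has_lim (fun t => (3 / 2 * mm t - 3 / 2 * yy t) / (t - s)) s.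
Proof.
destruct (has_lim_mult _ _ s (has_lim_const (3 / 2) s) mm_lim) as [b0 B0].
destruct (has_lim_mult _ _ s (has_lim_const (3 / 2) s) mm1_lim) as [b1 B1].
exists (b1 / (3 / 2 + 1)).
apply (rs_y1_lim (3 / 2) s 0 (X ^ 2) yy (fun t => 3 / 2 * mm t) (fun t => 3 / 2 * mm1 t)) with (b0 := b0); auto; try lra.
- apply s_in.
- intros r Hr Nr; apply yy_near; auto.
- apply yy_lim0.
- intros r Hr Nr; apply (is_derive_scal mm r (3 / 2)), mm_derive; auto.
Qed.

Lemma pp1_lim : has_lim pp1 s.
Proof.
apply has_lim_ext with (fun t => 2 / 3 * / sp t * ((3 / 2 * mm t - 3 / 2 * yy t) / (t - s))) 0 (X ^ 2); [apply s_in| |].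
- intros t H N; symmetry; apply pp1_yy; auto.
- apply has_lim_mult; [|apply yy1_lim]. apply has_lim_mult; [apply has_lim_const|apply sp_inv_lim].
Qed.

Definition dd t := mm1 t / sp t - mm t * sp1 t / sp t ^ 2.
Definition nu2 t := (dd t - 2 * nu t * nu1 t - nu1 t * (2 * nu t + 2 * t * nu1 t)) / (2 * t * nu t).
Definition mm2 t := G2 t / c * nu t + 2 * (G1 t / c) * nu1 t + G t / c * nu2 t.
Definition pp2 t := (dd t - 2 * pp1 t) / (t - s).

Lemma dd_derive t : 0 < t < X ^ 2 -> t <> s -> is_derive (fun t => mm t / sp t) t (dd t).
Proof.
intros H N. destruct (sp_range t H N) as [[P1 _] _]. evar_last.
- apply (is_derive_div mm sp t); [apply mm_derive; auto|apply sp_derive; auto|lra].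
- unfold dd. field; lra.
Qed.

Lemma nu1_derive t : 0 < t < X ^ 2 -> t <> s -> is_derive nu1 t (nu2 t).
Proof.
intros H N. destruct (sp_range t H N) as [[P1 _] _]. destruct (nu_range t H) as [[N1 N2] [N3 N4]]. evar_last.
- apply (is_derive_div (fun t => mm t / sp t - nu t ^ 2) (fun t => 2 * t * nu t)).
  + apply (is_derive_minus (fun t => mm t / sp t) (fun t => nu t ^ 2)); [apply dd_derive; auto|].
    apply (is_derive_comp (fun y => y ^ 2) nu); [|apply nu_derive; auto].
    instantiate (1 := 2 * nu t). auto_derive; auto; ring.
  + apply (is_derive_mult (fun t => 2 * t) nu t); [|apply nu_derive; auto|intros; apply Rmult_comm].
    instantiate (1 := 2). auto_derive; auto; ring.
  + assert (0 < t * nu t) by (apply Rmult_lt_0_compat; lra). simpl; lra.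
- unfold scal, minus, plus, opp, mult; simpl; unfold mult; simpl. unfold nu2.
  replace (nu1 t) with ((mm t / sp t - nu t ^ 2) / (2 * t * nu t)) at 4 by reflexivity.
  field. repeat split; lra.
Qed.

Lemma mm1_derive t : 0 < t < X ^ 2 -> t <> s -> is_derive mm1 t (mm2 t).
Proof.
intros H N. destruct (HG t H) as [_ [D _]]. destruct (HG1 t H N) as [D1 _]. unfold mm1 at 1. evar_last.
- apply (is_derive_plus (fun t => G1 t / c * nu t) (fun t => G t / c * nu1 t)).
  + apply (is_derive_mult (fun t => G1 t / c) nu t).
    * apply (is_derive_scal_l G1 t (G2 t) (/ c)); exact D1.
    * apply nu_derive; auto.
    * intros; apply Rmult_comm.
  + apply (is_derive_mult (fun t => G t / c) nu1 t).
    * apply (is_derive_scal_l G t (G1 t) (/ c)); exact D.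
    * apply nu1_derive; auto.
    * intros; apply Rmult_comm.
- unfold plus, mult, scal; simpl; unfold mult; simpl. unfold mm2; field; lra.
Qed.

Lemma pp1_derive t : 0 < t < X ^ 2 -> t <> s -> is_derive pp1 t (pp2 t).
Proof.
intros H N. destruct (sp_range t H N) as [[P1 _] _]. unfold pp1 at 1. evar_last.
- apply (is_derive_div (fun t => mm t / sp t - pp t) (fun t => t - s)).
  + apply (is_derive_minus (fun t => mm t / sp t) pp); [apply dd_derive; auto|apply pp_derive; auto].
  + instantiate (1 := 1). auto_derive; auto; ring.
  + lra.
- unfold minus, plus, opp; simpl. unfold pp2.
  replace ((dd t - 2 * pp1 t) / (t - s)) with ((dd t - pp1 t) / (t - s) - pp1 t / (t - s)) by (field; lra).
  unfold pp1 at 3. field. repeat split; lra.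
Qed.

Definition kdd := km * kp + g1 / g0 * kp * (kp1 * kp) * kp ^ 2.
Definition kn2 := (2 * kdd + 2 * kp * (2 * kn) + 2 * kn * (2 * kp + 2 * X ^ 2 * (2 * kn))) * kp.
Definition km2 := L2 / g0 * kp + 2 * (L / g0) * X ^ 2 * (2 * kn) + g1 / g0 * kn2.
Definition kp2 := (kp * (2 * km2) + X ^ 2 * (kp1 ^ 2 * kp ^ 2)) + 2 * (kdd + 2 * kp1).

Lemma kp1_nonneg : 0 <= kp1 /\ 0 <= kdd /\ 0 <= kn2 /\ 0 <= km2.
Proof.
destruct km_nonneg as [Q1 [Q2 [Q3 Q4]]]. assert (A := ka_nonneg).
assert (B : 0 <= kp1) by (unfold kp1; nra).
assert (C : 0 <= kdd).
{ unfold kdd. apply Rplus_le_le_0_compat; [nra|].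
  repeat apply Rmult_le_pos; try apply pow2_ge_0; try lra. left; apply Rinv_0_lt_compat; lra. }
assert (X2 : 0 <= X ^ 2) by apply pow2_ge_0.
assert (D : 0 <= kn2).
{ unfold kn2. apply Rmult_le_pos; [|lra]. nra. }
repeat split; auto. unfold km2.
assert (0 <= L2 / g0) by (apply Rmult_le_pos; auto; left; apply Rinv_0_lt_compat; lra).
assert (0 <= L / g0 * (X ^ 2 * kn)) by (apply Rmult_le_pos; auto; apply Rmult_le_pos; auto). nra.
Qed.

Lemma mm_le t : 0 < t < X ^ 2 -> Rabs (mm t) <= g1 / g0 * kp.
Proof. intros H; apply abs_mult_le; [apply Gc_le; auto|]. destruct (nu_range t H); apply abs_pos_le; lra. Qed.

Lemma sp1_bound t : 0 < t < X ^ 2 -> t <> s -> Rabs (sp1 t) <= kp1 * kp.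
Proof.
intros H N. destruct (sp_range t H N) as [[P1 P2] [P3 P4]]. destruct kp1_nonneg as [Q _].
unfold sp1. replace (pp1 t / (2 * sp t)) with (pp1 t * (/ sp t / 2)) by (field; lra).
apply abs_mult_le; [apply pp1_bound; auto|apply abs_pos_le; lra].
Qed.

Lemma dd_bound t : 0 < t < X ^ 2 -> t <> s -> Rabs (t * dd t) <= kdd * Rmax t s.
Proof.
intros H N. destruct (sp_range t H N) as [[P1 P2] [P3 P4]]. destruct (max_bounds t) as [M1 [M2 M3]]; [lra|].
destruct kp1_nonneg as [Q1 _]. destruct km_nonneg as [_ [Q2 [Q3 Q4]]].
replace (t * dd t) with ((t * mm1 t) * / sp t - mm t * sp1 t * (/ sp t) ^ 2 * t) by (unfold dd; field; lra).
replace (kdd * Rmax t s) with (km * Rmax t s * kp + g1 / g0 * kp * (kp1 * kp) * kp ^ 2 * Rmax t s) by (unfold kdd; ring).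
apply abs_minus_le.
- apply abs_mult_le; [apply mm1_bound; auto|apply abs_pos_le; lra].
- apply abs_mult_le; [|apply abs_pos_le; lra]. apply abs_mult_le; [apply abs_mult_le; [apply mm_le|apply sp1_bound]; auto|].
  apply abs_pos_le; split; [apply pow2_ge_0|]. apply pow_incr; lra.
Qed.

Lemma nu2_bound t : 0 < t < X ^ 2 -> t <> s -> s / 2 <= t -> Rabs (t * nu2 t) <= kn2.
Proof.
intros H N Hs. destruct (nu_range t H) as [[N1 N2] [N3 N4]].
destruct kp1_nonneg as [Q1 [Q5 _]]. destruct km_nonneg as [Q2 _].
assert (B1 : Rabs (nu1 t) <= 2 * kn) by (apply near_div with t; try lra; apply nu1_bound; auto).
assert (B2 : Rabs (dd t) <= 2 * kdd) by (apply near_div with t; try lra; apply dd_bound; auto).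
replace (t * nu2 t) with ((dd t - 2 * nu t * nu1 t - nu1 t * (2 * nu t + 2 * t * nu1 t)) * (/ nu t / 2)) by (unfold nu2; field; lra).
unfold kn2. apply abs_mult_le; [|apply abs_pos_le; lra].
apply abs_minus_le; [apply abs_minus_le; auto|].
- apply abs_mult_le; auto. apply abs_pos_le; lra.
- apply abs_mult_le; auto. apply abs_plus_le; [apply abs_pos_le; lra|].
  apply abs_mult_le; auto. apply abs_pos_le; lra.
Qed.

Lemma mm2_bound t : 0 < t < X ^ 2 -> t <> s -> s / 2 <= t -> Rabs (t * mm2 t) <= km2.
Proof.
intros H N Hs. destruct (nu_range t H) as [[N1 N2] [N3 N4]]. destruct (HG1 t H N) as [_ BG].
destruct km_nonneg as [Q2 [_ [Q3 _]]]. assert (C := cinv).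
assert (B1 : Rabs (nu1 t) <= 2 * kn) by (apply near_div with t; try lra; apply nu1_bound; auto).
replace (t * mm2 t) with ((t * G2 t) * / c * nu t + 2 * (G1 t / c) * t * nu1 t + G t / c * (t * nu2 t)) by (unfold mm2; field; lra).
unfold km2. apply abs_plus_le; [apply abs_plus_le|].
- apply abs_mult_le; [|apply abs_pos_le; lra]. apply abs_mult_le; auto; apply abs_pos_le; lra.
- apply abs_mult_le; auto. apply abs_mult_le; [|apply abs_pos_le; lra].
  apply abs_mult_le; [apply abs_pos_le; lra|apply G1c_le; auto].
- apply abs_mult_le; [apply Gc_le; auto|apply nu2_bound; auto].
Qed.

Definition yy1 t := (3 / 2 * mm t - 3 / 2 * yy t) / (t - s).

(** Second pass of the singular estimate, for [yy1] with exponent [5 / 2]. Only [t * mm2 t] is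
    bounded, so [1 / r] is replaced by [2 / s] on the interval concerned, and [t <= 2 * s] allows
    multiplying back by [t]. *)
Lemma yy2_bound t : 0 < t < X ^ 2 -> t <> s -> s / 2 <= t <= 2 * s ->
  Rabs (t * ((3 / 2 * mm1 t - (3 / 2 + 1) * yy1 t) / (t - s))) <= 2 * km2.
Proof.
intros H N Hs. assert (S := s_in). destruct kp1_nonneg as [_ [_ [_ Q]]].
destruct (has_lim_mult _ _ s (has_lim_const (3 / 2) s) mm_lim) as [b0 B0].
destruct (has_lim_mult _ _ s (has_lim_const (3 / 2) s) mm1_lim) as [b1 B1].
assert (Dm : forall r, 0 < r < X ^ 2 -> r <> s -> is_derive (fun t => 3 / 2 * mm t) r (3 / 2 * mm1 r)).
{ intros r Hr Nr; apply (is_derive_scal mm r (3 / 2)), mm_derive; auto. }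
assert (B : Rabs ((3 / 2 * mm1 t - (3 / 2 + 1) * yy1 t) / (t - s)) <= (3 / 2 * (km2 * (2 * / s))) / (3 / 2 + 1 + 1)).
{ apply (rs_y1_bound (3 / 2 + 1) s 0 (X ^ 2) yy1 (fun t => 3 / 2 * mm1 t) (fun t => 3 / 2 * mm2 t)) with (b0 := b1); auto; try lra.
  - intros r Hr Nr. apply (rs_y1_derive (3 / 2) s 0 (X ^ 2) yy (fun t => 3 / 2 * mm t) (fun t => 3 / 2 * mm1 t)); auto.
    intros u Hu Nu; apply yy_near; auto.
  - apply (rs_y1_lim0 (3 / 2) s 0 (X ^ 2) yy (fun t => 3 / 2 * mm t)) with (b0 := b0); auto; try lra.
    + intros r Hr Nr; apply yy_near; auto.
    + apply yy_lim0.
  - intros r Hr Nr; apply (is_derive_scal mm1 r (3 / 2)), mm1_derive; auto.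
  - intros r Hr. assert (Hr' : 0 < r < X ^ 2 /\ r <> s /\ s / 2 <= r).
    { unfold Rmin, Rmax in Hr; destruct (Rle_dec s t); lra. }
    apply abs_mult_le; [apply abs_pos_le; lra|].
    assert (M := mm2_bound r (proj1 Hr') (proj1 (proj2 Hr')) (proj2 (proj2 Hr'))).
    rewrite Rabs_mult, (Rabs_pos_eq r) in M by lra.
    apply Rmult_le_reg_l with r; [lra|]. eapply Rle_trans; [apply M|].
    replace (r * (km2 * (2 * / s))) with (km2 * (r * 2 * / s)) by ring.
    rewrite <- (Rmult_1_r km2) at 1. apply Rmult_le_compat_l; auto.
    apply Rmult_le_reg_r with s; [lra|]. rewrite Rmult_assoc, Rinv_l; lra. }
rewrite Rabs_mult, (Rabs_pos_eq t) by lra.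
apply Rle_trans with (2 * s * ((3 / 2 * (km2 * (2 * / s))) / (3 / 2 + 1 + 1))).
- apply Rmult_le_compat; auto; try lra. apply Rabs_pos.
- replace (2 * s * (3 / 2 * (km2 * (2 * / s)) / (3 / 2 + 1 + 1))) with (12 / 7 * km2) by (field; lra). lra.
Qed.

(** Two differentiations of [pp = yy^(2/3)]. *)
Lemma pp2_yy t : 0 < t < X ^ 2 -> t <> s ->
  t * pp2 t = 2 / 3 * / sp t * (t * ((3 / 2 * mm1 t - (3 / 2 + 1) * yy1 t) / (t - s))) - t * (pp1 t ^ 2 * (/ pp t / 2)).
Proof.
intros H N. destruct (sp_range t H N) as [[P1 _] _].
unfold pp2, dd, sp1, yy1, yy, pp1. rewrite <- (sp_sqr t H N). field. repeat split; lra.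
Qed.

Lemma pp2_bound t : 0 < t < X ^ 2 -> t <> s -> Rabs (t * pp2 t) <= kp2.
Proof.
intros H N. destruct (sp_range t H N) as [[P1 P2] [P3 P4]]. destruct (pp_range t H N) as [[R1 R2] [R3 R4]].
destruct kp1_nonneg as [Q1 [Q2 [Q3 Q4]]]. destruct (max_bounds t) as [M1 [M2 M3]]; [lra|].
assert (X2 : 0 <= X ^ 2) by apply pow2_ge_0.
assert (Z1 : 0 <= kp * (2 * km2)) by nra.
assert (Z2 : 0 <= X ^ 2 * (kp1 ^ 2 * kp ^ 2)) by (apply Rmult_le_pos; auto; apply Rmult_le_pos; apply pow2_ge_0).
destruct (Rle_lt_dec (s / 2) t) as [Hs|Hs].
- destruct (Rle_lt_dec t (2 * s)) as [Hs2|Hs2].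
  + rewrite pp2_yy by auto. apply Rle_trans with (kp * (2 * km2) + X ^ 2 * (kp1 ^ 2 * kp ^ 2)); [|unfold kp2; lra].
    apply abs_minus_le.
    * apply abs_mult_le; [apply abs_pos_le; lra|apply yy2_bound; auto].
    * apply abs_mult_le; [apply abs_pos_le; lra|]. apply abs_mult_le; [|apply abs_pos_le; lra].
      simpl. rewrite !Rmult_1_r. apply abs_mult_le; apply pp1_bound; auto.
  + apply Rle_trans with (2 * (kdd + 2 * kp1)); [|unfold kp2; lra].
    replace (t * pp2 t) with ((t * dd t - 2 * t * pp1 t) / (t - s)) by (unfold pp2; field; lra).
    apply far_div; auto; try lra. rewrite Rmult_plus_distr_r. apply abs_minus_le; [apply dd_bound; auto|].
    replace (2 * kp1 * Rmax t s) with (2 * Rmax t s * kp1) by ring. apply abs_mult_le; [apply abs_pos_le; lra|apply pp1_bound; auto].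
- apply Rle_trans with (2 * (kdd + 2 * kp1)); [|unfold kp2; lra].
  replace (t * pp2 t) with ((t * dd t - 2 * t * pp1 t) / (t - s)) by (unfold pp2; field; lra).
  apply far_div; auto; try lra. rewrite Rmult_plus_distr_r. apply abs_minus_le; [apply dd_bound; auto|].
  replace (2 * kp1 * Rmax t s) with (2 * Rmax t s * kp1) by ring. apply abs_mult_le; [apply abs_pos_le; lra|apply pp1_bound; auto].
Qed.

(** Langer's [rho = xi'^2] as a function of [t]: with [E - xi^2 = c * pp * (s - t)], the relation
    [rho * (E - xi^2) = G^2 * (s - t)] forces this quotient. Its logarithmic derivative is [rl]. *)
Definition rr t := G t ^ 2 / (c * pp t).
Definition rl t := 2 * (G1 t / G t) - pp1 t / pp t.
Definition rr1 t := rr t * rl t.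
Definition rr2 t := rr1 t * rl t + rr t * (2 * (G2 t / G t) - 2 * (G1 t / G t) ^ 2 - pp2 t / pp t + (pp1 t / pp t) ^ 2).

Lemma rr_derive t : 0 < t < X ^ 2 -> t <> s -> is_derive rr t (rr1 t).
Proof.
intros H N. destruct (HG t H) as [[B1 B2] [D _]]. destruct (pp_range t H N) as [[R1 R2] _]. unfold rr at 1. evar_last.
- apply (is_derive_div (fun t => G t ^ 2) (fun t => c * pp t)).
  + apply (is_derive_comp (fun y => y ^ 2) G); [|exact D].
    instantiate (1 := 2 * G t). auto_derive; auto; ring.
  + apply (is_derive_scal pp t c), pp_derive; auto.
  + apply Rgt_not_eq, Rmult_lt_0_compat; lra.
- unfold scal, minus, plus, opp, mult; simpl; unfold mult; simpl. unfold rr1, rr, rl. field. repeat split; lra.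
Qed.

Lemma rl_derive t : 0 < t < X ^ 2 -> t <> s ->
  is_derive rl t (2 * (G2 t / G t) - 2 * (G1 t / G t) ^ 2 - pp2 t / pp t + (pp1 t / pp t) ^ 2).
Proof.
intros H N. destruct (HG t H) as [[B1 B2] [D _]]. destruct (HG1 t H N) as [D1 _]. destruct (pp_range t H N) as [[R1 R2] _]. evar_last.
- apply (is_derive_minus (fun t => 2 * (G1 t / G t)) (fun t => pp1 t / pp t)).
  + apply (is_derive_scal (fun t => G1 t / G t) t 2). apply (is_derive_div G1 G t); [exact D1|exact D|lra].
  + apply (is_derive_div pp1 pp t); [apply pp1_derive; auto|apply pp_derive; auto|lra].
- unfold minus, plus, opp; simpl. field. repeat split; lra.
Qed.

Lemma rr1_derive t : 0 < t < X ^ 2 -> t <> s -> is_derive rr1 t (rr2 t).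
Proof.
intros H N. evar_last.
- apply (is_derive_mult rr rl t); [apply rr_derive; auto|apply rl_derive; auto|intros; apply Rmult_comm].
- unfold plus, mult; simpl. unfold rr2; ring.
Qed.

Definition rlo := g0 ^ 2 * / (g1 * kp ^ 2).
Definition rhi := g1 ^ 2 * (/ g0 * kp ^ 2).
Definition krl := 2 * (L * / g0) + kp1 * kp ^ 2.
Definition rb1 := rhi * krl.
Definition rb2 := X ^ 2 * (rb1 * krl) +
  rhi * (2 * (L2 * / g0) + X ^ 2 * (2 * (L * / g0) ^ 2) + kp2 * kp ^ 2 + X ^ 2 * (kp1 * kp ^ 2) ^ 2).

Lemma ginv t : 0 < t < X ^ 2 -> 0 < / G t <= / g0.
Proof.
intros H. destruct (HG t H) as [[B1 B2] _]. split; [apply Rinv_0_lt_compat; lra|apply Rinv_le_contravar; lra].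
Qed.

Lemma rr_range t : 0 < t < X ^ 2 -> t <> s -> rlo <= rr t <= rhi.
Proof.
intros H N. destruct (HG t H) as [[B1 B2] _]. destruct (pp_range t H N) as [[R1 R2] [R3 R4]]. assert (C := cinv).
unfold rr, rlo, rhi, Rdiv. rewrite (Rinv_mult c). split.
- apply Rmult_le_compat; [apply pow2_ge_0|left; apply Rinv_0_lt_compat; apply Rmult_lt_0_compat; nra|apply pow_incr; lra|].
  rewrite <- Rinv_mult. apply Rinv_le_contravar; [apply Rmult_lt_0_compat; lra|]. apply Rmult_le_compat; lra.
- apply Rmult_le_compat; [apply pow2_ge_0|apply Rmult_le_pos; lra|apply pow_incr; lra|]. apply Rmult_le_compat; lra.
Qed.

Lemma rhi_nonneg : 0 < rlo /\ 0 <= rhi.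
Proof.
unfold rlo, rhi. assert (0 < / g0) by (apply Rinv_0_lt_compat; lra). split.
- apply Rmult_lt_0_compat; [nra|]. apply Rinv_0_lt_compat, Rmult_lt_0_compat; nra.
- apply Rmult_le_pos; [nra|]. apply Rmult_le_pos; nra.
Qed.

Lemma rl_bound t : 0 < t < X ^ 2 -> t <> s -> Rabs (rl t) <= krl.
Proof.
intros H N. destruct (HG t H) as [_ [_ B]]. destruct (pp_range t H N) as [[R1 R2] [R3 R4]]. assert (C := ginv t H).
unfold rl, krl, Rdiv. apply abs_minus_le.
- apply abs_mult_le; [apply abs_pos_le; lra|]. apply abs_mult_le; auto; apply abs_pos_le; lra.
- apply abs_mult_le; [apply pp1_bound; auto|apply abs_pos_le; lra].
Qed.

Lemma rr1_bound t : 0 < t < X ^ 2 -> t <> s -> Rabs (rr1 t) <= rb1.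
Proof.
intros H N. destruct rhi_nonneg. assert (R := rr_range t H N).
apply abs_mult_le; [apply abs_pos_le; lra|apply rl_bound; auto].
Qed.

(** The weight [t] costs nothing: the second derivative of [rr (x^2)] in [x] is
    [2 * rr1 + 4 * t * rr2] at [t = x^2]. *)
Lemma rr2_bound t : 0 < t < X ^ 2 -> t <> s -> Rabs (t * rr2 t) <= rb2.
Proof.
intros H N. destruct rhi_nonneg. assert (R := rr_range t H N). destruct (HG t H) as [_ [_ B]]. destruct (HG1 t H N) as [_ BB].
destruct (pp_range t H N) as [[R1 R2] [R3 R4]]. assert (C := ginv t H).
replace (t * rr2 t) with (t * (rr1 t * rl t) + rr t * (2 * ((t * G2 t) * / G t) - t * (2 * (G1 t * / G t) ^ 2) - (t * pp2 t) * / pp t + t * (pp1 t * / pp t) ^ 2))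
  by (unfold rr2, Rdiv; ring).
assert (SQ : forall a A, Rabs a <= A -> Rabs (a ^ 2) <= A ^ 2).
{ intros a A HA. simpl. rewrite !Rmult_1_r. apply abs_mult_le; auto. }
assert (Tp : Rabs t <= X ^ 2) by (apply abs_pos_le; lra).
assert (T2 : Rabs 2 <= 2) by (apply abs_pos_le; lra).
assert (Cg : Rabs (/ G t) <= / g0) by (apply abs_pos_le; lra).
assert (Cp : Rabs (/ pp t) <= kp ^ 2) by (apply abs_pos_le; lra).
assert (Cr : Rabs (rr t) <= rhi) by (apply abs_pos_le; lra).
unfold rb2. apply abs_plus_le.
- apply abs_mult_le; auto. apply abs_mult_le; [apply rr1_bound|apply rl_bound]; auto.
- apply abs_mult_le; auto. apply abs_plus_le; [apply abs_minus_le; [apply abs_minus_le|]|].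
  + apply abs_mult_le; auto. apply abs_mult_le; auto.
  + apply abs_mult_le; auto. apply abs_mult_le; auto. apply SQ, abs_mult_le; auto.
  + apply abs_mult_le; auto. apply pp2_bound; auto.
  + apply abs_mult_le; auto. apply SQ, abs_mult_le; auto. apply pp1_bound; auto.
Qed.

Lemma pp_lim : has_lim pp s.
Proof.
apply has_lim_ext with (fun t => sp t * sp t) 0 (X ^ 2); [apply s_in| |apply has_lim_mult; apply sp_lim].
intros t H N; apply sp_sqr; auto.
Qed.

Lemma pp_inv_lim : has_lim (fun t => / pp t) s.
Proof.
apply (has_lim_inv pp s (/ kp ^ 2) 0 (X ^ 2)); [apply s_in|apply Rinv_0_lt_compat; nra| |apply pp_lim].
intros t H N. destruct (pp_range t H N) as [[R1 R2] [R3 R4]]. apply inv_ge; auto.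
Qed.

Lemma rr_lim : has_lim rr s /\ has_lim rr1 s.
Proof.
destruct G_lim as [A B].
assert (R : has_lim rr s).
{ apply has_lim_ext with (fun t => G t * G t * (/ c * / pp t)) 0 (X ^ 2); [apply s_in| |].
  - intros t H N. destruct (pp_range t H N) as [[R1 R2] _]. unfold rr. field. lra.
  - apply has_lim_mult; [apply has_lim_mult; auto|]. apply has_lim_mult; [apply has_lim_const|apply pp_inv_lim]. }
split; auto. unfold rr1, rl. apply has_lim_mult; auto. apply has_lim_minus.
- apply has_lim_mult; [apply has_lim_const|]. apply has_lim_mult; auto.
  apply (has_lim_inv G s g0 0 (X ^ 2)); auto; [apply s_in|lra|]. intros t H N; apply HG; auto.
- apply has_lim_mult; [apply pp1_lim|apply pp_inv_lim].
Qed.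

End Symbol.

(** * Langer's variable, uniformly in the turning point *)

Lemma rint_jac_quarter xs : 0 < xs -> RInt (jac xs) 0 xs = PI / 4 * xs ^ 2.
Proof.
intros H. assert (PI0 := PI_RGT_0).
assert (E := RInt_comp (jac xs) (fun th => xs * sin th) (fun th => xs * cos th) 0 (PI / 2)).
cbv beta in E. rewrite sin_0, sin_PI2, Rmult_0_r, Rmult_1_r in E. rewrite <- E.
- apply is_RInt_unique.
  apply is_RInt_ext with (fun th => xs ^ 2 * (cos th) ^ 2).
  { intros th; rewrite Rmin_left, Rmax_right by lra; intros Hth.
    unfold scal; simpl; unfold mult; simpl. unfold jac.
    replace (xs ^ 2 - (xs * sin th) ^ 2) with ((xs * cos th) ^ 2).
    - assert (C : 0 < cos th) by (apply cos_gt_0; lra).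
      rewrite Rabs_pos_eq by apply pow2_ge_0. rewrite sqrt_pow2 by (apply Rmult_le_pos; lra). ring.
    - assert (S := sin2_cos2 th). unfold Rsqr in S.
      replace ((xs * cos th) ^ 2) with (xs ^ 2 * (1 - sin th * sin th)) by (rewrite <- S; ring). ring. }
  evar_last.
  + apply (is_RInt_derive (fun th => xs ^ 2 * (th / 2 + sin th * cos th / 2)) (fun th => xs ^ 2 * (cos th) ^ 2)).
    * intros th _. auto_derive; auto. assert (S := sin2_cos2 th). unfold Rsqr in S.
      apply Rminus_diag_uniq. transitivity (xs ^ 2 * (1 - (sin th * sin th + cos th * cos th)) / 2); [field|rewrite S; field].
    * intros th _. apply is_derive_continuous with (xs ^ 2 * (2 * cos th * - sin th)). auto_derive; auto. ring.
  + unfold minus, plus, opp; simpl. rewrite sin_PI2, cos_PI2, sin_0, cos_0. field.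
- intros th _. apply jac_continuous.
- intros th _. split; [auto_derive; auto; ring|].
  apply is_derive_continuous with (xs * - sin th). auto_derive; auto; ring.
Qed.

Lemma is_lim_sqr (f : R -> R) (xs : R) (l : R) : 0 < xs ->
  is_lim f (xs ^ 2) l -> is_lim (fun x => f (x ^ 2)) xs l.
Proof.
intros H0 H. apply (is_lim_comp f (fun x => x ^ 2) xs l (xs ^ 2)).
- exact H.
- apply (is_lim_continuity (fun x => x ^ 2)). apply continuous_pt, is_derive_continuous with (2 * xs). auto_derive; auto; ring.
- exists (mkposreal xs H0); intros y Hy N E. apply Rbar_finite_eq in E.
  assert (Y : Rabs (y - xs) < xs) by exact Hy. apply Rabs_def2 in Y. apply N. nra.
Qed.

Section Langer.

Variables (X g0 g1 L L2 : R).
Hypothesis X0 : 0 < X.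
Hypothesis g00 : 0 < g0 <= g1.
Hypothesis L0 : 0 <= L.
Hypothesis L20 : 0 <= L2.

Let k := kap g0 g1.
Let K := (1 + k) * (4 * k * lc g0 L) + lc g0 L.
(** A sum instead of a maximum: the terms are nonnegative, so it dominates each of the required
    bounds separately. *)
Definition langer_const := 1 + / rlo g0 g1 k + rhi g0 g1 k + 2 * rb1 g0 g1 L k K +
  (2 * rb1 g0 g1 L k K + 4 * rb2 X g0 g1 L L2 k K) + sqrt g1 * k + k ^ 2 / g0.

(** The map [xt] matches the integral of [jac] up to [xt x] with that of [q / c] up to [x]. Then
    [xi = sqrt c * xt] and [E = c * xs^2] give [xi'^2 * (E - xi^2) = G^2 * (xs^2 - x^2)]. The
    constant depends on [X] and the bounds for [G], not on [xs]. *)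
Lemma langer (xs : R) (q G G1 G2 : R -> R) :
  0 < xs < X ->
  (forall u, continuous q u) ->
  (forall u, 0 < u < X -> q u = G (u ^ 2) * jac xs u) ->
  (forall t, 0 < t < X ^ 2 -> g0 <= G t <= g1 /\ is_derive G t (G1 t) /\ Rabs (G1 t) <= L) ->
  continuous G1 (xs ^ 2) ->
  (forall t, 0 < t < X ^ 2 -> t <> xs ^ 2 -> is_derive G1 t (G2 t) /\ Rabs (t * G2 t) <= L2) ->
  exists (E : R) (xi rho rho1 rho2 : R -> R),
    RInt q 0 xs = PI / 4 * E /\ 0 < E /\
    (forall x, 0 < x < X -> 0 < xi x <= langer_const * x /\ is_derive xi x (sqrt (rho x)) /\
       is_derive rho x (rho1 x) /\ continuous rho1 x /\
       / langer_const <= rho x <= langer_const /\ Rabs (rho1 x) <= langer_const * x /\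
       rho x * (E - xi x ^ 2) = G (x ^ 2) ^ 2 * (xs ^ 2 - x ^ 2)) /\
    (forall x, 0 < x < X -> x <> xs -> is_derive rho1 x (rho2 x) /\ Rabs (rho2 x) <= langer_const) /\
    (forall x, xs < x < X -> (x ^ 2 - xs ^ 2) / langer_const <= xi x ^ 2 - E).
Proof.
intros Hxs Cq Hq HG CG1 HG1.
assert (HGr : forall t, 0 < t < X ^ 2 -> g0 <= G t <= g1) by (intros t Ht; apply HG; auto).
assert (HL : forall t r, 0 < t < X ^ 2 -> 0 < r < X ^ 2 -> Rabs (G t - G r) <= L * Rabs (t - r)).
{ assert (W : forall t r, 0 < t < X ^ 2 -> 0 < r < X ^ 2 -> t <= r -> Rabs (G r - G t) <= L * (r - t)).
  { intros t r Ht Hr tr. apply (mvt_bound G G1); auto.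
    - intros u Hu; apply is_derive_continuous with (G1 u), HG; lra.
    - intros u Hu; apply HG; lra.
    - intros u Hu; apply HG; lra. }
  intros t r Ht Hr. destruct (Rle_lt_dec t r) as [Q|Q].
  - rewrite Rabs_minus_sym, (Rabs_minus_sym t), (Rabs_pos_eq (r - t)) by lra; auto.
  - rewrite (Rabs_pos_eq (t - r)) by lra. apply W; auto; lra. }
set (c := action_ratio xs q).
assert (Hc : g0 <= c <= g1) by (apply (c_range xs X g0 g1 q G); auto; lra).
assert (Ex : forall x, exists y, 0 <= x < X -> 0 <= y /\ RInt (jac xs) 0 y = RInt q 0 x / c).
{ intros x. destruct (classic (0 <= x < X)) as [Hx|N]; [|exists 0; intros; contradiction].
  assert (CJ := jac_continuous xs).
  assert (Q0 : 0 <= RInt q 0 x).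
  { apply Rle_trans with (0 * (x - 0)); [lra|]. apply rint_lower; auto; [lra|]. intros u Hu. rewrite Hq by lra.
    apply Rmult_le_pos; [assert (Z := HGr (u ^ 2) ltac:(split; nra)); lra|apply jac_nonneg]. }
  assert (T0 : 0 <= RInt q 0 x / c) by (apply Rmult_le_pos; auto; left; apply Rinv_0_lt_compat; lra).
  (* [jac] is at least [1] beyond [xs + 1], so its integral reaches the target value no later than
     [v]. *)
  set (v := xs + 1 + RInt q 0 x / c).
  assert (V1 : RInt q 0 x / c <= RInt (jac xs) 0 v).
  { rewrite (rint_chasles (jac xs) CJ 0 (xs + 1) v).
    assert (0 * (xs + 1 - 0) <= RInt (jac xs) 0 (xs + 1)).
    { apply rint_lower; auto; [lra|]. intros; apply jac_nonneg. }
    assert (1 * (v - (xs + 1)) <= RInt (jac xs) (xs + 1) v).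
    { apply rint_lower; auto; [unfold v; lra|]. intros u Hu; apply jac_ge1; lra. }
    unfold v in *; lra. }
  assert (Z : RInt (jac xs) 0 0 = 0) by apply (@RInt_point R_CompleteNormedModule).
  destruct (IVT_gen_consistent (fun y => RInt (jac xs) 0 y) 0 v (RInt q 0 x / c)) as [y [Y1 Y2]].
  - intros y; eapply is_derive_continuous, rint_derive, CJ.
  - rewrite Z. rewrite Rmin_left, Rmax_right by lra. lra.
  - exists y; intros _; split; auto. rewrite Rmin_left in Y1 by (unfold v; lra). lra. }
set (xt := fun x => proj1_sig (constructive_indefinite_description _ (Ex x))).
assert (Hxt : forall x, 0 <= x < X -> 0 <= xt x /\ RInt (jac xs) 0 (xt x) = RInt q 0 x / c).
{ intros x Hx. unfold xt. destruct (constructive_indefinite_description _ (Ex x)) as [y Hy]. apply Hy; auto. }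
clearbody xt.
assert (Exs : xt xs = xs) by (apply (xt_xs xs X g0 g1 q G); auto; lra).
assert (Inc : forall x y, 0 <= x < y -> y < X -> xt x < xt y) by (apply (xt_incr xs X g0 g1 q G); auto; lra).
assert (K1 : 3 <= k) by (apply (kap_ge xs X g0 g1 G); auto; lra).
assert (lc0 : 0 <= lc g0 L) by (apply lc_nonneg; auto; lra).
assert (KK : 0 <= (1 + k) * (4 * k * lc g0 L)) by (apply Rmult_le_pos; [lra|apply Rmult_le_pos; lra]).
assert (K0 : 0 <= K) by (unfold K; lra).
assert (HGc : forall t, 0 < t < X ^ 2 -> Rabs (G t / c - 1) <= K * Rmax t (xs ^ 2)).
{ intros t Ht. eapply Rle_trans; [apply (Gc_near_1 xs X g0 g1 L q G); auto; lra|].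
  apply Rmult_le_compat_r; [eapply Rle_trans; [|apply Rmax_l]; lra|]. unfold K; lra. }
assert (Hxt2 : forall x, 0 < x < X -> 0 < xt x /\ x <= k * xt x /\ xt x <= k * x /\
  Rabs (xs ^ 2 - xt x ^ 2) <= k ^ 2 * Rabs (xs ^ 2 - x ^ 2) /\
  Rabs (xs ^ 2 - x ^ 2) <= k ^ 2 * Rabs (xs ^ 2 - xt x ^ 2) /\
  Rabs (xt x ^ 2 - x ^ 2) <= K * x ^ 2 * Rabs (xs ^ 2 - x ^ 2) /\ continuous xt x).
{ intros x Hx.
  assert (P : 0 < xt x) by (apply (xt_pos xs X g0 g1 q G); auto; lra).
  destruct (xt_ratio xs X g0 g1 q G Hxs ltac:(lra) Cq HGr Hq xt Hxt x Hx) as [R1 R2].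
  destruct (xt_sq_ratio xs X g0 g1 q G Hxs ltac:(lra) Cq HGr Hq xt Hxt x Hx) as [S1 S2].
  assert (N := xt_near xs X g0 g1 L q G Hxs ltac:(lra) L0 Cq HGr HL Hq xt Hxt x Hx).
  assert (CT := xt_continuous xs X g0 g1 q G Hxs ltac:(lra) Cq HGr Hq xt Hxt x Hx).
  fold k in R1, R2, S1, S2, N.
  refine (conj P (conj R1 (conj R2 (conj S1 (conj S2 (conj _ CT)))))).
  replace (xt x ^ 2 - x ^ 2) with ((xt x + x) * (xt x - x)) by ring.
  apply Rle_trans with ((1 + k) * x * (4 * k * lc g0 L * x * Rabs (xs ^ 2 - x ^ 2))).
  - apply abs_mult_le; auto. apply abs_pos_le; lra.
  - replace ((1 + k) * x * (4 * k * lc g0 L * x * Rabs (xs ^ 2 - x ^ 2))) with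
      ((1 + k) * (4 * k * lc g0 L) * (x ^ 2 * Rabs (xs ^ 2 - x ^ 2))) by ring.
    apply Rle_trans with (K * (x ^ 2 * Rabs (xs ^ 2 - x ^ 2))); [|right; ring]. apply Rmult_le_compat_r; [|unfold K; lra].
    apply Rmult_le_pos; [apply pow2_ge_0|apply Rabs_pos]. }
assert (Hxts : forall x, 0 < x < X -> (x < xs -> xt x < xs) /\ (xs < x -> xs < xt x)).
{ intros x Hx; split; intros Q; rewrite <- Exs at 1; [rewrite <- Exs|]; apply Inc; lra. }
assert (Dxt : forall x, 0 < x < X -> x <> xs -> is_derive xt x (G (x ^ 2) * jac xs x / (c * jac xs (xt x)))).
{ intros x Hx N. rewrite <- Hq by auto. apply (xt_derive xs X g0 g1 q G); auto; lra. }
set (R0 := rr xs c G xt). set (R1 := rr1 xs c G G1 xt). set (R2 := rr2 xs c G G1 G2 xt).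
assert (FR : forall t, 0 < t < X ^ 2 -> t <> xs ^ 2 -> rlo g0 g1 k <= R0 t <= rhi g0 g1 k /\
   is_derive R0 t (R1 t) /\ is_derive R1 t (R2 t) /\ Rabs (R1 t) <= rb1 g0 g1 L k K /\ Rabs (t * R2 t) <= rb2 X g0 g1 L L2 k K).
{ intros t Ht Nt. refine (conj _ (conj _ (conj _ (conj _ _)))).
  - apply (rr_range xs X g0 g1 L k K c G G1 xt); auto.
  - apply (rr_derive xs X g0 g1 L k K c G G1 xt); auto.
  - apply (rr1_derive xs X g0 g1 L L2 k K c G G1 G2 xt); auto.
  - apply (rr1_bound xs X g0 g1 L k K c G G1 xt); auto.
  - apply (rr2_bound xs X g0 g1 L L2 k K c G G1 G2 xt); auto. }
destruct (rr_lim xs X g0 g1 L k K c G G1 xt) as [[l0 Hl0] [l1 Hl1]]; auto.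
destruct (rhi_nonneg g0 g1 k) as [RL0 RH0]; auto.
assert (B1 : 0 <= rb1 g0 g1 L k K).
{ destruct (FR (xs ^ 2 / 2)) as [_ [_ [_ [B _]]]]; [split; nra|nra|]. eapply Rle_trans; [apply Rabs_pos|apply B]. }
assert (B2 : 0 <= rb2 X g0 g1 L L2 k K).
{ destruct (FR (xs ^ 2 / 2)) as [_ [_ [_ [_ B]]]]; [split; nra|nra|]. eapply Rle_trans; [apply Rabs_pos|apply B]. }
assert (C1 : 0 < / rlo g0 g1 k) by (apply Rinv_0_lt_compat; auto).
assert (C2 : 0 <= sqrt g1 * k) by (apply Rmult_le_pos; [apply sqrt_pos|lra]).
assert (C3 : 0 <= k ^ 2 / g0) by (apply Rmult_le_pos; [apply pow2_ge_0|left; apply Rinv_0_lt_compat; lra]).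
assert (LCb : 1 <= langer_const /\ / rlo g0 g1 k <= langer_const /\ rhi g0 g1 k <= langer_const /\
  2 * rb1 g0 g1 L k K <= langer_const /\ 2 * rb1 g0 g1 L k K + 4 * rb2 X g0 g1 L L2 k K <= langer_const /\
  sqrt g1 * k <= langer_const /\ k ^ 2 / g0 <= langer_const).
{ unfold langer_const. repeat split; lra. }
set (Cc := langer_const) in *. clearbody Cc.
destruct LCb as [LC0 [LC1 [LC2 [LC3 [LC4 [LC5 LC6]]]]]].
set (r0 := fun x => R0 (x ^ 2)). set (r1 := fun x => 2 * x * R1 (x ^ 2)).
set (r2 := fun x => 2 * R1 (x ^ 2) + 2 * x * (2 * x * R2 (x ^ 2))).
assert (Sq : forall x, 0 < x < X -> 0 < x ^ 2 < X ^ 2) by (intros x Hx; split; nra).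
assert (SqN : forall x, 0 < x < X -> x <> xs -> x ^ 2 <> xs ^ 2) by (intros x Hx N E; apply N; nra).
assert (Dsq : forall x : R, is_derive (fun x => x ^ 2) x (2 * x)) by (intros x; auto_derive; auto; ring).
assert (Dr0 : forall x, 0 < x < X -> x <> xs -> is_derive r0 x (r1 x)).
{ intros x Hx N. destruct (FR (x ^ 2) (Sq x Hx) (SqN x Hx N)) as [_ [D _]].
  apply (is_derive_comp R0 (fun x => x ^ 2) x (R1 (x ^ 2)) (2 * x)); auto. }
assert (Dr1 : forall x, 0 < x < X -> x <> xs -> is_derive r1 x (r2 x)).
{ intros x Hx N. destruct (FR (x ^ 2) (Sq x Hx) (SqN x Hx N)) as [_ [_ [D _]]]. evar_last.
  - apply (is_derive_mult (fun x => 2 * x) (fun x => R1 (x ^ 2)) x).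
    + instantiate (1 := 2). auto_derive; auto; ring.
    + apply (is_derive_comp R1 (fun x => x ^ 2) x (R2 (x ^ 2)) (2 * x)); auto.
    + intros; apply Rmult_comm.
  - reflexivity. }
assert (L0r : is_lim r0 xs l0) by (apply is_lim_sqr; auto; lra).
assert (L1r : is_lim r1 xs (2 * xs * l1)).
{ apply (is_lim_mult (fun x => 2 * x) (fun x => R1 (x ^ 2)) xs (2 * xs) l1); [|apply is_lim_sqr; auto; lra|exact I].
  apply (is_lim_continuity (fun x => 2 * x)). apply continuous_pt, is_derive_continuous with 2. auto_derive; auto; ring. }
assert (Br1 : forall x, 0 < x < X -> x <> xs -> Rabs (r1 x) <= Cc * x).
{ intros x Hx N. destruct (FR (x ^ 2) (Sq x Hx) (SqN x Hx N)) as [_ [_ [_ [B _]]]].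
  unfold r1. apply Rle_trans with (2 * x * rb1 g0 g1 L k K); [|nra]. apply abs_mult_le; auto. apply abs_pos_le; lra. }
assert (Br0 : forall x, 0 < x < X -> x <> xs -> / Cc <= r0 x <= Cc).
{ intros x Hx N. destruct (FR (x ^ 2) (Sq x Hx) (SqN x Hx N)) as [B _]. unfold r0. split; [|lra].
  apply Rle_trans with (rlo g0 g1 k); [|lra]. rewrite <- (Rinv_inv (rlo g0 g1 k)). apply Rinv_le_contravar; lra. }
(* At the turning point [rho] and [rho1] take the limits of their formulas; about [rho2] nothing is
   claimed there. *)
exists (c * xs ^ 2), (fun x => sqrt c * xt x), (patch r0 xs l0), (patch r1 xs (2 * xs * l1)), r2.
assert (c0 : 0 < c) by lra. assert (sc : sqrt c * sqrt c = c) by (apply sqrt_sqrt; lra).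
assert (sc0 : 0 < sqrt c) by (apply sqrt_lt_R0; lra).
assert (DP := patch_derive r0 r1 xs l0 (2 * xs * l1) 0 X Hxs Dr0 L0r L1r).
assert (Eq : forall x, 0 < x < X -> x <> xs -> r0 x * (c * xs ^ 2 - (sqrt c * xt x) ^ 2) = G (x ^ 2) ^ 2 * (xs ^ 2 - x ^ 2)).
{ intros x Hx N. replace ((sqrt c * xt x) ^ 2) with (c * xt x ^ 2) by (rewrite <- sc at 1; ring).
  unfold r0, R0, rr, pp. rewrite sqrt_pow2 by lra. destruct (Hxts x Hx) as [A B]. destruct (Hxt2 x Hx) as [P _].
  assert (xs ^ 2 - xt x ^ 2 <> 0).
  { destruct (Rtotal_order x xs) as [Q|[Q|Q]]; [specialize (A Q); nra|lra|specialize (B Q); nra]. }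
  field. repeat split; try lra. intros Z; apply (SqN x Hx N); lra. }
refine (conj _ (conj _ (conj _ (conj _ _)))).
- assert (M : c * RInt (jac xs) 0 xs = RInt q 0 xs) by (apply c_mult with X; lra).
  rewrite <- M, rint_jac_quarter by lra. real_eq; ring.
- apply Rmult_lt_0_compat; [lra|apply pow_lt; lra].
- intros x Hx. destruct (Hxt2 x Hx) as [P [_ [R3 [_ [_ [_ CT]]]]]].
  refine (conj _ (conj _ (conj (DP x Hx) (conj _ (conj _ (conj _ _)))))).
  + split; [nra|]. assert (sqrt c <= sqrt g1) by (apply sqrt_le_1_alt; lra).
    apply Rle_trans with (sqrt g1 * (k * x)); [apply Rmult_le_compat; lra|]. rewrite <- Rmult_assoc. apply Rmult_le_compat_r; lra.
  + assert (DX : forall x, 0 < x < X -> x <> xs -> is_derive (fun x => sqrt c * xt x) x (sqrt (patch r0 xs l0 x))).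
    { clear x Hx P R3 CT. intros x Hx N. rewrite patch_neq by auto. evar_last.
      - apply (is_derive_scal xt x (sqrt c)), Dxt; auto.
      - destruct (Hxt2 x Hx) as [P _]. destruct (Hxts x Hx) as [A B]. destruct (HG (x ^ 2) (Sq x Hx)) as [HGx _].
        assert (Nt : xt x <> xs) by (destruct (Rtotal_order x xs) as [Q|[Q|Q]]; [specialize (A Q); lra|lra|specialize (B Q); lra]).
        assert (J0 : 0 < jac xs x) by (apply jac_pos; lra). assert (J1 : 0 < jac xs (xt x)) by (apply jac_pos; lra).
        symmetry. apply sqrt_lem_1.
        + apply Br0 in Hx; auto. assert (0 < / Cc) by (apply Rinv_0_lt_compat; lra). lra.
        + change (0 <= sqrt c * (G (x ^ 2) * jac xs x / (c * jac xs (xt x)))). apply Rmult_le_pos; [lra|].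
          apply Rmult_le_pos; [apply Rmult_le_pos; lra|]. left; apply Rinv_0_lt_compat, Rmult_lt_0_compat; lra.
        + change (sqrt c * (G (x ^ 2) * jac xs x / (c * jac xs (xt x))) * (sqrt c * (G (x ^ 2) * jac xs x / (c * jac xs (xt x)))) = r0 x).
          replace (sqrt c * (G (x ^ 2) * jac xs x / (c * jac xs (xt x))) * (sqrt c * (G (x ^ 2) * jac xs x / (c * jac xs (xt x)))))
            with ((sqrt c * sqrt c) * G (x ^ 2) ^ 2 * (jac xs x * jac xs x) / (c ^ 2 * (jac xs (xt x) * jac xs (xt x)))) by (field; lra).
          rewrite sc, !jac_sqr. unfold r0, R0, rr, pp. rewrite sqrt_pow2 by lra.
          destruct (Rtotal_order x xs) as [Q|[Q|Q]]; [|lra|].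
          * specialize (A Q). rewrite !Rabs_pos_eq by nra. field. repeat split; try nra.
          * specialize (B Q). rewrite !Rabs_left by nra. field. repeat split; try nra. }
    destruct (Req_dec x xs) as [->|N]; [|auto].
    apply (is_derive_limit (fun x => sqrt c * xt x) (fun x => sqrt (patch r0 xs l0 x)) 0 xs X); auto.
    * apply (continuous_scal_r (sqrt c) xt xs); auto.
    * apply (is_lim_continuity (fun x => sqrt (patch r0 xs l0 x))). apply continuous_pt.
      apply (continuous_comp (patch r0 xs l0) sqrt); [apply patch_continuous; auto|apply continuous_sqrt].
  + destruct (Req_dec x xs) as [->|N]; [apply patch_continuous; auto|].
    apply is_derive_continuous with (r2 x). apply is_derive_ext_loc with r1; [apply patch_locally; auto|auto].
  + destruct (Req_dec x xs) as [->|N].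
    * rewrite patch_eq. split.
      -- apply (is_lim_ge r0 xs l0 (/ Cc) 0 X); auto. intros y Hy N; apply Br0; auto.
      -- assert (- Cc <= - l0); [|lra]. apply (is_lim_ge (fun x => - r0 x) xs (- l0) (- Cc) 0 X); auto.
         ++ intros y Hy N; destruct (Br0 y Hy N); lra.
         ++ apply (is_lim_opp r0 xs l0); auto.
    * rewrite patch_neq by auto. apply Br0; auto.
  + destruct (Req_dec x xs) as [->|N].
    * rewrite patch_eq. apply Rnot_lt_le; intros Q.
      (* Division by [x] turns the bound [Cc * x] into a constant one, which passes to the limit. *)
      set (ff := fun x => r1 x / x).
      assert (Lf : is_lim ff xs (2 * xs * l1 / xs)).
      { apply (is_lim_mult r1 (fun x => / x) xs (2 * xs * l1) (/ xs)); auto; [|exact I].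
        apply (is_lim_continuity (fun x => / x)). apply continuous_pt, is_derive_continuous with (- / xs ^ 2). auto_derive; [lra|]. field; lra. }
      assert (Bf : Rabs (2 * xs * l1 / xs) <= Cc).
      { apply (is_lim_bound ff xs (2 * xs * l1 / xs) Cc 0 X); auto. intros y Hy N. unfold ff, Rdiv.
        rewrite Rabs_mult, Rabs_inv, (Rabs_pos_eq y) by lra. apply Rle_div_l; [lra|]. apply Br1; auto. }
      unfold Rdiv in Bf. rewrite Rabs_mult, Rabs_inv, (Rabs_pos_eq xs) in Bf by lra.
      apply (Rle_div_l (Rabs (2 * xs * l1)) Cc xs) in Bf; lra.
    * rewrite patch_neq by auto. apply Br1; auto.
  + destruct (Req_dec x xs) as [->|N].
    * rewrite Exs. replace ((sqrt c * xs) ^ 2) with (sqrt c * sqrt c * xs ^ 2) by ring. rewrite sc. ring.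
    * rewrite patch_neq by auto. apply Eq; auto.
- intros x Hx N. split.
  + apply is_derive_ext_loc with r1; [apply patch_locally; auto|auto].
  + destruct (FR (x ^ 2) (Sq x Hx) (SqN x Hx N)) as [_ [_ [_ [Ba Bb]]]]. unfold r2.
    replace (2 * R1 (x ^ 2) + 2 * x * (2 * x * R2 (x ^ 2))) with (2 * R1 (x ^ 2) + 4 * (x ^ 2 * R2 (x ^ 2))) by ring.
    eapply Rle_trans; [|apply LC4]. apply abs_plus_le; apply abs_mult_le; auto; apply abs_pos_le; lra.
- intros x Hx. destruct (Hxt2 x ltac:(lra)) as [P [_ [_ [_ [S2 _]]]]]. destruct (Hxts x ltac:(lra)) as [_ B].
  specialize (B ltac:(lra)). rewrite !Rabs_left in S2 by nra.
  replace ((sqrt c * xt x) ^ 2) with (sqrt c * sqrt c * xt x ^ 2) by ring. rewrite sc.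
  assert (0 < xt x ^ 2 - xs ^ 2) by nra.
  apply Rle_div_l; [lra|].
  assert (S3 : k ^ 2 <= Cc * g0) by (apply Rle_div_l; lra).
  apply Rle_trans with (k ^ 2 * (xt x ^ 2 - xs ^ 2)); [lra|].
  apply Rle_trans with (Cc * g0 * (xt x ^ 2 - xs ^ 2)); [apply Rmult_le_compat_r; lra|].
  replace ((c * xt x ^ 2 - c * xs ^ 2) * Cc) with (Cc * c * (xt x ^ 2 - xs ^ 2)) by ring.
  apply Rmult_le_compat_r; [lra|]. apply Rmult_le_compat_l; lra.
Qed.

End Langer.

(** * Square root of a divided difference *)

Section DividedDifference.

Variables (T m M C2 C3 s : R) (b b1 b2 b3 : R -> R).
Hypothesis m0 : 0 < m.
Hypothesis Hs : 0 < s < T.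
Hypothesis Db : forall t, 0 < t < T -> is_derive b t (b1 t) /\ m <= b1 t <= M.
Hypothesis Db1 : forall t, 0 < t < T -> is_derive b1 t (b2 t) /\ Rabs (b2 t) <= C2.
Hypothesis Db2 : forall t, 0 < t < T -> is_derive b2 t (b3 t) /\ Rabs (t * b3 t) <= C3.

(** The divided difference solves [(t - s) * be' + be = b1], and its successive derivatives solve
    the same equation with exponents [2] and [3]. The unsimplified [1 *] and [1 + 1] match the
    pattern [a], [a + 1] of the regular singular estimates. *)
Let be t := (b t - b s) / (t - s).
Let be1 t := (b1 t - 1 * be t) / (t - s).
Let be2 t := (b2 t - (1 + 1) * be1 t) / (t - s).

Lemma be_derive t : 0 < t < T -> t <> s -> is_derive be t (be1 t).
Proof.
intros H N. evar_last.
- apply (is_derive_div (fun t => b t - b s) (fun t => t - s)).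
  + apply (is_derive_minus b (fun _ => b s)); [apply Db; auto|apply (is_derive_const (b s))].
  + instantiate (1 := 1). auto_derive; auto; ring.
  + lra.
- unfold minus, plus, opp, zero; simpl. unfold be1, be. field; lra.
Qed.

Lemma be_range t : 0 < t < T -> t <> s -> m <= be t <= M.
Proof.
intros H N.
assert (W : forall u v, 0 < u < T -> 0 < v < T -> u < v -> m <= (b v - b u) / (v - u) <= M).
{ intros u v Hu Hv uv. destruct (mvt b b1 u v uv) as [c [Hc E]].
  - intros x Hx; apply is_derive_continuous with (b1 x), Db; lra.
  - intros x Hx; apply Db; lra.
  - rewrite E. replace (b1 c * (v - u) / (v - u)) with (b1 c) by (field; lra). apply Db; lra. }
unfold be. destruct (Rtotal_order t s) as [Q|[Q|Q]]; [|lra|apply W; auto].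
replace ((b t - b s) / (t - s)) with ((b s - b t) / (s - t)) by (field; lra). apply W; auto.
Qed.

Lemma be_lim0 : is_lim (fun t => (t - s) * be t) s 0.
Proof.
apply is_lim_ext_neq with (fun t => b t - b s) 0 T; auto.
{ intros t H N; unfold be; field; lra. }
replace (Finite 0) with (Finite (b s - b s)) by (f_equal; ring).
apply (is_lim_continuity (fun t => b t - b s)). apply continuous_pt, is_derive_continuous with (b1 s).
evar_last; [apply (is_derive_minus b (fun _ => b s)); [apply Db; auto|apply (is_derive_const (b s))]|].
unfold minus, plus, opp, zero; simpl; ring.
Qed.

Lemma b_lim k k' : (forall t, 0 < t < T -> is_derive k t (k' t)) -> is_lim k s (k s).
Proof. intros D. apply is_lim_continuity, continuous_pt, is_derive_continuous with (k' s), D; auto. Qed.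

Lemma be_lim : is_lim be s (b1 s / 1).
Proof.
apply (rs_y_lim 1 s 0 T be b1); auto; [lra| |apply be_lim0|apply b_lim with b2; apply Db1].
intros t H N; apply be_derive; auto.
Qed.

Lemma be1_lim : is_lim be1 s (b2 s / (1 + 1)).
Proof.
apply (rs_y1_lim 1 s 0 T be b1 b2) with (b0 := b1 s); auto; try lra.
- intros t H N; apply be_derive; auto.
- apply be_lim0.
- intros t H N; apply Db1; auto.
- apply b_lim with b2; apply Db1.
- apply b_lim with b3; apply Db2.
Qed.

Lemma be1_bound t : 0 < t < T -> t <> s -> Rabs (be1 t) <= C2 / (1 + 1).
Proof.
intros H N. apply (rs_y1_bound 1 s 0 T be b1 b2) with (b0 := b1 s); auto; try lra.
- intros u Hu Nu; apply be_derive; auto.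
- apply be_lim0.
- intros u Hu Nu; apply Db1; auto.
- apply b_lim with b2; apply Db1.
- intros r Hr. apply Db1. unfold Rmin, Rmax in Hr; destruct (Rle_dec s t); lra.
Qed.

Lemma be1_derive t : 0 < t < T -> t <> s -> is_derive be1 t (be2 t).
Proof.
intros H N. apply (rs_y1_derive 1 s 0 T be b1 b2); auto.
- intros u Hu Nu; apply be_derive; auto.
- intros u Hu Nu; apply Db1; auto.
Qed.

Lemma C23_nonneg : 0 <= C2 /\ 0 <= C3.
Proof.
split; [destruct (Db1 s Hs) as [_ B]|destruct (Db2 s Hs) as [_ B]]; eapply Rle_trans; try apply B; apply Rabs_pos.
Qed.

(** Away from [s] the distance [|t - s|] is at least [t / 2] and divides out directly. Near [s] the
    singular estimate applies, with [b3] bounded by [2 * C3 / s] on the interval between [s] and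
    [t]. *)
Lemma be2_bound t : 0 < t < T -> t <> s -> Rabs (t * be2 t) <= 4 * C2 + 2 * C3.
Proof.
intros H N. destruct C23_nonneg as [P2 P3].
assert (Far : (t <= s / 2 \/ 2 * s <= t) -> Rabs (t * be2 t) <= 4 * C2).
{ intros Q. assert (A : t <= 2 * Rabs (t - s)).
  { destruct Q; [rewrite Rabs_left by lra|rewrite Rabs_pos_eq by lra]; lra. }
  assert (P : 0 < Rabs (t - s)) by (apply Rabs_pos_lt; lra).
  unfold be2. replace (t * ((b2 t - (1 + 1) * be1 t) / (t - s))) with ((t * (b2 t - (1 + 1) * be1 t)) / (t - s)) by (field; lra).
  unfold Rdiv; rewrite (Rabs_mult _ (/ (t - s))), Rabs_inv. apply Rle_div_l; auto.
  apply Rle_trans with (2 * Rabs (t - s) * (C2 + (1 + 1) * (C2 / (1 + 1)))); [|right; field].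
  apply abs_mult_le; [apply abs_pos_le; lra|]. apply abs_minus_le; [apply Db1; auto|].
  apply abs_mult_le; [apply abs_pos_le; lra|apply be1_bound; auto]. }
destruct (Rle_lt_dec t (s / 2)) as [Q1|Q1]; [specialize (Far (or_introl Q1)); lra|].
destruct (Rle_lt_dec (2 * s) t) as [Q2|Q2]; [specialize (Far (or_intror Q2)); lra|].
assert (B : Rabs (be2 t) <= (C3 * (2 * / s)) / (1 + 1 + 1)).
{ apply (rs_y1_bound (1 + 1) s 0 T be1 b2 b3) with (b0 := b2 s); auto; try lra.
  - intros u Hu Nu; apply be1_derive; auto.
  - apply (rs_y1_lim0 1 s 0 T be b1) with (b0 := b1 s); auto; try lra.
    + intros u Hu Nu; apply be_derive; auto.
    + apply be_lim0.
    + apply b_lim with b2; apply Db1.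
  - intros u Hu Nu; apply Db2; auto.
  - apply b_lim with b3; apply Db2.
  - intros r Hr. assert (Hr' : 0 < r < T /\ s / 2 <= r) by (unfold Rmin, Rmax in Hr; destruct (Rle_dec s t); lra).
    destruct (Db2 r (proj1 Hr')) as [_ M3]. rewrite Rabs_mult, (Rabs_pos_eq r) in M3 by lra.
    apply Rmult_le_reg_l with r; [lra|]. eapply Rle_trans; [apply M3|].
    replace (r * (C3 * (2 * / s))) with (C3 * (r * 2 * / s)) by ring.
    rewrite <- (Rmult_1_r C3) at 1. apply Rmult_le_compat_l; auto.
    apply Rmult_le_reg_r with s; [lra|]. rewrite Rmult_assoc, Rinv_l; lra. }
rewrite Rabs_mult, (Rabs_pos_eq t) by lra.
apply Rle_trans with (2 * s * ((C3 * (2 * / s)) / (1 + 1 + 1))).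
- apply Rmult_le_compat; auto; try lra. apply Rabs_pos.
- replace (2 * s * (C3 * (2 * / s) / (1 + 1 + 1))) with (4 / 3 * C3) by (field; lra). lra.
Qed.

Definition dd_L := C2 / 2 * / (2 * sqrt m).
Definition dd_L2 := ((4 * C2 + 2 * C3) + 2 * T * dd_L ^ 2) * / (2 * sqrt m).

(** [G^2] is what remains of [b t - b s] after its simple zero at [s] is divided out; the lower
    bound [m] on the slope of [b] keeps it away from [0], so the square root is as regular as the
    quotient. *)
Lemma divided_difference_sqrt : exists G G1 G2 : R -> R,
  (forall t, 0 < t < T -> sqrt m <= G t <= sqrt M /\ is_derive G t (G1 t) /\ Rabs (G1 t) <= dd_L) /\
  continuous G1 s /\
  (forall t, 0 < t < T -> t <> s -> is_derive G1 t (G2 t) /\ Rabs (t * G2 t) <= dd_L2) /\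
  (forall t, 0 < t < T -> G t ^ 2 * (t - s) = b t - b s).
Proof.
set (B := patch be s (b1 s / 1)). set (B1 := patch be1 s (b2 s / (1 + 1))).
assert (DB : forall t, 0 < t < T -> is_derive B t (B1 t)).
{ apply (patch_derive be be1 s (b1 s / 1) (b2 s / (1 + 1)) 0 T); auto.
  - intros t H N; apply be_derive; auto.
  - apply be_lim.
  - apply be1_lim. }
assert (RB : forall t, 0 < t < T -> m <= B t <= M).
{ intros t H. destruct (Req_dec t s) as [->|N].
  - unfold B; rewrite patch_eq. unfold Rdiv; rewrite Rinv_1, Rmult_1_r. apply Db; auto.
  - unfold B; rewrite patch_neq by auto. apply be_range; auto. }
assert (RB1 : forall t, 0 < t < T -> Rabs (B1 t) <= C2 / 2).
{ intros t H. destruct (Req_dec t s) as [->|N].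
  - unfold B1; rewrite patch_eq. unfold Rdiv. apply abs_mult_le; [apply Db1; auto|apply abs_pos_le; lra].
  - unfold B1; rewrite patch_neq by auto. replace (C2 / 2) with (C2 / (1 + 1)) by (f_equal; ring). apply be1_bound; auto. }
assert (CB1 : continuous B1 s) by (apply patch_continuous, be1_lim).
assert (DB1 : forall t, 0 < t < T -> t <> s -> is_derive B1 t (be2 t)).
{ intros t H N. apply is_derive_ext_loc with be1; [apply patch_locally; auto|apply be1_derive; auto]. }
assert (sm : 0 < sqrt m) by (apply sqrt_lt_R0; auto).
set (G := fun t => sqrt (B t)).
assert (RG : forall t, 0 < t < T -> sqrt m <= G t <= sqrt M).
{ intros t H; destruct (RB t H); split; apply sqrt_le_1_alt; auto. }
assert (G2B : forall t, 0 < t < T -> G t * G t = B t).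
{ intros t H; apply sqrt_sqrt; destruct (RB t H); lra. }
set (G1 := fun t => B1 t / (2 * G t)).
assert (DG : forall t, 0 < t < T -> is_derive G t (G1 t)).
{ intros t H. destruct (RG t H). evar_last.
  - apply (is_derive_comp sqrt B t); [apply is_derive_Reals, derivable_pt_lim_sqrt; destruct (RB t H); lra|apply DB; auto].
  - unfold scal; simpl; unfold mult; simpl. unfold G1, G in *. field. lra. }
assert (IG : forall t, 0 < t < T -> 0 < / (2 * G t) <= / (2 * sqrt m)).
{ intros t H; destruct (RG t H). split; [apply Rinv_0_lt_compat; lra|apply Rinv_le_contravar; lra]. }
assert (BG1 : forall t, 0 < t < T -> Rabs (G1 t) <= dd_L).
{ intros t H. unfold G1, Rdiv, dd_L. apply abs_mult_le; [apply RB1; auto|]. apply abs_pos_le. destruct (IG t H); lra. }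
exists G, G1, (fun t => (be2 t - 2 * G1 t ^ 2) / (2 * G t)).
refine (conj _ (conj _ (conj _ _))).
- intros t H; refine (conj (RG t H) (conj (DG t H) (BG1 t H))).
- unfold G1, Rdiv. apply (continuous_mult B1 (fun t => / (2 * G t))); auto.
  destruct (RG s Hs). apply is_derive_continuous with (- (2 * G1 s) / (2 * G s) ^ 2).
  apply (is_derive_inv (fun t => 2 * G t) s); [|lra]. apply (is_derive_scal G s 2), DG; auto.
- intros t H N. destruct (RG t H). split.
  + evar_last.
    * apply (is_derive_div B1 (fun t => 2 * G t) t (be2 t) (2 * G1 t)); [apply DB1; auto|apply (is_derive_scal G t 2), DG; auto|lra].
    * unfold G1. field. lra.
  + replace (t * ((be2 t - 2 * G1 t ^ 2) / (2 * G t))) with ((t * be2 t - 2 * t * G1 t ^ 2) * / (2 * G t)) by (field; lra).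
    unfold dd_L2. apply abs_mult_le; [|apply abs_pos_le; destruct (IG t H); lra].
    apply abs_minus_le; [apply be2_bound; auto|]. apply abs_mult_le; [apply abs_pos_le; lra|].
    simpl. rewrite !Rmult_1_r. apply abs_mult_le; apply BG1; auto.
- intros t H. simpl; rewrite Rmult_1_r, G2B by auto.
  destruct (Req_dec t s) as [->|N]; [ring|]. unfold B; rewrite patch_neq by auto. unfold be; field; lra.
Qed.

End DividedDifference.

(** * Even profiles as functions of [x^2] *)

Section EvenProfile.

Variables (A A1 A2 A3 A4 A5 : R -> R).
Hypothesis DA : forall x, is_derive A x (A1 x).
Hypothesis DA1 : forall x, is_derive A1 x (A2 x).
Hypothesis DA2 : forall x, is_derive A2 x (A3 x).
Hypothesis DA3 : forall x, is_derive A3 x (A4 x).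
Hypothesis DA4 : forall x, is_derive A4 x (A5 x).
Hypothesis Apos : forall x, 0 < A x.
Hypothesis Aeven : forall x, A (- x) = A x.
Hypothesis Adecr : forall x, 0 < x -> A1 x < 0.
Hypothesis A20 : A2 0 < 0.

Lemma odd_derive (f f1 : R -> R) (k : R) : (forall x, is_derive f x (f1 x)) ->
  (forall x, f (- x) = k * f x) -> forall x, f1 (- x) = - k * f1 x.
Proof.
intros D H x.
assert (E1 : is_derive (fun x => f (- x)) x (- f1 (- x))).
{ evar_last; [apply (is_derive_comp f Ropp x (f1 (- x)) (-1)); [apply D|auto_derive; auto; ring]|].
  unfold scal; simpl; unfold mult; simpl; ring. }
assert (E2 : is_derive (fun x => f (- x)) x (k * f1 x)).
{ apply is_derive_ext with (fun x => k * f x); [intros; rewrite H; auto|apply (is_derive_scal f x k), D]. }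
assert (U : - f1 (- x) = k * f1 x).
{ rewrite <- (is_derive_unique _ _ _ E1). apply (is_derive_unique _ _ _ E2). }
lra.
Qed.

Lemma odd_at0 : A1 0 = 0 /\ A3 0 = 0.
Proof.
assert (H0 : forall x, A (- x) = 1 * A x) by (intros; rewrite Aeven; ring).
assert (H1 := odd_derive A A1 _ DA H0). assert (H2 := odd_derive A1 A2 _ DA1 H1).
assert (H3 := odd_derive A2 A3 _ DA2 H2).
specialize (H1 0). specialize (H3 0). rewrite Ropp_0 in H1, H3. lra.
Qed.

Let q1 x := -2 * (A x * A1 x).
Let q2 x := -2 * (A1 x ^ 2 + A x * A2 x).
Let q3 x := -2 * (3 * A1 x * A2 x + A x * A3 x).
Let q4 x := -2 * (3 * A2 x ^ 2 + 4 * A1 x * A3 x + A x * A4 x).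

Lemma q_derive x : is_derive (fun x => - A x ^ 2) x (q1 x) /\ is_derive q1 x (q2 x) /\ is_derive q2 x (q3 x) /\
  is_derive q3 x (q4 x) /\ continuous q4 x.
Proof.
assert (E0 : Derive (fun x => A x) x = A1 x) by apply is_derive_unique, DA.
assert (E1 : Derive (fun x => A1 x) x = A2 x) by apply is_derive_unique, DA1.
assert (E2 : Derive (fun x => A2 x) x = A3 x) by apply is_derive_unique, DA2.
assert (E3 : Derive (fun x => A3 x) x = A4 x) by apply is_derive_unique, DA3.
assert (X0 : ex_derive A x) by (eexists; apply DA). assert (X1 : ex_derive A1 x) by (eexists; apply DA1).
assert (X2 : ex_derive A2 x) by (eexists; apply DA2). assert (X3 : ex_derive A3 x) by (eexists; apply DA3).
assert (X4 : ex_derive A4 x) by (eexists; apply DA4).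
refine (conj _ (conj _ (conj _ (conj _ _)))).
- unfold q1. auto_derive; [auto|]. rewrite E0. ring.
- unfold q1, q2. auto_derive; [auto|]. rewrite E0, E1. ring.
- unfold q2, q3. auto_derive; [auto|]. rewrite E0, E1, E2. ring.
- unfold q3, q4. auto_derive; [repeat split; auto|]. rewrite E0, E1, E2, E3. ring.
- apply (ex_derive_continuous q4 x). unfold q4. auto_derive. repeat split; auto.
Qed.

(** The quotient extends continuously to [0] by [q2 0 / 2 = - A 0 * A2 0 > 0], so it has a positive
    minimum on a compact interval. The nondegenerate maximum of [A] thus gives a slope bound that
    survives as [xs] tends to [0]. *)
Lemma q1_slope X : 0 < X -> exists m M, 0 < m /\ forall x, 0 < x < X -> m <= q1 x / (2 * x) <= M.
Proof.
intros HX. destruct odd_at0 as [Z1 Z3].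
set (h := patch (fun x => q1 x / (2 * x)) 0 (q2 0 / 2)).
assert (Lh : is_lim (fun x => q1 x / (2 * x)) 0 (q2 0 / 2)).
{ apply is_lim_R; intros e He. destruct (q_derive 0) as [_ [D _]].
  destruct (proj1 (is_derive_R _ _ _) D e He) as [d [d0 Hd]]; exists d; split; auto.
  intros y Hy N. specialize (Hd y N Hy). unfold q1 at 2 in Hd. rewrite Z1 in Hd.
  replace (q1 y - -2 * (A 0 * 0) - q2 0 * (y - 0)) with (q1 y - q2 0 * y) in Hd by ring. rewrite Rminus_0_r in Hd.
  replace (q1 y / (2 * y) - q2 0 / 2) with ((q1 y - q2 0 * y) * / (2 * y)) by (field; auto).
  assert (P : 0 < Rabs y) by (apply Rabs_pos_lt; auto).
  rewrite Rabs_mult, Rabs_inv, Rabs_mult, (Rabs_pos_eq 2) by lra.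
  apply Rle_lt_trans with (e * Rabs y * / (2 * Rabs y)).
  - apply Rmult_le_compat_r; auto. left; apply Rinv_0_lt_compat; lra.
  - replace (e * Rabs y * / (2 * Rabs y)) with (e / 2) by (field; lra). lra. }
assert (Ch : forall x, 0 <= x <= X -> continuity_pt h x).
{ intros x Hx. apply continuous_pt. destruct (Req_dec x 0) as [->|N]; [apply patch_continuous; auto|].
  apply is_derive_continuous with ((q2 x * (2 * x) - q1 x * 2) / (2 * x) ^ 2).
  apply is_derive_ext_loc with (fun x => q1 x / (2 * x)); [apply patch_locally; auto|].
  apply (is_derive_div q1 (fun x => 2 * x) x (q2 x) 2); [apply q_derive|auto_derive; auto; ring|lra]. }
assert (Ph : forall x, 0 <= x <= X -> 0 < h x).
{ intros x Hx. unfold h. destruct (Req_dec x 0) as [->|N].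
  - rewrite patch_eq. unfold q2. rewrite Z1. assert (P := Apos 0). nra.
  - rewrite patch_neq by auto. assert (P := Apos x). assert (Q := Adecr x ltac:(lra)).
    apply Rdiv_lt_0_compat; [unfold q1; nra|lra]. }
destruct (continuity_ab_min h 0 X) as [xm [Hm1 Hm2]]; [lra|auto|].
destruct (continuity_ab_maj h 0 X) as [xM [HM1 HM2]]; [lra|auto|].
exists (h xm), (h xM); split; [apply Ph; auto|].
intros x Hx. assert (E : h x = q1 x / (2 * x)) by (apply (patch_neq (fun x => q1 x / (2 * x))); lra). rewrite <- E.
split; [apply Hm1|apply HM1]; lra.
Qed.

(** Evenness makes [q1] and [q3] vanish at [0]. The two quantities build the numerators of the
    second and third derivatives of [- A (sqrt t)^2] in [t], and their powers of [x] cancel the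
    denominators. *)
Lemma q_bounds X : 0 < X -> exists M4, 0 <= M4 /\ forall x, 0 < x < X ->
  Rabs (q3 x) <= M4 * x /\ Rabs (x * q2 x - q1 x) <= M4 * x ^ 3.
Proof.
intros HX. destruct odd_at0 as [Z1 Z3].
assert (C4 : forall x, 0 <= x <= X -> continuity_pt (fun x => Rabs (q4 x)) x).
{ intros x _. apply continuous_pt. apply (continuous_comp q4 Rabs); [apply q_derive|apply continuous_pt, Rcontinuity_abs]. }
destruct (continuity_ab_maj (fun x => Rabs (q4 x)) 0 X) as [xM [HM1 HM2]]; [lra|auto|].
set (M4 := Rabs (q4 xM)). assert (M40 : 0 <= M4) by apply Rabs_pos.
exists M4; split; auto.
assert (B3 : forall x, 0 < x < X -> Rabs (q3 x) <= M4 * x).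
{ intros x Hx. assert (Q0 : q3 0 = 0) by (unfold q3; rewrite Z1, Z3; ring).
  assert (B := mvt_bound q3 q4 0 x M4). rewrite Q0, !Rminus_0_r in B. apply B; [lra| | |].
  - intros y _; apply is_derive_continuous with (q4 y), q_derive.
  - intros y _; apply q_derive.
  - intros y Hy; apply HM1; lra. }
intros x Hx; split; auto.
assert (Q0 : 0 * q2 0 - q1 0 = 0) by (unfold q1; rewrite Z1; ring).
assert (DN : forall y, is_derive (fun x => x * q2 x - q1 x) y (y * q3 y)).
{ intros y. destruct (q_derive y) as [_ [D1 [D2 _]]]. evar_last.
  - apply (is_derive_minus (fun x => x * q2 x) q1); [|exact D1].
    apply (is_derive_mult (fun x => x) q2 y 1 (q3 y)); [apply (is_derive_id y)|exact D2|intros; apply Rmult_comm].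
  - unfold minus, plus, opp, mult; simpl; ring. }
assert (B := mvt_bound (fun x => x * q2 x - q1 x) (fun y => y * q3 y) 0 x (M4 * x ^ 2)). cbv beta in B.
rewrite Q0, !Rminus_0_r in B. replace (M4 * x ^ 3) with (M4 * x ^ 2 * x) by ring. apply B; [lra| | |].
- intros y _; apply is_derive_continuous with (y * q3 y), DN.
- intros y _; apply DN.
- intros y Hy. replace (M4 * x ^ 2) with (x * (M4 * x)) by ring. apply abs_mult_le; [apply abs_pos_le; lra|].
  eapply Rle_trans; [apply B3; lra|]. apply Rmult_le_compat_l; lra.
Qed.

Lemma sqrt_comp_derive (f : R -> R) (t l : R) : 0 < t -> is_derive f (sqrt t) l ->
  is_derive (fun t => f (sqrt t)) t (l / (2 * sqrt t)).
Proof.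
intros Ht D. assert (P : 0 < sqrt t) by (apply sqrt_lt_R0; auto). evar_last.
- apply (is_derive_comp f sqrt t); [exact D|apply is_derive_Reals, derivable_pt_lim_sqrt; auto].
- unfold scal; simpl; unfold mult; simpl. field; lra.
Qed.

Lemma langer_profile X : 0 < X -> exists C, 1 <= C /\ forall xs, 0 < xs < X ->
  exists (E : R) (xi rho rho1 rho2 : R -> R),
    RInt (fun x => sqrt (Rabs (A x ^ 2 - A xs ^ 2))) 0 xs = PI / 4 * E /\ 0 < E /\
    (forall x, 0 < x < X -> 0 < xi x <= C * x /\ is_derive xi x (sqrt (rho x)) /\
       is_derive rho x (rho1 x) /\ continuous rho1 x /\
       / C <= rho x <= C /\ Rabs (rho1 x) <= C * x /\
       rho x * (E - xi x ^ 2) = A x ^ 2 - A xs ^ 2) /\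
    (forall x, 0 < x < X -> x <> xs -> is_derive rho1 x (rho2 x) /\ Rabs (rho2 x) <= C) /\
    (forall x, xs < x < X -> (x ^ 2 - xs ^ 2) / C <= xi x ^ 2 - E).
Proof.
intros HX. destruct (q1_slope X HX) as [m [M [m0 Hm]]]. destruct (q_bounds X HX) as [M4 [M40 HM4]].
set (T := X ^ 2). assert (T0 : 0 < T) by (unfold T; nra).
set (b := fun t => - A (sqrt t) ^ 2).
set (b1 := fun t => q1 (sqrt t) / (2 * sqrt t)).
set (f2 := fun x => (x * q2 x - q1 x) / (4 * x ^ 3)).
set (b2 := fun t => f2 (sqrt t)).
set (b3 := fun t => (sqrt t ^ 2 * q3 (sqrt t) - 3 * (sqrt t * q2 (sqrt t) - q1 (sqrt t))) / (8 * sqrt t ^ 5)).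
assert (In : forall t, 0 < t < T -> 0 < sqrt t < X /\ sqrt t ^ 2 = t).
{ intros t Ht; split; [split|].
  - apply sqrt_lt_R0; lra.
  - rewrite <- (sqrt_pow2 X) by lra. apply sqrt_lt_1_alt; unfold T in Ht; lra.
  - apply pow2_sqrt; lra. }
assert (Db : forall t, 0 < t < T -> is_derive b t (b1 t) /\ m <= b1 t <= M).
{ intros t Ht. destruct (In t Ht) as [I1 I2]. split; [|apply Hm; auto].
  apply (sqrt_comp_derive (fun x => - A x ^ 2)); [lra|apply q_derive]. }
assert (Db1 : forall t, 0 < t < T -> is_derive b1 t (b2 t) /\ Rabs (b2 t) <= M4 / 4).
{ intros t Ht. destruct (In t Ht) as [I1 I2]. destruct (HM4 (sqrt t) I1) as [_ B].
  assert (P3 : 0 < sqrt t ^ 3) by (apply pow_lt; lra). split.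
  - evar_last.
    + apply (sqrt_comp_derive (fun x => q1 x / (2 * x))); [lra|].
      apply (is_derive_div q1 (fun x => 2 * x) (sqrt t) (q2 (sqrt t)) 2); [apply q_derive|auto_derive; auto; ring|lra].
    + unfold b2, f2. field. lra.
  - unfold b2, f2, Rdiv. rewrite Rabs_mult, Rabs_inv, (Rabs_pos_eq (4 * sqrt t ^ 3)) by lra. apply Rle_div_l; lra. }
assert (Db2 : forall t, 0 < t < T -> is_derive b2 t (b3 t) /\ Rabs (t * b3 t) <= M4 / 2).
{ intros t Ht. destruct (In t Ht) as [I1 I2]. destruct (HM4 (sqrt t) I1) as [B3 B].
  assert (P3 : 0 < sqrt t ^ 3) by (apply pow_lt; lra). split.
  - evar_last.
    + apply (sqrt_comp_derive f2); [lra|].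
      apply (is_derive_div (fun x => x * q2 x - q1 x) (fun x => 4 * x ^ 3) (sqrt t) (sqrt t * q3 (sqrt t)) (12 * sqrt t ^ 2)).
      * destruct (q_derive (sqrt t)) as [_ [D1 [D2 _]]]. evar_last.
        -- apply (is_derive_minus (fun x => x * q2 x) q1); [|exact D1].
           apply (is_derive_mult (fun x => x) q2 (sqrt t) 1 (q3 (sqrt t))); [apply (is_derive_id (sqrt t))|exact D2|intros; apply Rmult_comm].
        -- unfold minus, plus, opp, mult; simpl; ring.
      * auto_derive; auto; ring.
      * lra.
    + unfold b3. field. lra.
  - set (x := sqrt t) in *. replace (t * b3 t) with ((x ^ 2 * q3 x - 3 * (x * q2 x - q1 x)) * / (8 * x ^ 3)).
    + rewrite Rabs_mult, Rabs_inv, (Rabs_pos_eq (8 * x ^ 3)) by lra. apply Rle_div_l; [lra|].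
      replace (M4 / 2 * (8 * x ^ 3)) with (x ^ 2 * (M4 * x) + 3 * (M4 * x ^ 3)) by field.
      apply abs_minus_le; apply abs_mult_le; auto; apply abs_pos_le; lra.
    + assert (Z : t * b3 t = x ^ 2 * b3 t) by (rewrite I2; reflexivity). rewrite Z. unfold b3; fold x. field. lra. }
assert (mM : m <= M) by (destruct (Hm (X / 2) ltac:(lra)); lra).
assert (sm : 0 < sqrt m) by (apply sqrt_lt_R0; auto).
assert (sM : sqrt m <= sqrt M) by (apply sqrt_le_1_alt; auto).
set (L := dd_L m (M4 / 4)). set (L2 := dd_L2 T m (M4 / 4) (M4 / 2)).
assert (L0 : 0 <= L).
{ unfold L, dd_L. apply Rmult_le_pos; [lra|]. left; apply Rinv_0_lt_compat; lra. }
assert (L20 : 0 <= L2).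
{ unfold L2, dd_L2. apply Rmult_le_pos; [|left; apply Rinv_0_lt_compat; lra].
  assert (0 <= T * dd_L m (M4 / 4) ^ 2) by (apply Rmult_le_pos; [lra|apply pow2_ge_0]). lra. }
set (C := langer_const X (sqrt m) (sqrt M) L L2).
(* The sign of [C] is read off below from the conclusion for a given [xs], whereas the constant must
   be fixed before [xs]; the added terms secure the lower bound [1]. *)
exists (C + Rabs C + 1). assert (C1 : 1 <= C + Rabs C + 1).
{ assert (Z := Rle_abs (- C)). rewrite Rabs_Ropp in Z. lra. }
split; auto. intros xs Hxs.
assert (Ht : 0 < xs ^ 2 < T) by (unfold T; split; nra).
destruct (divided_difference_sqrt T m M (M4 / 4) (M4 / 2) (xs ^ 2) b b1 b2 b3) as [G [G1 [G2 [HG [CG1 [HG1 EG]]]]]]; auto.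
fold L in HG. fold L2 in HG1.
set (q := fun x => sqrt (Rabs (A x ^ 2 - A xs ^ 2))).
assert (EGx : forall x, 0 < x < X -> G (x ^ 2) ^ 2 * (xs ^ 2 - x ^ 2) = A x ^ 2 - A xs ^ 2).
{ intros x Hx. assert (Hx2 : 0 < x ^ 2 < T) by (unfold T; split; nra). assert (Z := EG _ Hx2).
  unfold b in Z. rewrite !sqrt_pow2 in Z by lra. lra. }
destruct (langer X (sqrt m) (sqrt M) L L2 (conj sm sM) L0 L20 xs q G G1 G2) as [E [xi [rho [rho1 [rho2 [H1 [H2 [H3 [H4 H5]]]]]]]]]; auto.
- intros u. unfold q. apply (continuous_comp (fun x => Rabs (A x ^ 2 - A xs ^ 2)) sqrt); [|apply continuous_sqrt].
  apply (continuous_comp (fun x => A x ^ 2 - A xs ^ 2) Rabs); [|apply continuous_pt, Rcontinuity_abs].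
  apply (ex_derive_continuous (fun x => A x ^ 2 - A xs ^ 2)). auto_derive. exists (A1 u); apply DA.
- intros u Hu. unfold q, jac. rewrite <- EGx by auto.
  assert (Hu2 : 0 < u ^ 2 < T) by (unfold T; split; nra).
  destruct (HG (u ^ 2) Hu2) as [[P _] _].
  rewrite Rabs_mult, (Rabs_pos_eq (G (u ^ 2) ^ 2)) by apply pow2_ge_0.
  rewrite sqrt_mult_alt by apply pow2_ge_0. rewrite sqrt_pow2 by lra. reflexivity.
- fold C in H3, H4, H5.
  assert (C0 : 0 < C).
  { destruct (H3 xs Hxs) as [[Q1 Q2] _]. nra. }
  assert (CC : C <= C + Rabs C + 1) by (assert (Z := Rabs_pos C); lra).
  exists E, xi, rho, rho1, rho2. refine (conj H1 (conj H2 (conj _ (conj _ _)))).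
  + intros x Hx. destruct (H3 x Hx) as [[P1 P2] [P3 [P4 [P5 [[P6 P7] [P8 P9]]]]]].
    refine (conj (conj P1 _) (conj P3 (conj P4 (conj P5 (conj (conj _ _) (conj _ _)))))).
    * nra.
    * apply Rle_trans with (/ C); auto. apply Rinv_le_contravar; lra.
    * lra.
    * nra.
    * rewrite P9. apply EGx; auto.
  + intros x Hx N. destruct (H4 x Hx N). split; auto. lra.
  + intros x Hx. apply Rle_trans with ((x ^ 2 - xs ^ 2) / C); [|apply H5; auto].
    unfold Rdiv. apply Rmult_le_compat_l; [nra|]. apply Rinv_le_contravar; lra.
Qed.

End EvenProfile.

(** * Reduction of decaying solutions *)

Section DecayingSolution.

Variables (A A1 A2 : R -> R) (eps mu : R) (u1 u2 : R -> R).
Hypothesis DA : forall x, is_derive A x (A1 x).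
Hypothesis DA1 : forall x, is_derive A1 x (A2 x).
Hypothesis Apos : forall x, 0 < A x.
Hypothesis Aeven : forall x, A (- x) = A x.
Hypothesis Adecr : forall x, 0 < x -> A1 x < 0.
Hypothesis eps0 : 0 < eps.
Hypothesis mu0 : 0 < mu.
Hypothesis Du1 : forall x, is_derive u1 x ((mu * u1 x + A x * u2 x) / eps).
Hypothesis Du2 : forall x, is_derive u2 x (- (A x * u1 x + mu * u2 x) / eps).
Hypothesis nontriv : exists x, u1 x <> 0 \/ u2 x <> 0.

Let h x := u1 x ^ 2 + u2 x ^ 2.
Hypothesis L2 : exists M, forall a, 0 <= a -> RInt h (- a) a <= M.

Lemma h_derive x : is_derive h x (2 * mu / eps * (u1 x ^ 2 - u2 x ^ 2)).
Proof.
unfold h. evar_last.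
- apply (is_derive_plus (fun x => u1 x ^ 2) (fun x => u2 x ^ 2)).
  + apply (is_derive_comp (fun y => y ^ 2) u1 x (2 * u1 x)); [auto_derive; auto; ring|apply Du1].
  + apply (is_derive_comp (fun y => y ^ 2) u2 x (2 * u2 x)); [auto_derive; auto; ring|apply Du2].
- unfold plus, scal; simpl; unfold mult; simpl. field. lra.
Qed.

Lemma h_continuous x : continuous h x.
Proof. eapply is_derive_continuous, h_derive. Qed.

Lemma h_nonneg x : 0 <= h x.
Proof. unfold h; nra. Qed.

(** As [|h'| <= k * h], both [exp (k * y) * h] and [exp (- k * y) * h] are monotone, in opposite
    directions, so a zero of [h] would spread over the whole line. *)
Lemma solution_unique x : h x <> 0.
Proof.
intros Hx.
set (k := 2 * mu / eps). assert (k0 : 0 < k) by (apply Rdiv_lt_0_compat; lra).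
assert (De : forall s y, is_derive (fun y => exp (s * k * y) * h y) y (exp (s * k * y) * (k * (s * h y + (u1 y ^ 2 - u2 y ^ 2))))).
{ intros s y. evar_last.
  - apply (is_derive_mult (fun y => exp (s * k * y)) h y); [|apply h_derive|intros; apply Rmult_comm].
    instantiate (1 := s * k * exp (s * k * y)). auto_derive; auto; ring.
  - unfold plus, mult; simpl. fold k. ring. }
assert (Z : forall y, h y = 0).
{ intros y. destruct (Rle_lt_dec x y) as [Q|Q].
  - assert (B : - (exp (-1 * k * x) * h x) <= - (exp (-1 * k * y) * h y)).
    { apply (incr_weak (fun y => - (exp (-1 * k * y) * h y)) (fun y => - (exp (-1 * k * y) * (k * (-1 * h y + (u1 y ^ 2 - u2 y ^ 2)))))); auto.
      - intros z _. eapply is_derive_continuous, (is_derive_opp (fun y => exp (-1 * k * y) * h y)), De.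
      - intros z _. apply (is_derive_opp (fun y => exp (-1 * k * y) * h y)), De.
      - intros z _. assert (P := exp_pos (-1 * k * z)). unfold h.
        assert (0 <= exp (-1 * k * z) * (k * (2 * u2 z ^ 2))); [|nra].
        apply Rmult_le_pos; [lra|]. apply Rmult_le_pos; [lra|]. nra. }
    rewrite Hx in B. assert (P := exp_pos (-1 * k * y)). assert (N := h_nonneg y). nra.
  - assert (B : exp (1 * k * y) * h y <= exp (1 * k * x) * h x).
    { apply (incr_weak (fun y => exp (1 * k * y) * h y) (fun y => exp (1 * k * y) * (k * (1 * h y + (u1 y ^ 2 - u2 y ^ 2))))); [lra| | |].
      - intros z _. eapply is_derive_continuous, De.
      - intros z _. apply De.
      - intros z _. assert (P := exp_pos (1 * k * z)). unfold h.
        apply Rmult_le_pos; [lra|]. apply Rmult_le_pos; [lra|]. nra. }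
    rewrite Hx in B. assert (P := exp_pos (1 * k * y)). assert (N := h_nonneg y). nra. }
destruct nontriv as [y [N|N]]; specialize (Z y); unfold h in Z; apply N; nra.
Qed.

Lemma h_pos x : 0 < h x.
Proof. assert (A0 := h_nonneg x). assert (N := solution_unique x). lra. Qed.

Lemma not_bounded_below x0 kappa : 0 <= x0 -> 0 < kappa -> (forall x, x0 <= x -> kappa <= h x) -> False.
Proof.
intros H0 Hk B. destruct L2 as [M HM].
assert (C := h_continuous).
set (a := x0 + (Rabs M + 1) / kappa).
assert (P : 0 < (Rabs M + 1) / kappa) by (apply Rdiv_lt_0_compat; auto; assert (Z := Rabs_pos M); lra).
assert (Ha : x0 < a) by (unfold a; lra).
specialize (HM a ltac:(lra)). rewrite (rint_chasles h C (- a) x0 a) in HM.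
assert (B1 : 0 * (x0 - - a) <= RInt h (- a) x0) by (apply rint_lower; auto; [lra|]; intros; apply h_nonneg).
assert (B2 : kappa * (a - x0) <= RInt h x0 a) by (apply rint_lower; auto; [lra|]; intros; apply B; lra).
replace (kappa * (a - x0)) with (Rabs M + 1) in B2 by (unfold a; field; lra).
assert (Z := Rle_abs M). lra.
Qed.

(* Wronskian of [u] and its mirror image [(u2 (-x), u1 (-x))]. *)
Lemma symmetric_at_0 : u1 0 ^ 2 = u2 0 ^ 2.
Proof.
set (w := fun x => u1 x * u1 (- x) - u2 x * u2 (- x)).
assert (Dr : forall f f' x, (forall y, is_derive f y (f' y)) -> is_derive (fun y => f (- y)) x (- f' (- x))).
{ intros f f' x D. evar_last; [apply (is_derive_comp f Ropp x (f' (- x)) (-1)); [apply D|auto_derive; auto; ring]|].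
  unfold scal; simpl; unfold mult; simpl; ring. }
assert (Dw : forall x, is_derive w x 0).
{ intros x. unfold w. evar_last.
  - apply (is_derive_minus (fun x => u1 x * u1 (- x)) (fun x => u2 x * u2 (- x))).
    + apply (is_derive_mult u1 (fun x => u1 (- x)) x); [apply Du1|apply (Dr u1 _ x Du1)|intros; apply Rmult_comm].
    + apply (is_derive_mult u2 (fun x => u2 (- x)) x); [apply Du2|apply (Dr u2 _ x Du2)|intros; apply Rmult_comm].
  - unfold minus, plus, opp, mult; simpl. rewrite Aeven. field. lra. }
assert (Cw : forall x, w x = w 0).
{ assert (W : forall a b, a <= b -> w b = w a).
  { intros a b ab. assert (B := mvt_bound w (fun _ => 0) a b 0 ab). apply Rminus_diag_uniq.
    assert (Z : Rabs (w b - w a) <= 0 * (b - a)).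
    { apply B; intros; [eapply is_derive_continuous, Dw|apply Dw|rewrite Rabs_R0; lra]. }
    rewrite Rmult_0_l in Z. apply Rabs_eq_0. assert (P := Rabs_pos (w b - w a)). lra. }
  intros x. destruct (Rle_lt_dec 0 x); [apply W; auto|symmetry; apply W; lra]. }
assert (E0 : w 0 = u1 0 ^ 2 - u2 0 ^ 2) by (unfold w; rewrite Ropp_0; ring).
assert (Bw : forall x, 2 * Rabs (w 0) <= h x + h (- x)).
{ intros x. rewrite <- (Cw x). unfold w, h.
  destruct (Rle_lt_dec 0 (u1 x * u1 (- x) - u2 x * u2 (- x))) as [Q|Q].
  - rewrite Rabs_pos_eq by auto. assert (0 <= (u1 x - u1 (- x)) ^ 2) by apply pow2_ge_0.
    assert (0 <= (u2 x + u2 (- x)) ^ 2) by apply pow2_ge_0. nra.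
  - rewrite Rabs_left by auto. assert (0 <= (u1 x + u1 (- x)) ^ 2) by apply pow2_ge_0.
    assert (0 <= (u2 x - u2 (- x)) ^ 2) by apply pow2_ge_0. nra. }
destruct (Req_dec (w 0) 0) as [Z|N]; [lra|exfalso].
set (k := Rabs (w 0)) in *. assert (k0 : 0 < k) by (apply Rabs_pos_lt; auto).
assert (C := h_continuous). destruct L2 as [M HM].
set (a := (Rabs M + 1) / (2 * k)).
assert (a0 : 0 < a) by (apply Rdiv_lt_0_compat; [assert (Z := Rabs_pos M)|]; lra).
assert (D0 : forall x, is_derive (fun x => RInt h 0 x) x (h x)) by (intros; apply rint_derive, C).
assert (B : RInt h 0 0 - RInt h 0 (- 0) - 2 * k * 0 <= RInt h 0 a - RInt h 0 (- a) - 2 * k * a).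
{ assert (DD : forall x, is_derive (fun a => RInt h 0 a - RInt h 0 (- a) - 2 * k * a) x (h x + h (- x) - 2 * k)).
  { intros x. evar_last.
    - apply (is_derive_minus (fun a => RInt h 0 a - RInt h 0 (- a)) (fun a => 2 * k * a)).
      + apply (is_derive_minus (fun a => RInt h 0 a) (fun a => RInt h 0 (- a))); [apply D0|].
        apply (Dr (fun a => RInt h 0 a) h x D0).
      + instantiate (1 := 2 * k). auto_derive; auto; ring.
    - unfold minus, plus, opp; simpl; ring. }
  apply (incr_weak (fun a => RInt h 0 a - RInt h 0 (- a) - 2 * k * a) (fun x => h x + h (- x) - 2 * k)); [lra| | |].
  - intros x _; eapply is_derive_continuous, DD.
  - intros x _; apply DD.
  - intros x _; specialize (Bw x); lra. }
rewrite Ropp_0 in B.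
specialize (HM a ltac:(lra)). assert (E := rint_chasles h C 0 (- a) a).
assert (E1 : 2 * k * a = Rabs M + 1) by (unfold a; field; lra).
assert (Z := Rle_abs M). lra.
Qed.

Section Tail.

Variable xs : R.
Hypothesis xs0 : 0 <= xs.
Hypothesis Axs : A xs = mu.

Lemma A_below x : xs < x -> A x < mu.
Proof.
intros H. rewrite <- Axs. assert (- A xs < - A x); [|lra].
apply (incr_strict (fun x => - A x) (fun x => - A1 x)); auto.
- intros y _; eapply is_derive_continuous, (is_derive_opp A), DA.
- intros y _; apply (is_derive_opp A), DA.
- intros y Hy; assert (Z := Adecr y ltac:(lra)); lra.
Qed.

Lemma diff_derive x : is_derive (fun x => u1 x ^ 2 - u2 x ^ 2) x ((2 * mu * h x + 4 * A x * (u1 x * u2 x)) / eps).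
Proof.
evar_last.
- apply (is_derive_minus (fun x => u1 x ^ 2) (fun x => u2 x ^ 2)).
  + apply (is_derive_comp (fun y => y ^ 2) u1 x (2 * u1 x)); [auto_derive; auto; ring|apply Du1].
  + apply (is_derive_comp (fun y => y ^ 2) u2 x (2 * u2 x)); [auto_derive; auto; ring|apply Du2].
- unfold minus, plus, opp, scal; simpl; unfold mult; simpl. unfold h. field. lra.
Qed.

Lemma diff_incr x y : xs <= x < y -> u1 x ^ 2 - u2 x ^ 2 < u1 y ^ 2 - u2 y ^ 2.
Proof.
intros H.
apply (incr_strict (fun x => u1 x ^ 2 - u2 x ^ 2) (fun x => (2 * mu * h x + 4 * A x * (u1 x * u2 x)) / eps)); [lra| | |].
- intros z _; eapply is_derive_continuous, diff_derive.
- intros z _; apply diff_derive.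
- intros z Hz. apply Rdiv_lt_0_compat; auto. assert (B := A_below z ltac:(lra)). assert (P := h_pos z). assert (Az := Apos z).
  assert (Q : - h z <= 2 * (u1 z * u2 z)) by (unfold h; assert (0 <= (u1 z + u2 z) ^ 2) by apply pow2_ge_0; nra). nra.
Qed.

(** Where [A < mu] the difference [u1^2 - u2^2] increases. Once nonnegative, it would eventually
    stay above a positive constant, against square integrability. *)
Lemma diff_neg x : xs <= x -> u1 x ^ 2 < u2 x ^ 2.
Proof.
intros Hx. apply Rnot_le_lt; intros N.
assert (I := diff_incr x (x + 1) ltac:(lra)).
apply (not_bounded_below (x + 1) (u1 (x + 1) ^ 2 - u2 (x + 1) ^ 2)); [lra|lra|].
intros y [Hy|<-].
- assert (J := diff_incr (x + 1) y ltac:(lra)). unfold h. assert (0 <= u2 y ^ 2) by apply pow2_ge_0. lra.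
- unfold h. assert (0 <= u2 (x + 1) ^ 2) by apply pow2_ge_0. lra.
Qed.

(** Because [u1^2 < u2^2], the product [u1 * u2] is nondecreasing; a positive value would bound [h]
    away from [0] ever after. *)
Lemma prod_nonpos x : xs <= x -> u1 x * u2 x <= 0.
Proof.
intros Hx. apply Rnot_lt_le; intros N.
assert (D : forall y, is_derive (fun y => u1 y * u2 y) y (A y * (u2 y ^ 2 - u1 y ^ 2) / eps)).
{ intros y. evar_last.
  - apply (is_derive_mult u1 u2 y); [apply Du1|apply Du2|intros; apply Rmult_comm].
  - unfold plus, mult; simpl. field. lra. }
apply (not_bounded_below x (2 * (u1 x * u2 x))); [lra|lra|].
intros y Hy. assert (I : u1 x * u2 x <= u1 y * u2 y).
{ apply (incr_weak (fun y => u1 y * u2 y) (fun y => A y * (u2 y ^ 2 - u1 y ^ 2) / eps)); [exact Hy| | |].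
  - intros z _; eapply is_derive_continuous, D.
  - intros z _; apply D.
  - intros z Hz. assert (B := diff_neg z ltac:(lra)). assert (Az := Apos z).
    apply Rmult_le_pos; [|left; apply Rinv_0_lt_compat; auto]. apply Rmult_le_pos; lra. }
unfold h. assert (0 <= (u1 y - u2 y) ^ 2) by apply pow2_ge_0. nra.
Qed.

(** At [mu = A 0] the forbidden region starts at [0], where symmetry forces [u1^2 = u2^2]. This
    settles the endpoint at which Langer's variable degenerates. *)
Lemma top_no_solution : xs = 0 -> False.
Proof. intros E. assert (B := diff_neg 0 ltac:(lra)). rewrite symmetric_at_0 in B. lra. Qed.

End Tail.

(** With [a = A + mu] this is [sqrt a * (1 / sqrt a)''], the price of removing the first derivative
    from the equation of [u1 - u2]. It does not involve [eps]. *)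
Definition schwarz x := 3 / 4 * (A1 x / (A x + mu)) ^ 2 - A2 x / (2 * (A x + mu)).

(** For [p = u1 + u2] and [q = u1 - u2] the system reads [eps * p' = (mu - A) * q] and
    [eps * q' = (mu + A) * p]. Eliminating [p] divides by [mu + A], which never vanishes, whereas
    eliminating [q] would divide by [0] at the turning points. Symmetry gives [p * q = 0] at [0],
    which decides the parity. *)
Lemma schrodinger_reduction xs : 0 <= xs -> A xs = mu ->
  exists (w w1 : R -> R) (p : nat), (p <= 1)%nat /\
   (forall x, is_derive w x (w1 x) /\
     is_derive w1 x ((schwarz x - (A x ^ 2 - mu ^ 2) / eps ^ 2) * w x) /\ (w x = 0 -> w1 x <> 0)) /\
   (p = 1%nat -> w 0 = 0) /\ (p = 0%nat -> w1 0 = 0) /\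
   (forall x, xs <= x -> w x <> 0 /\
      - ((A x + mu) / eps + Rabs (A1 x) / mu) * w x ^ 2 <= w1 x * w x <= Rabs (A1 x) / mu * w x ^ 2).
Proof.
intros Hxs Axs.
set (al := fun x => sqrt (A x + mu)).
assert (P : forall x, 0 < A x + mu) by (intros x; assert (Z := Apos x); lra).
assert (al0 : forall x, 0 < al x) by (intros x; apply sqrt_lt_R0, P).
assert (al2 : forall x, al x * al x = A x + mu) by (intros x; apply sqrt_sqrt; left; apply P).
assert (Dal : forall x, is_derive al x (A1 x / (2 * al x))).
{ intros x. evar_last.
  - apply (is_derive_comp sqrt (fun x => A x + mu) x (/ (2 * al x)) (A1 x)).
    + apply is_derive_Reals, derivable_pt_lim_sqrt, P.
    + evar_last; [apply (is_derive_plus A (fun _ => mu)); [apply DA|apply (is_derive_const mu)]|]. unfold plus, zero; simpl; ring.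
  - unfold scal; simpl; unfold mult; simpl. unfold Rdiv; ring. }
set (p := fun x => u1 x + u2 x). set (q := fun x => u1 x - u2 x).
assert (Dp : forall x, is_derive p x ((mu - A x) * q x / eps)).
{ intros x. evar_last; [apply (is_derive_plus u1 u2); [apply Du1|apply Du2]|]. unfold plus, q; simpl. field; lra. }
assert (Dq : forall x, is_derive q x (al x * al x * p x / eps)).
{ intros x. evar_last; [apply (is_derive_minus u1 u2); [apply Du1|apply Du2]|]. rewrite al2. unfold minus, plus, opp, p; simpl. field; lra. }
set (w := fun x => q x / al x).
set (w1 := fun x => al x * p x / eps - A1 x * q x / (2 * al x ^ 3)).
assert (al3 : forall x, 0 < al x ^ 3) by (intros x; apply pow_lt; auto).
assert (Dw : forall x, is_derive w x (w1 x)).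
{ intros x. assert (Z := al0 x). evar_last.
  - apply (is_derive_div q al x); [apply Dq|apply Dal|lra].
  - unfold w1. field. lra. }
assert (Dw1 : forall x, is_derive w1 x ((schwarz x - (A x ^ 2 - mu ^ 2) / eps ^ 2) * w x)).
{ intros x. assert (Z := al0 x). unfold w1. evar_last.
  - apply (is_derive_minus (fun x => al x * p x / eps) (fun x => A1 x * q x / (2 * al x ^ 3))).
    + apply (is_derive_scal_l (fun x => al x * p x) x (A1 x / (2 * al x) * p x + al x * ((mu - A x) * q x / eps)) (/ eps)).
      apply (is_derive_mult al p x); [apply Dal|apply Dp|intros; apply Rmult_comm].
    + apply (is_derive_div (fun x => A1 x * q x) (fun x => 2 * al x ^ 3) x).
      * apply (is_derive_mult A1 q x); [apply DA1|apply Dq|intros; apply Rmult_comm].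
      * apply (is_derive_scal (fun x => al x ^ 3) x 2). apply (is_derive_comp (fun y => y ^ 3) al x (3 * al x ^ 2)); [auto_derive; auto; ring|apply Dal].
      * specialize (al3 x). lra.
  - unfold minus, plus, opp, mult, scal; simpl; unfold mult; simpl. unfold schwarz, w.
    assert (EA : A x = al x * al x - mu) by (rewrite al2; ring). rewrite EA.
    field. repeat split; [lra|lra|]. replace (al x * al x - mu + mu) with (al x * al x) by ring. assert (0 < al x * al x) by (apply Rmult_lt_0_compat; auto). lra. }
assert (Par : exists k : nat, (k <= 1)%nat /\ (k = 1%nat -> q 0 = 0) /\ (k = 0%nat -> p 0 = 0)).
{ assert (S := symmetric_at_0). assert (S' : p 0 * q 0 = 0) by (unfold p, q; lra).
  destruct (Rmult_integral _ _ S') as [E|E]; [exists 0%nat|exists 1%nat]; repeat split; auto; intros; discriminate. }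
assert (A10 : A1 0 = 0).
{ assert (E1 : is_derive (fun x => A (- x)) 0 (- A1 0)).
  { evar_last; [apply (is_derive_comp A Ropp 0 (A1 (- 0)) (-1)); [apply DA|auto_derive; auto; ring]|].
    unfold scal; simpl; unfold mult; simpl. rewrite Ropp_0; ring. }
  assert (E2 : is_derive (fun x => A (- x)) 0 (A1 0)) by (apply is_derive_ext with A; [intros; symmetry; apply Aeven|apply DA]).
  assert (U : - A1 0 = A1 0) by (rewrite <- (is_derive_unique _ _ _ E1); apply (is_derive_unique _ _ _ E2)). lra. }
destruct Par as [k [K1 [K2 K3]]]. exists w, w1, k.
refine (conj K1 (conj _ (conj _ (conj _ _)))).
- intros x. refine (conj (Dw x) (conj (Dw1 x) _)). intros E E1.
  assert (Z := al0 x). assert (Q0 : q x = 0).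
  { unfold w in E. destruct (Rmult_integral _ _ E) as [|F]; auto. exfalso.
    assert (0 < / al x) by (apply Rinv_0_lt_compat; auto). lra. }
  assert (P0 : p x = 0).
  { unfold w1 in E1. rewrite Q0 in E1. replace (al x * p x / eps - A1 x * 0 / (2 * al x ^ 3)) with (al x * p x / eps) in E1 by (field; split; lra).
    assert (E2 : al x * p x = 0) by (apply Rmult_eq_reg_r with (/ eps); [rewrite Rmult_0_l; exact E1|apply Rinv_neq_0_compat; lra]).
    destruct (Rmult_integral _ _ E2); lra. }
  apply (solution_unique x). unfold h, p, q in *. nra.
- intros E. unfold w. rewrite K2 by auto. unfold Rdiv; ring.
- intros E. unfold w1. rewrite K3, A10 by auto. unfold Rdiv; ring.
- intros x Hx. assert (Z := al0 x).
  assert (B1 := diff_neg xs Hxs Axs x Hx). assert (B2 := prod_nonpos xs Hxs Axs x Hx).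
  assert (PQ : p x * q x < 0) by (unfold p, q; lra).
  (* [p * q + q^2 = 2 * u1 * (u1 - u2)] is nonnegative because [u1 * u2 <= 0]. *)
  assert (PQ2 : - q x ^ 2 <= p x * q x) by (unfold p, q; nra).
  assert (W2 : w x ^ 2 = q x ^ 2 / (A x + mu)) by (rewrite <- al2; unfold w; field; lra).
  assert (W1 : w1 x * w x = p x * q x / eps - A1 x / (2 * (A x + mu)) * w x ^ 2).
  { rewrite W2, <- al2. unfold w1, w. field. lra. }
  assert (Q0 : q x <> 0) by (intros E; rewrite E in PQ; lra).
  split.
  + unfold w. intros E. destruct (Rmult_integral _ _ E) as [|F]; [lra|].
    assert (0 < / al x) by (apply Rinv_0_lt_compat; auto). lra.
  + rewrite W1.
    assert (T : Rabs (A1 x / (2 * (A x + mu))) <= Rabs (A1 x) / mu).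
    { unfold Rdiv; rewrite Rabs_mult, Rabs_inv. apply Rmult_le_compat_l; [apply Rabs_pos|].
      assert (Az := Apos x). rewrite Rabs_pos_eq by lra. apply Rinv_le_contravar; lra. }
    apply Rabs_le_between in T.
    assert (E1 : - ((A x + mu) / eps * w x ^ 2) <= p x * q x / eps).
    { rewrite W2. replace (- ((A x + mu) / eps * (q x ^ 2 / (A x + mu)))) with (- q x ^ 2 / eps) by (field; split; [specialize (P x)|]; lra).
      apply Rmult_le_compat_r; [left; apply Rinv_0_lt_compat; lra|lra]. }
    assert (E2 : p x * q x / eps <= 0).
    { assert (0 < / eps) by (apply Rinv_0_lt_compat; auto). unfold Rdiv. nra. }
    split; nra.
Qed.

End DecayingSolution.

(** * The transported oscillator *)

Lemma has_zeros_pull (f phi : R -> R) b n :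
  (forall x y, 0 < x < y -> y <= b -> phi x < phi y) -> 0 < b ->
  (forall z, 0 < z < phi b -> exists x, 0 < x < b /\ phi x = z) ->
  has_zeros f 0 (phi b) n -> has_zeros (fun x => f (phi x)) 0 b n.
Proof.
revert b; induction n as [|n IH]; intros b Hi b0 Hs; simpl; auto.
intros [z [Hz [Fz Hn]]]. destruct (Hs z Hz) as [x [Hx Ex]].
exists x. rewrite Ex. refine (conj Hx (conj Fz _)). apply IH; [|lra| |rewrite Ex; auto].
- intros u v Huv Hv; apply Hi; lra.
- intros t Ht. destruct (Hs t) as [y [Hy Ey]]; [lra|]. exists y; split; auto. split; [lra|].
  apply Rnot_le_lt; intros [Q|Q]; [|subst; lra]. assert (phi x < phi y) by (apply Hi; lra). lra.
Qed.

Lemma has_zeros_push (f phi : R -> R) b n :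
  (forall x y, 0 < x < y -> y <= b -> phi x < phi y) -> (forall x, 0 < x <= b -> 0 < phi x) ->
  has_zeros (fun x => f (phi x)) 0 b n -> has_zeros f 0 (phi b) n.
Proof.
revert b; induction n as [|n IH]; intros b Hi Hp; simpl; auto.
intros [x [Hx [Fx Hn]]]. exists (phi x). refine (conj (conj _ _) (conj Fx _)).
- apply Hp; lra.
- apply Hi; lra.
- apply IH; auto.
  + intros u v Huv Hv; apply Hi; lra.
  + intros u Hu; apply Hp; lra.
Qed.

(* Two decaying solutions in the forbidden region: if the log-derivative of [f] stayed above that of [g],
   their difference would grow like [exp (lam * x)], beyond its a priori bound. *)
Lemma forbidden_comparison (f f1 g g1 Ff Fg : R -> R) (x1 lam Dm : R) :
  (forall x, x1 <= x <= x1 + 1 -> is_derive f x (f1 x) /\ is_derive f1 x (Ff x * f x) /\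
     is_derive g x (g1 x) /\ is_derive g1 x (Fg x * g x) /\ 1 <= Ff x - Fg x /\ f x <> 0 /\ g x <> 0 /\
     f1 x / f x + g1 x / g x <= - lam) ->
  0 <= lam -> f1 (x1 + 1) / f (x1 + 1) - g1 (x1 + 1) / g (x1 + 1) <= Dm -> Dm < lam ^ 2 / 6 ->
  exists x, x1 <= x <= x1 + 1 /\ (f1 x * g x - f x * g1 x) * (f x * g x) < 0.
Proof.
intros H lam0 HD HDm. apply NNPP; intros NE.
set (d := fun x => f1 x / f x - g1 x / g x).
assert (P : forall x, x1 <= x <= x1 + 1 -> 0 <= d x).
{ intros x Hx. destruct (H x Hx) as [_ [_ [_ [_ [_ [Nf [Ng _]]]]]]]. apply Rnot_lt_le; intros Q. apply NE; exists x; split; auto.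
  replace ((f1 x * g x - f x * g1 x) * (f x * g x)) with (d x * (f x * g x) ^ 2) by (unfold d; field; auto).
  assert (0 < (f x * g x) ^ 2).
  { assert (f x * g x <> 0) by (apply Rmult_integral_contrapositive_currified; auto).
    assert (0 <= (f x * g x) ^ 2) by apply pow2_ge_0. assert (N := pow_nonzero (f x * g x) 2 H0). lra. }
  nra. }
set (d' := fun x => (Ff x - Fg x) - (f1 x / f x + g1 x / g x) * d x).
assert (D : forall x, x1 <= x <= x1 + 1 -> is_derive d x (d' x)).
{ intros x Hx. destruct (H x Hx) as [D1 [D2 [D3 [D4 [_ [Nf [Ng _]]]]]]]. evar_last.
  - apply (is_derive_minus (fun x => f1 x / f x) (fun x => g1 x / g x)).
    + apply (is_derive_div f1 f x _ _ D2 D1 Nf).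
    + apply (is_derive_div g1 g x _ _ D4 D3 Ng).
  - unfold minus, plus, opp; simpl. unfold d', d. field. auto. }
assert (G : forall x, x1 <= x <= x1 + 1 -> 1 + lam * d x <= d' x).
{ intros x Hx. destruct (H x Hx) as [_ [_ [_ [_ [K [_ [_ S]]]]]]]. specialize (P x Hx). unfold d'. nra. }
(* From [d' >= 1 + lam * d], three lower bounds are bootstrapped, the first Taylor terms of
   [(exp (lam * (x - x1)) - 1) / lam]. The third yields [lam^2 / 6]; this suffices since [lam] and
   [Dm] will both be of order [1 / eps]. *)
assert (Step : forall e e' : R -> R, (forall x, is_derive e x (e' x)) -> e x1 = 0 ->
  (forall x, x1 <= x <= x1 + 1 -> e' x <= 1 + lam * d x) -> forall x, x1 <= x <= x1 + 1 -> e x <= d x).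
{ intros e e' De E0 B x Hx.
  assert (I : d x1 - e x1 <= d x - e x).
  { apply (incr_weak (fun x => d x - e x) (fun x => d' x - e' x)); [lra| | |].
    - intros y Hy. apply is_derive_continuous with (d' y - e' y).
      apply (is_derive_minus d e); [apply D; lra|apply De].
    - intros y Hy. apply (is_derive_minus d e); [apply D; lra|apply De].
    - intros y Hy. specialize (G y ltac:(lra)). specialize (B y ltac:(lra)). lra. }
  specialize (P x1 ltac:(lra)). lra. }
assert (S1 : forall x, x1 <= x <= x1 + 1 -> x - x1 <= d x).
{ apply (Step (fun x => x - x1) (fun _ => 1)); [intros; auto_derive; auto; ring|ring|].
  intros x Hx; specialize (P x Hx); nra. }
assert (S2 : forall x, x1 <= x <= x1 + 1 -> lam * (x - x1) ^ 2 / 2 <= d x).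
{ apply (Step (fun x => lam * (x - x1) ^ 2 / 2) (fun x => lam * (x - x1))); [intros; auto_derive; auto; field|field|].
  intros x Hx; specialize (S1 x Hx); nra. }
assert (S3 : forall x, x1 <= x <= x1 + 1 -> lam ^ 2 * (x - x1) ^ 3 / 6 <= d x).
{ apply (Step (fun x => lam ^ 2 * (x - x1) ^ 3 / 6) (fun x => lam ^ 2 * (x - x1) ^ 2 / 2)); [intros; auto_derive; auto; field|field|].
  intros x Hx; specialize (S2 x Hx).
  replace (lam ^ 2 * (x - x1) ^ 2 / 2) with (lam * (lam * (x - x1) ^ 2 / 2)) by field.
  assert (lam * (lam * (x - x1) ^ 2 / 2) <= lam * d x) by (apply Rmult_le_compat_l; auto). lra. }
specialize (S3 (x1 + 1) ltac:(lra)). unfold d in S3.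
replace (lam ^ 2 * (x1 + 1 - x1) ^ 3 / 6) with (lam ^ 2 / 6) in S3 by field. lra.
Qed.

Section ModelSolution.

(* [mv] solves the oscillator equation transported by [xi], with [xi' = sqrt rho]. *)
Variables (X C E eps : R) (xs : R) (xi rho rho1 rho2 : R -> R) (k : nat).
Hypothesis C1 : 1 <= C.
Hypothesis eps0 : 0 < eps.
Hypothesis E0 : 0 < E.
Hypothesis xs0 : 0 < xs < X.
Hypothesis H1 : forall x, 0 < x < X -> 0 < xi x <= C * x /\ is_derive xi x (sqrt (rho x)) /\
       is_derive rho x (rho1 x) /\ continuous rho1 x /\
       / C <= rho x <= C /\ Rabs (rho1 x) <= C * x.
Hypothesis H2 : forall x, 0 < x < X -> x <> xs -> is_derive rho1 x (rho2 x) /\ Rabs (rho2 x) <= C.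

(** [rho^(-1/4) = xi'^(-1/2)], the Liouville factor that cancels the first derivative term created
    by the change of variable. *)
Definition amp x := exp (- ln (rho x) / 4).
Definition yv x := xi x / sqrt eps.
Definition mv x := amp x * psi k (yv x).
Definition mv1 x := amp x * (- rho1 x / (4 * rho x) * psi k (yv x) + sqrt (rho x) / sqrt eps * psi1 k (yv x)).
(** This is [amp'' / amp], the error that the change of variable adds to the potential. *)
Definition sch x := 5 / 16 * (rho1 x / rho x) ^ 2 - rho2 x / (4 * rho x).
Definition mF x := sch x + rho x * (xi x ^ 2 - eps * (2 * INR k + 1)) / eps ^ 2.

Lemma rho_pos x : 0 < x < X -> 0 < rho x.
Proof. intros Hx; destruct (H1 x Hx) as [_ [_ [_ [_ [[B _] _]]]]]. assert (0 < / C) by (apply Rinv_0_lt_compat; lra). lra. Qed.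

Lemma amp_pos x : 0 < amp x.
Proof. apply exp_pos. Qed.

Lemma amp_derive x : 0 < x < X -> is_derive amp x (amp x * (- rho1 x / (4 * rho x))).
Proof.
intros Hx. assert (P := rho_pos x Hx). destruct (H1 x Hx) as [_ [_ [D _]]]. evar_last.
- apply (is_derive_comp (fun r => exp (- ln r / 4)) rho x (exp (- ln (rho x) / 4) * (- / rho x / 4)) (rho1 x)); auto.
  auto_derive; auto. unfold Rdiv. ring.
- unfold scal; simpl; unfold mult; simpl. unfold amp. field. lra.
Qed.

Lemma yv_derive x : 0 < x < X -> is_derive yv x (sqrt (rho x) / sqrt eps).
Proof.
intros Hx. destruct (H1 x Hx) as [_ [D _]].
apply (is_derive_scal_l xi x (sqrt (rho x)) (/ sqrt eps)); auto.
Qed.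

Lemma sqrt_eps : 0 < sqrt eps /\ sqrt eps * sqrt eps = eps.
Proof. split; [apply sqrt_lt_R0; auto|apply sqrt_sqrt; lra]. Qed.

Lemma mv_derive x : 0 < x < X -> is_derive mv x (mv1 x).
Proof.
intros Hx. evar_last.
- apply (is_derive_mult amp (fun x => psi k (yv x)) x); [apply amp_derive; auto| |intros; apply Rmult_comm].
  apply (is_derive_comp (psi k) yv x); [apply psi_derive|apply yv_derive; auto].
- unfold plus, mult, scal; simpl; unfold mult; simpl. unfold mv1. ring.
Qed.

Lemma sqrt_rho_derive x : 0 < x < X -> is_derive (fun x => sqrt (rho x)) x (rho1 x / (2 * sqrt (rho x))).
Proof.
intros Hx. assert (P := rho_pos x Hx). destruct (H1 x Hx) as [_ [_ [D _]]]. evar_last.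
- apply (is_derive_comp sqrt rho x); [apply is_derive_Reals, derivable_pt_lim_sqrt; auto|exact D].
- unfold scal; simpl; unfold mult; simpl. unfold Rdiv; ring.
Qed.

Lemma mv1_derive x : 0 < x < X -> x <> xs -> is_derive mv1 x (mF x * mv x).
Proof.
intros Hx N. assert (P := rho_pos x Hx). destruct (H1 x Hx) as [_ [_ [D _]]]. destruct (H2 x Hx N) as [D2 _].
assert (SP : 0 < sqrt (rho x)) by (apply sqrt_lt_R0; auto).
assert (S2 : sqrt (rho x) * sqrt (rho x) = rho x) by (apply sqrt_sqrt; lra).
destruct sqrt_eps as [E1 E2].
unfold mv1. evar_last.
- apply (is_derive_mult amp (fun x => - rho1 x / (4 * rho x) * psi k (yv x) + sqrt (rho x) / sqrt eps * psi1 k (yv x)) x);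
    [apply amp_derive; auto| |intros; apply Rmult_comm].
  apply (is_derive_plus (fun x => - rho1 x / (4 * rho x) * psi k (yv x)) (fun x => sqrt (rho x) / sqrt eps * psi1 k (yv x))).
  + apply (is_derive_mult (fun x => - rho1 x / (4 * rho x)) (fun x => psi k (yv x)) x).
    * apply (is_derive_div (fun x => - rho1 x) (fun x => 4 * rho x) x (- rho2 x) (4 * rho1 x)); [apply (is_derive_opp rho1); auto|apply (is_derive_scal rho x 4); auto|lra].
    * apply (is_derive_comp (psi k) yv x); [apply psi_derive|apply yv_derive; auto].
    * intros; apply Rmult_comm.
  + apply (is_derive_mult (fun x => sqrt (rho x) / sqrt eps) (fun x => psi1 k (yv x)) x).
    * apply (is_derive_scal_l (fun x => sqrt (rho x)) x (rho1 x / (2 * sqrt (rho x))) (/ sqrt eps)). apply sqrt_rho_derive; auto.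
    * apply (is_derive_comp (psi1 k) yv x); [apply psi1_derive|apply yv_derive; auto].
    * intros; apply Rmult_comm.
- unfold plus, mult, scal; simpl; unfold mult; simpl. unfold mF, sch, mv.
  replace (yv x ^ 2) with (xi x ^ 2 / eps) by (rewrite <- E2; unfold yv; field; lra).
  replace (yv x * (yv x * 1)) with (xi x ^ 2 / eps) by (rewrite <- E2; unfold yv; field; lra).
  set (S := sqrt (rho x)) in *. rewrite <- S2. set (se := sqrt eps) in *. rewrite <- E2. field. split; lra.
Qed.

Lemma mv_zero x : mv x = 0 <-> hermite k (yv x) = 0.
Proof.
rewrite <- psi_zero. unfold mv. assert (P := amp_pos x). split; intros Z.
- destruct (Rmult_integral _ _ Z); auto; lra.
- rewrite Z; ring.
Qed.

Lemma mv_simple x : 0 < x < X -> mv x = 0 -> mv1 x <> 0.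
Proof.
intros Hx Z Z1. apply mv_zero, psi_zero in Z. unfold mv1 in Z1. rewrite Z in Z1.
assert (P := amp_pos x). assert (SP : 0 < sqrt (rho x)) by (apply sqrt_lt_R0, rho_pos; auto). destruct sqrt_eps as [E1 E2].
assert (Q : 0 < sqrt (rho x) / sqrt eps) by (apply Rdiv_lt_0_compat; auto).
destruct (Rmult_integral _ _ Z1) as [B|B]; [lra|]. rewrite Rmult_0_r, Rplus_0_l in B.
destruct (Rmult_integral _ _ B) as [B'|B']; [lra|]. apply (psi_simple k (yv x)); auto.
Qed.

Lemma mv1_continuous x : 0 < x < X -> continuous mv1 x.
Proof.
intros Hx. destruct (H1 x Hx) as [_ [_ [D [CR _]]]]. assert (P := rho_pos x Hx).
unfold mv1. apply (continuous_mult amp (fun x => - rho1 x / (4 * rho x) * psi k (yv x) + sqrt (rho x) / sqrt eps * psi1 k (yv x))).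
{ eapply is_derive_continuous, amp_derive; auto. }
apply (continuous_plus (fun x => - rho1 x / (4 * rho x) * psi k (yv x)) (fun x => sqrt (rho x) / sqrt eps * psi1 k (yv x))).
- apply (continuous_mult (fun x => - rho1 x / (4 * rho x)) (fun x => psi k (yv x))).
  + apply (continuous_mult (fun x => - rho1 x) (fun x => / (4 * rho x))); [apply (continuous_opp rho1); auto|].
    apply is_derive_continuous with (- (4 * rho1 x) / (4 * rho x) ^ 2).
    apply (is_derive_inv (fun x => 4 * rho x) x); [apply (is_derive_scal rho x 4); auto|lra].
  + eapply is_derive_continuous. apply (is_derive_comp (psi k) yv x); [apply psi_derive|apply yv_derive; auto].
- apply (continuous_mult (fun x => sqrt (rho x) / sqrt eps) (fun x => psi1 k (yv x))).
  + eapply is_derive_continuous. apply (is_derive_scal_l (fun x => sqrt (rho x)) x (rho1 x / (2 * sqrt (rho x))) (/ sqrt eps)). apply sqrt_rho_derive; auto.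
  + eapply is_derive_continuous. apply (is_derive_comp (psi1 k) yv x); [apply psi1_derive|apply yv_derive; auto].
Qed.

Lemma log_rho_bound x : 0 < x < X -> Rabs (- rho1 x / (4 * rho x)) <= C ^ 2 * x.
Proof.
intros Hx. destruct (H1 x Hx) as [_ [_ [_ [_ [[B _] B1]]]]]. assert (P := rho_pos x Hx).
replace (- rho1 x / (4 * rho x)) with (- rho1 x * (/ rho x / 4)) by (field; lra).
replace (C ^ 2 * x) with (C * x * C) by ring. apply abs_mult_le; [rewrite Rabs_Ropp; auto|].
assert (I : / rho x <= C) by (rewrite <- (Rinv_inv C); apply Rinv_le_contravar; [apply Rinv_0_lt_compat|]; lra).
assert (0 < / rho x) by (apply Rinv_0_lt_compat; auto). apply abs_pos_le; lra.
Qed.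

Lemma sch_bound x : 0 < x < X -> x <> xs -> Rabs (sch x) <= 5 / 16 * (C ^ 2 * X) ^ 2 + C ^ 2.
Proof.
intros Hx N. destruct (H1 x Hx) as [_ [_ [_ [_ [[B _] B1]]]]]. destruct (H2 x Hx N) as [_ B2]. assert (P := rho_pos x Hx).
assert (I : / rho x <= C) by (rewrite <- (Rinv_inv C); apply Rinv_le_contravar; [apply Rinv_0_lt_compat|]; lra).
assert (I0 : 0 < / rho x) by (apply Rinv_0_lt_compat; auto).
unfold sch. apply abs_minus_le.
- apply abs_mult_le; [apply abs_pos_le; lra|].
  assert (Z : Rabs (rho1 x / rho x) <= C ^ 2 * X).
  { apply Rle_trans with (C * x * C); [apply abs_mult_le; auto; apply abs_pos_le; lra|]. nra. }
  simpl. rewrite !Rmult_1_r. apply abs_mult_le; simpl in Z; rewrite Rmult_1_r in Z; auto.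
- replace (rho2 x / (4 * rho x)) with (rho2 x * (/ rho x / 4)) by (field; lra).
  replace (C ^ 2) with (C * C) by ring. apply abs_mult_le; auto. apply abs_pos_le; lra.
Qed.

Lemma amp_bound x : 0 < x < X -> amp x <= exp (ln C / 4).
Proof.
intros Hx. destruct (H1 x Hx) as [_ [_ [_ [_ [[B _] _]]]]]. assert (P := rho_pos x Hx). unfold amp.
assert (L : - ln (rho x) <= ln C).
{ rewrite <- ln_Rinv by auto. destruct (Rle_lt_or_eq_dec (/ rho x) C) as [Q|Q].
  - rewrite <- (Rinv_inv C). apply Rinv_le_contravar; [apply Rinv_0_lt_compat|]; lra.
  - left; apply ln_increasing; auto. apply Rinv_0_lt_compat; auto.
  - rewrite Q; lra. }
destruct L as [L|L]; [left; apply exp_increasing; lra|right; f_equal; lra].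
Qed.

(** The data on [xi] hold for [x > 0] only, hence the extension [xh] by [0], continuous there
    because [xi x <= C * x]. The Wronskian is dominated by [B], which is continuous at [0] and
    vanishes there when the parities agree. *)
Lemma wronskian_at_0 (w w1 : R -> R) : continuous w 0 -> continuous w1 0 ->
  psi k 0 * w1 0 = 0 -> psi1 k 0 * w 0 = 0 ->
  forall e, 0 < e -> exists d, 0 < d /\ forall x, 0 < x < d -> Rabs (mv1 x * w x - mv x * w1 x) < e.
Proof.
intros Cw Cw1 Z1 Z2 e He. destruct sqrt_eps as [E1 E2].
set (xh := fun x => if Rlt_dec 0 x then (if Rlt_dec x X then xi x / sqrt eps else 0) else 0).
assert (C0 : continuous xh 0).
{ apply continuous_R; intros e' He'. exists (e' * sqrt eps / C); split.
  - apply Rdiv_lt_0_compat; [apply Rmult_lt_0_compat|]; lra.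
  - intros y Hy. rewrite Rminus_0_r in Hy. unfold xh. destruct (Rlt_dec 0 0); [lra|]. rewrite Rminus_0_r.
    destruct (Rlt_dec 0 y) as [Y|Y]; [|rewrite Rabs_R0; auto]. destruct (Rlt_dec y X) as [Y'|Y']; [|rewrite Rabs_R0; auto].
    destruct (H1 y (conj Y Y')) as [[B1 B2] _]. rewrite Rabs_pos_eq in Hy by lra.
    rewrite Rabs_pos_eq by (left; apply Rdiv_lt_0_compat; auto). apply Rlt_div_l; auto.
    apply (Rlt_div_r y (e' * sqrt eps) C) in Hy; [|lra]. nra. }
assert (X0h : xh 0 = 0) by (unfold xh; destruct (Rlt_dec 0 0); lra).
set (cs := sqrt C / sqrt eps). set (ca := exp (ln C / 4)).
set (B := fun x => ca * (C ^ 2 * Rabs x * Rabs (psi k (xh x) * w x) + cs * Rabs (psi1 k (xh x) * w x) + Rabs (psi k (xh x) * w1 x))).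
assert (Ck : continuous (fun x => psi k (xh x)) 0).
{ apply (continuous_comp xh (psi k)); auto. eapply is_derive_continuous, psi_derive. }
assert (Ck1 : continuous (fun x => psi1 k (xh x)) 0).
{ apply (continuous_comp xh (psi1 k)); auto. eapply is_derive_continuous, psi1_derive. }
assert (Cab : forall f : R -> R, continuous f 0 -> continuous (fun x => Rabs (f x)) 0).
{ intros f Cf. apply (continuous_comp f Rabs); auto. apply continuous_pt, Rcontinuity_abs. }
assert (CB : continuous B 0).
{ unfold B. apply (continuous_scal_r ca (fun x => C ^ 2 * Rabs x * Rabs (psi k (xh x) * w x) + cs * Rabs (psi1 k (xh x) * w x) + Rabs (psi k (xh x) * w1 x))).
  apply (continuous_plus (fun x => C ^ 2 * Rabs x * Rabs (psi k (xh x) * w x) + cs * Rabs (psi1 k (xh x) * w x)) (fun x => Rabs (psi k (xh x) * w1 x))).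
  - apply (continuous_plus (fun x => C ^ 2 * Rabs x * Rabs (psi k (xh x) * w x)) (fun x => cs * Rabs (psi1 k (xh x) * w x))).
    + apply (continuous_mult (fun x => C ^ 2 * Rabs x) (fun x => Rabs (psi k (xh x) * w x))).
      * apply (continuous_scal_r (C ^ 2) (fun x => Rabs x)). apply (Cab (fun x => x)), continuous_id.
      * apply (Cab (fun x => psi k (xh x) * w x)). apply (continuous_mult (fun x => psi k (xh x)) w); auto.
    + apply (continuous_scal_r cs (fun x => Rabs (psi1 k (xh x) * w x))).
      apply (Cab (fun x => psi1 k (xh x) * w x)). apply (continuous_mult (fun x => psi1 k (xh x)) w); auto.
  - apply (Cab (fun x => psi k (xh x) * w1 x)). apply (continuous_mult (fun x => psi k (xh x)) w1); auto. }
assert (B0 : B 0 = 0) by (unfold B; rewrite X0h, Z1, Z2, Rabs_R0; ring).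
destruct (proj1 (continuous_R _ _) CB e He) as [d [d0 Hd]].
exists (Rmin d X); split; [apply Rmin_glb_lt; lra|]. intros x Hx.
assert (M1 := Rmin_l d X). assert (M2 := Rmin_r d X). assert (Hx' : 0 < x < X) by lra.
assert (Q : Rabs (B x - B 0) < e) by (apply Hd; rewrite Rminus_0_r, Rabs_pos_eq; lra).
rewrite B0, Rminus_0_r in Q. eapply Rle_lt_trans; [|eapply Rle_lt_trans; [apply Rle_abs|apply Q]].
assert (Ex : xh x = yv x) by (unfold xh, yv; destruct (Rlt_dec 0 x); [destruct (Rlt_dec x X)|]; lra).
unfold B. rewrite Ex. unfold mv1, mv.
replace (amp x * (- rho1 x / (4 * rho x) * psi k (yv x) + sqrt (rho x) / sqrt eps * psi1 k (yv x)) * w x - amp x * psi k (yv x) * w1 x)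
  with (amp x * (- rho1 x / (4 * rho x) * (psi k (yv x) * w x) + sqrt (rho x) / sqrt eps * (psi1 k (yv x) * w x) - psi k (yv x) * w1 x)) by ring.
assert (Am := amp_bound x Hx'). assert (Ap := amp_pos x).
apply abs_mult_le; [apply abs_pos_le; unfold ca; lra|].
apply abs_minus_le; [apply abs_plus_le|apply Rle_refl].
- apply abs_mult_le; [|apply Rle_refl]. rewrite (Rabs_pos_eq x) by lra. apply log_rho_bound; auto.
- apply abs_mult_le; [|apply Rle_refl]. destruct (H1 x Hx') as [_ [_ [_ [_ [[_ B2] _]]]]].
  apply abs_pos_le. split; [apply Rmult_le_pos; [apply sqrt_pos|left; apply Rinv_0_lt_compat; auto]|].
  apply Rmult_le_compat_r; [left; apply Rinv_0_lt_compat; auto|]. apply sqrt_le_1_alt; auto.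
Qed.

(** A margin [1 / (2 * C)] in [xi^2] past the turning point gives the Hermite function a decay rate
    [bt], which becomes of order [1 / eps] in the variable [x]; the amplitude contributes only the
    bounded term [C^2 * X]. *)
Lemma mv_tail x : 0 < x < X -> eps * (2 * INR k) + / (2 * C) <= xi x ^ 2 ->
  0 < mv x /\ - (C ^ 2 * X + C ^ 2 * X / eps) <= mv1 x / mv x <= C ^ 2 * X - / (2 * C) / eps.
Proof.
intros Hx Hxi. destruct (H1 x Hx) as [[X1 X2] [_ [_ [_ [[B1 B2] _]]]]]. assert (P := rho_pos x Hx).
destruct sqrt_eps as [E1 E2]. assert (Y0 : 0 < yv x) by (apply Rdiv_lt_0_compat; lra).
assert (Y2 : yv x ^ 2 = xi x ^ 2 / eps) by (rewrite <- E2; unfold yv; field; lra). assert (I2C : 0 < / (2 * C)) by (apply Rinv_0_lt_compat; lra).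
set (bt := sqrt (/ (2 * C) / eps)).
assert (bt2 : bt ^ 2 = / (2 * C) / eps) by (apply pow2_sqrt; left; apply Rdiv_lt_0_compat; auto).
destruct (psi_tail (yv x) bt k) as [T1 [T2 T3]]; auto; [apply sqrt_pos| |].
{ rewrite Y2, bt2. apply Rle_div_r; auto. replace ((2 * INR k + / (2 * C) / eps) * eps) with (eps * (2 * INR k) + / (2 * C)) by (field; lra). auto. }
assert (Am := amp_pos x). split; [apply Rmult_lt_0_compat; auto|].
assert (LB := log_rho_bound x Hx). apply Rabs_le_between in LB.
assert (C2x : C ^ 2 * x <= C ^ 2 * X) by (apply Rmult_le_compat_l; [apply pow2_ge_0|lra]).
set (sr := sqrt (rho x)). assert (sr0 : 0 < sr) by (apply sqrt_lt_R0; auto).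
assert (sr2 : sr * sr = rho x) by (apply sqrt_sqrt; lra).
assert (R1 : mv1 x / mv x = - rho1 x / (4 * rho x) + sr / sqrt eps * (psi1 k (yv x) / psi k (yv x))).
{ unfold mv1, mv. fold sr. field. repeat split; lra. }
rewrite R1. set (l := psi1 k (yv x) / psi k (yv x)).
assert (l1 : - yv x <= l) by (apply Rle_div_r; auto). assert (l2 : l <= - bt) by (apply Rle_div_l; auto).
assert (q0 : 0 < sr / sqrt eps) by (apply Rdiv_lt_0_compat; auto).
split.
- assert (Z : sr / sqrt eps * yv x <= C ^ 2 * X / eps).
  { assert (Ez : sr / sqrt eps * yv x = sr * xi x / (sqrt eps * sqrt eps)) by (unfold yv; field; lra). rewrite Ez, E2.
    apply Rmult_le_compat_r; [left; apply Rinv_0_lt_compat; auto|].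
    assert (sr <= C) by nra. apply Rle_trans with (C * (C * x)); [apply Rmult_le_compat; lra|]. nra. }
  assert (sr / sqrt eps * - yv x <= sr / sqrt eps * l) by (apply Rmult_le_compat_l; lra). lra.
- assert (Z : / (2 * C) / eps <= sr / sqrt eps * bt).
  { apply Rsqr_incr_0_var; [|apply Rmult_le_pos; [lra|apply sqrt_pos]]. unfold Rsqr.
    replace (sr / sqrt eps * bt * (sr / sqrt eps * bt)) with ((sr * sr) * bt ^ 2 / (sqrt eps * sqrt eps)) by (field; lra).
    rewrite sr2, bt2, E2. replace (rho x * (/ (2 * C) / eps) / eps) with (rho x * (/ (2 * C) / eps / eps)) by (field; split; lra).
    replace (/ (2 * C) / eps * (/ (2 * C) / eps)) with (/ (2 * C) * (/ (2 * C) / eps / eps)) by (field; split; lra).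
    apply Rmult_le_compat_r.
    - left. apply Rdiv_lt_0_compat; auto. apply Rdiv_lt_0_compat; auto.
    - apply Rle_trans with (/ C); auto. apply Rinv_le_contravar; lra. }
  assert (sr / sqrt eps * l <= sr / sqrt eps * - bt) by (apply Rmult_le_compat_l; lra). lra.
Qed.

End ModelSolution.

(** * Quantization *)

Lemma sturm_pair_intro (f f1 Ff g g1 Fg : R -> R) (s Xm : R) :
  (forall x, 0 < x < Xm -> is_derive f x (f1 x) /\ is_derive g x (g1 x) /\ continuous f1 x /\ continuous g1 x) ->
  (forall x, 0 < x < Xm -> x <> s -> is_derive f1 x (Ff x * f x) /\ is_derive g1 x (Fg x * g x) /\ 0 < Ff x - Fg x) ->
  (forall e, 0 < e -> exists d, 0 < d /\ forall x, 0 < x < d -> Rabs (f1 x * g x - f x * g1 x) < e) ->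
  sturm_pair f f1 g g1 (fun x => Ff x - Fg x) s Xm.
Proof.
intros H1 H2 H3; split; [auto|split; auto]. intros x Hx N. destruct (H1 x Hx) as [D1 [D2 _]].
destruct (H2 x Hx N) as [D3 [D4 P]]. split; auto. evar_last.
- apply (is_derive_minus (fun x => f1 x * g x) (fun x => f x * g1 x)).
  + apply (is_derive_mult f1 g x); [exact D3|exact D2|intros; apply Rmult_comm].
  + apply (is_derive_mult f g1 x); [exact D1|exact D4|intros; apply Rmult_comm].
- unfold minus, plus, opp, mult; simpl. ring.
Qed.

Section Quantization.

Variables (A A1 A2 A3 A4 A5 : R -> R).
Hypothesis DA : forall x, is_derive A x (A1 x).
Hypothesis DA1 : forall x, is_derive A1 x (A2 x).
Hypothesis DA2 : forall x, is_derive A2 x (A3 x).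
Hypothesis DA3 : forall x, is_derive A3 x (A4 x).
Hypothesis DA4 : forall x, is_derive A4 x (A5 x).
Hypothesis Apos : forall x, 0 < A x.
Hypothesis Aeven : forall x, A (- x) = A x.
Hypothesis Adecr : forall x, 0 < x -> A1 x < 0.
Hypothesis A20 : A2 0 < 0.
Hypothesis Alim : forall a, 0 < a -> exists x, 0 < x /\ A x < a.

Lemma A_decr x y : 0 <= x < y -> A y < A x.
Proof. intros H. apply (A_below A A1 (A x) DA Adecr x); auto; lra. Qed.

Lemma A_derivs_bounded X : 0 < X -> exists B, 0 <= B /\ forall x, 0 < x < X -> Rabs (A1 x) <= B /\ Rabs (A2 x) <= B.
Proof.
intros HX. set (h := fun x => Rabs (A1 x) + Rabs (A2 x)).
assert (C : forall x, 0 <= x <= X -> continuity_pt h x).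
{ intros x _. apply continuous_pt. apply (continuous_plus (fun x => Rabs (A1 x)) (fun x => Rabs (A2 x))).
  - apply (continuous_comp A1 Rabs); [eapply is_derive_continuous, DA1|apply continuous_pt, Rcontinuity_abs].
  - apply (continuous_comp A2 Rabs); [eapply is_derive_continuous, DA2|apply continuous_pt, Rcontinuity_abs]. }
destruct (continuity_ab_maj h 0 X) as [xM [HM _]]; [lra|auto|].
exists (h xM); split; [unfold h; apply Rplus_le_le_0_compat; apply Rabs_pos|].
intros x Hx. specialize (HM x ltac:(lra)). unfold h in *. assert (P1 := Rabs_pos (A1 x)). assert (P2 := Rabs_pos (A2 x)).
split; lra.
Qed.

Definition half_action xs := RInt (fun x => sqrt (Rabs (A x ^ 2 - A xs ^ 2))) 0 xs.

Lemma quantization a : 0 < a -> exists M eps0, 0 <= M /\ 0 < eps0 /\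
  forall (eps mu xs : R) (u1 u2 : R -> R),
  0 < eps < eps0 -> a <= mu -> 0 <= xs -> A xs = mu ->
  (forall x, is_derive u1 x ((mu * u1 x + A x * u2 x) / eps)) ->
  (forall x, is_derive u2 x (- (A x * u1 x + mu * u2 x) / eps)) ->
  (exists x, u1 x <> 0 \/ u2 x <> 0) ->
  (exists Bd, forall r, 0 <= r -> RInt (fun x => u1 x ^ 2 + u2 x ^ 2) (- r) r <= Bd) ->
  exists k : nat, Rabs (4 / PI * half_action xs - eps * (2 * INR k + 1)) <= M * eps ^ 2.
Proof.
intros Ha. destruct (Alim a Ha) as [X0 [X00 AX0]].
(* For [mu >= a] the turning point satisfies [xs < X0], so [[X0 + 1, X0 + 2]] lies in the forbidden
   region, at distance more than [1] from [xs] and inside [(0, X)]. *)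
set (X := X0 + 3). assert (HX : 0 < X) by (unfold X; lra).
destruct (langer_profile A A1 A2 A3 A4 A5 DA DA1 DA2 DA3 DA4 Apos Aeven Adecr A20 X HX) as [C [C1 Langer]].
destruct (A_derivs_bounded X HX) as [B [B0 HB]].
set (Ba := B / a). assert (Ba0 : 0 <= Ba) by (apply Rmult_le_pos; auto; left; apply Rinv_0_lt_compat; auto).
set (Cg := 3 / 4 * (Ba * Ba) + Ba). set (Ch := 5 / 16 * (C ^ 2 * X) ^ 2 + C ^ 2).
assert (Cg0 : 0 <= Cg) by (unfold Cg; nra).
assert (Ch0 : 0 <= Ch) by (unfold Ch; assert (0 <= (C ^ 2 * X) ^ 2) by apply pow2_ge_0; assert (0 <= C ^ 2) by apply pow2_ge_0; lra).
(* [Cg] and [Ch] bound the two error potentials and [rho >= 1 / C], so a level farther than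
   [M * eps^2] from [E] makes the full potentials differ by at least [1]. *)
set (M := C * (Cg + Ch + 1)). assert (M0 : 0 <= M) by (unfold M; nra).
set (Q := C ^ 2 * X + Ba). assert (C2X : 0 < C ^ 2 * X) by (apply Rmult_lt_0_compat; [nra|auto]).
assert (Q0 : 0 < Q) by (unfold Q; lra).
set (D := 2 * (C ^ 2 * X) + 2 * A 0 + Ba). assert (A00 := Apos 0). assert (D0 : 0 < D) by (unfold D; lra).
(* The four requirements serve [1 <= 1 / eps], the margin [4 * eps <= 1 / (2 * C)] past the turning
   point, [Q <= lam], and [D / eps < lam^2 / 6], where [lam = 1 / (4 * C * eps)]. *)
set (e1 := Rmin 1 (/ (8 * C))). set (e2 := Rmin (/ (4 * C * Q)) (/ (96 * C ^ 2 * D))).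
assert (CQ : 0 < 4 * C * Q) by (apply Rmult_lt_0_compat; lra).
assert (CD : 0 < 96 * C ^ 2 * D) by (apply Rmult_lt_0_compat; [nra|lra]).
exists M, (Rmin e1 e2). split; auto. split.
{ unfold e1, e2. repeat apply Rmin_glb_lt; try lra; apply Rinv_0_lt_compat; lra. }
intros eps mu xs u1 u2 Heps Hmu Hxs Axs Du1 Du2 NT L2.
assert (eps0 : 0 < eps) by lra.
assert (S1 : eps <= 1 /\ eps * (8 * C) <= 1 /\ eps * (4 * C * Q) <= 1 /\ eps * (96 * C ^ 2 * D) < 1).
{ assert (R1 := Rmin_l e1 e2). assert (R2 := Rmin_r e1 e2).
  assert (R3 := Rmin_l 1 (/ (8 * C))). assert (R4 := Rmin_r 1 (/ (8 * C))).
  assert (R5 := Rmin_l (/ (4 * C * Q)) (/ (96 * C ^ 2 * D))). assert (R6 := Rmin_r (/ (4 * C * Q)) (/ (96 * C ^ 2 * D))).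
  fold e1 in R3, R4. fold e2 in R5, R6.
  assert (IV : forall z, 0 < z -> eps < / z -> eps * z < 1).
  { intros z Hz Hl. apply Rmult_lt_compat_r with (r := z) in Hl; auto. rewrite Rinv_l in Hl by lra. auto. }
  split; [lra|]. split; [left; apply IV; lra|]. split; [left; apply IV; lra|apply IV; lra]. }
destruct S1 as [Sa [Sb [Sc Sd]]].
assert (mu0 : 0 < mu) by lra.
assert (xs0 : 0 < xs).
{ destruct Hxs as [|E]; auto. exfalso. apply (top_no_solution A A1 eps mu u1 u2) with (xs := xs); auto; lra. }
assert (xsX0 : xs < X0).
{ apply Rnot_le_lt; intros [N|N]; [assert (Z := A_decr X0 xs ltac:(lra)); lra|rewrite N in AX0; lra]. }
assert (muA0 : mu <= A 0) by (rewrite <- Axs; left; apply A_decr; lra).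
destruct (Langer xs ltac:(unfold X; lra)) as [E [xi [rho [rho1 [rho2 [HE [E0 [L3 [L4 L5]]]]]]]]]. clear Langer.
destruct (schrodinger_reduction A A1 A2 eps mu u1 u2 DA DA1 Apos Aeven Adecr eps0 mu0 Du1 Du2 NT L2 xs Hxs Axs)
  as [w [w1 [p [Hp [Hw [Wp1 [Wp0 Wt]]]]]]].
assert (Dw : forall x, is_derive w x (w1 x)) by (intros x; apply (proj1 (Hw x))).
assert (Cw : forall x, continuous w x) by (intros x; apply (is_derive_continuous w x (w1 x)), Dw).
assert (Cw1 : forall x, continuous w1 x).
{ intros x. apply (is_derive_continuous w1 x _ (proj1 (proj2 (Hw x)))). }
assert (PI0 := PI_RGT_0).
assert (EE : 4 / PI * half_action xs = E) by (unfold half_action; rewrite HE; field; lra).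
rewrite EE. apply NNPP; intros NE.
set (X1 := X0 + 1).
set (Fw := fun x => schwarz A A1 A2 mu x - (A x ^ 2 - mu ^ 2) / eps ^ 2).
assert (Hin : forall x, X1 <= x <= X1 + 1 -> 0 < x < X /\ xs <= x /\ x <> xs) by (unfold X1, X; intros x Hx; lra).
assert (L3' : forall x, 0 < x < X -> 0 < xi x <= C * x /\ is_derive xi x (sqrt (rho x)) /\
       is_derive rho x (rho1 x) /\ continuous rho1 x /\ / C <= rho x <= C /\ Rabs (rho1 x) <= C * x).
{ intros x Hx. destruct (L3 x Hx) as [Z1 [Z2 [Z3 [Z4 [Z5 [Z6 _]]]]]]. exact (conj Z1 (conj Z2 (conj Z3 (conj Z4 (conj Z5 Z6))))). }
assert (IC : 0 < / C) by (apply Rinv_0_lt_compat; lra).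
assert (IC2 : / (2 * C) = / C / 2) by (field; lra).
assert (Xi1 : forall x, X1 <= x <= X1 + 1 -> E + / C <= xi x ^ 2).
{ intros x Hx. assert (Z := L5 x ltac:(unfold X, X1 in *; lra)).
  assert (1 <= x ^ 2 - xs ^ 2) by (unfold X1 in Hx; nra).
  assert (/ C <= (x ^ 2 - xs ^ 2) / C) by (unfold Rdiv; rewrite <- (Rmult_1_l (/ C)) at 1; apply Rmult_le_compat_r; lra). lra. }
assert (Gb : forall x, 0 < x < X -> Rabs (schwarz A A1 A2 mu x) <= Cg).
{ intros x Hx. destruct (HB x Hx) as [U1 U2]. assert (Ax := Apos x). unfold schwarz, Cg.
  assert (I : 0 < / (A x + mu) <= / a) by (split; [apply Rinv_0_lt_compat; lra|apply Rinv_le_contravar; lra]).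
  apply abs_minus_le.
  - apply abs_mult_le; [apply abs_pos_le; lra|]. simpl. rewrite Rmult_1_r.
    assert (Q1 : Rabs (A1 x / (A x + mu)) <= Ba) by (apply abs_mult_le; auto; apply abs_pos_le; lra).
    apply abs_mult_le; auto.
  - replace (A2 x / (2 * (A x + mu))) with (A2 x * (/ (A x + mu) / 2)) by (field; lra). apply abs_mult_le; auto. apply abs_pos_le; lra. }
assert (Wt' : forall x, X1 <= x <= X1 + 1 -> w x <> 0 /\ - ((2 * A 0) / eps + Ba) <= w1 x / w x <= Ba).
{ intros x Hx. destruct (Hin x Hx) as [Hx1 [Hx2 Hx3]]. destruct (Wt x Hx2) as [N [T1 T2]]. split; auto.
  destruct (HB x Hx1) as [U1 _]. assert (W2 : 0 < w x ^ 2) by (assert (Z := pow_nonzero (w x) 2 N); assert (0 <= w x ^ 2) by apply pow2_ge_0; lra).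
  assert (R1 : w1 x / w x = w1 x * w x / w x ^ 2) by (field; auto). rewrite R1.
  assert (Bm : Rabs (A1 x) / mu <= Ba) by (apply Rmult_le_compat; auto; [apply Rabs_pos|left; apply Rinv_0_lt_compat; auto|apply Rinv_le_contravar; lra]).
  assert (Ax : A x < A 0) by (apply A_decr; lra).
  assert (Am : (A x + mu) / eps <= 2 * A 0 / eps) by (apply Rmult_le_compat_r; [left; apply Rinv_0_lt_compat; auto|lra]).
  split; [apply Rle_div_r|apply Rle_div_l]; auto; nra. }
(* Only model solutions of the parity of [w] are used, so that the Wronskian with [w] vanishes at
   [0]; their levels [en n] are [4 * eps] apart. *)
set (V := fun n => mv eps xi rho (2 * n + p)). set (V1 := fun n => mv1 eps xi rho rho1 (2 * n + p)).
set (FV := fun n => mF eps xi rho rho1 rho2 (2 * n + p)).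
set (en := fun n => eps * (2 * INR (2 * n + p) + 1)).
assert (C0 : 0 < C) by lra.
assert (Hxs' : 0 < xs < X) by (unfold X; lra).
assert (DV : forall n x, 0 < x < X -> is_derive (V n) x (V1 n x)) by (intros n x Hx; apply (mv_derive X C eps xi rho rho1); auto).
assert (DV1 : forall n x, 0 < x < X -> x <> xs -> is_derive (V1 n) x (FV n x * V n x)).
{ intros n x Hx N; apply (mv1_derive X C eps xs xi rho rho1 rho2); auto. }
assert (CV1 : forall n x, 0 < x < X -> continuous (V1 n) x) by (intros n x Hx; apply (mv1_continuous X C eps xi rho rho1); auto).
assert (Gap : forall n x, 0 < x < X -> x <> xs -> Rabs (FV n x - Fw x - rho x * (E - en n) / eps ^ 2) <= Cg + Ch).
{ intros n x Hx N. destruct (L3 x Hx) as [_ [_ [_ [_ [_ [_ Z]]]]]]. rewrite Axs in Z.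
  unfold FV, mF, Fw. fold (en n). rewrite <- Z.
  replace (sch rho rho1 rho2 x + rho x * (xi x ^ 2 - en n) / eps ^ 2 - (schwarz A A1 A2 mu x - rho x * (E - xi x ^ 2) / eps ^ 2) - rho x * (E - en n) / eps ^ 2)
    with (sch rho rho1 rho2 x - schwarz A A1 A2 mu x) by (field; lra).
  rewrite (Rplus_comm Cg). apply abs_minus_le; [|apply Gb; auto].
  apply (sch_bound X C xs xi rho rho1 rho2); auto. }
assert (e2pos : 0 < eps ^ 2) by (apply pow_lt; auto).
assert (Gap1 : forall n, en n < E - M * eps ^ 2 -> forall x, 0 < x < X -> x <> xs -> 1 <= FV n x - Fw x).
{ intros n Hn x Hx N. assert (G := Gap n x Hx N). apply Rabs_le_between in G. destruct (L3' x Hx) as [_ [_ [_ [_ [[R1 _] _]]]]].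
  assert (Cg + Ch + 1 <= rho x * (E - en n) / eps ^ 2); [|lra].
  apply Rle_div_r; auto. apply Rle_trans with (/ C * (M * eps ^ 2)); [right; unfold M; field; lra|].
  apply Rmult_le_compat; try lra. apply Rmult_le_pos; lra. }
assert (Gap2 : forall n, E + M * eps ^ 2 < en n -> forall x, 0 < x < X -> x <> xs -> 1 <= Fw x - FV n x).
{ intros n Hn x Hx N. assert (G := Gap n x Hx N). apply Rabs_le_between in G. destruct (L3' x Hx) as [_ [_ [_ [_ [[R1 _] _]]]]].
  assert (Cg + Ch + 1 <= rho x * (en n - E) / eps ^ 2).
  { apply Rle_div_r; auto. apply Rle_trans with (/ C * (M * eps ^ 2)); [right; unfold M; field; lra|].
    apply Rmult_le_compat; try lra. apply Rmult_le_pos; lra. }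
  replace (rho x * (E - en n) / eps ^ 2) with (- (rho x * (en n - E) / eps ^ 2)) in G by (field; lra). lra. }
assert (W0 : forall n e, 0 < e -> exists d, 0 < d /\ forall x, 0 < x < d -> Rabs (V1 n x * w x - V n x * w1 x) < e).
{ intros n. apply (wronskian_at_0 X C eps xs xi rho rho1); auto.
  - destruct (psi_at0 n p Hp) as [Z1 Z2]. destruct p as [|[|q]]; [rewrite Wp0; auto; ring|rewrite Z1; auto; ring|lia].
  - destruct (psi_at0 n p Hp) as [Z1 Z2]. destruct p as [|[|q]]; [rewrite Z2; auto; ring|rewrite Wp1; auto; ring|lia]. }
(* The slack [5 * eps] covers the first level above [E]: levels of equal parity are [4 * eps] apart,
   and the lowest is at most [3 * eps]. *)
assert (VT : forall n, en n <= E + 5 * eps -> forall x, X1 <= x <= X1 + 1 ->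
  V n x <> 0 /\ - (C ^ 2 * X + C ^ 2 * X / eps) <= V1 n x / V n x <= C ^ 2 * X - / (2 * C) / eps).
{ intros n Hn x Hx. destruct (Hin x Hx) as [Hx1 _]. assert (Z := Xi1 x Hx).
  destruct (mv_tail X C eps xi rho rho1 (2 * n + p) C1 eps0 L3' x Hx1) as [T1 T2].
  - unfold en in Hn. rewrite IC2. assert (4 * eps <= / C / 2); [|lra].
    apply Rmult_le_reg_r with (2 * C); [lra|]. replace (/ C / 2 * (2 * C)) with 1 by (field; lra). lra.
  - split; auto. intros F; unfold V in F; lra. }
set (lam := / (4 * C) / eps).
assert (lam0 : 0 <= lam) by (left; apply Rdiv_lt_0_compat; auto; apply Rinv_0_lt_compat; lra).
assert (Lq : Q - / (2 * C) / eps <= - lam).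
{ assert (Q <= / (4 * C) / eps).
  { apply Rle_div_r; auto. apply Rmult_le_reg_r with (4 * C); [lra|]. rewrite Rinv_l by lra. lra. }
  replace (/ (2 * C) / eps) with (2 * (/ (4 * C) / eps)) by (field; lra). unfold lam; lra. }
assert (Ld : D / eps < lam ^ 2 / 6).
{ unfold lam. apply Rmult_lt_reg_r with (96 * C ^ 2 * eps ^ 2); [nra|].
  replace ((/ (4 * C) / eps) ^ 2 / 6 * (96 * C ^ 2 * eps ^ 2)) with 1 by (field; lra).
  replace (D / eps * (96 * C ^ 2 * eps ^ 2)) with (eps * (96 * C ^ 2 * D)) by (field; lra). auto. }
assert (Ie : 1 <= / eps) by (rewrite <- Rinv_1; apply Rinv_le_contravar; lra).
assert (Hend : X1 <= X1 + 1 <= X1 + 1) by lra.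
(* For a level below [E], [w] oscillates faster and gains a zero. The count runs up to [x3], but [w]
   has no zero beyond [xs], so the zeros lie in [(0, X1)]. *)
assert (St1 : forall n, en n <= E + 5 * eps -> en n < E - M * eps ^ 2 -> has_zeros (V n) 0 X1 n -> has_zeros w 0 X1 (S n)).
{ intros n Hn5 Hn Hz.
  destruct (forbidden_comparison (V n) (V1 n) w w1 (FV n) Fw X1 lam (D / eps)) as [x3 [Hx3 T]]; auto.
  - intros x Hx. destruct (Hin x Hx) as [Hx1 [Hx2 Hx4]]. destruct (Hw x) as [W1 [W2 _]].
    destruct (VT n Hn5 x Hx) as [N1 [T1 T2]]. destruct (Wt' x Hx) as [N2 [T3 T4]].
    refine (conj _ (conj _ (conj W1 (conj W2 (conj _ (conj N1 (conj N2 _))))))); auto.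
    unfold Q in Lq. lra.
  - destruct (VT n Hn5 _ Hend) as [N1 [T1 T2]]. destruct (Wt' _ Hend) as [N2 [T3 T4]].
    assert (/ (2 * C) / eps >= 0) by (apply Rle_ge; left; apply Rdiv_lt_0_compat; auto; apply Rinv_0_lt_compat; lra).
    apply Rle_trans with (C ^ 2 * X + (2 * A 0 / eps + Ba)); [lra|]. unfold D, Rdiv. nra.
  - apply has_zeros_restrict with x3.
    { intros z Hz0 Fz. apply Rnot_le_lt; intros Z. destruct (Wt z) as [N _]; [unfold X1 in *; lra|auto]. }
    apply (sturm_count (V n) (V1 n) w w1 (fun x => FV n x - Fw x) xs X x3); auto.
    + apply sturm_pair_intro.
      * intros x Hx; refine (conj _ (conj _ (conj _ _))); auto.
      * intros x Hx N; refine (conj _ (conj _ _)); auto; [apply Hw|]. assert (Z := Gap1 n Hn x Hx N). lra.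
      * apply (W0 n).
    + apply Hin; auto.
    + intros x Hx; apply (mv_simple X C eps xi rho rho1); auto.
    + apply has_zeros_mono with X1; auto; lra. }
assert (St2 : forall n, en n <= E + 5 * eps -> E + M * eps ^ 2 < en n -> has_zeros w 0 X1 n ->
  exists x3, X1 <= x3 <= X1 + 1 /\ has_zeros (V n) 0 x3 (S n)).
{ intros n Hn5 Hn Hz.
  destruct (forbidden_comparison w w1 (V n) (V1 n) Fw (FV n) X1 lam (D / eps)) as [x3 [Hx3 T]]; auto.
  - intros x Hx. destruct (Hin x Hx) as [Hx1 [Hx2 Hx4]]. destruct (Hw x) as [W1 [W2 _]].
    destruct (VT n Hn5 x Hx) as [N1 [T1 T2]]. destruct (Wt' x Hx) as [N2 [T3 T4]].
    refine (conj W1 (conj W2 (conj _ (conj _ (conj _ (conj N2 (conj N1 _))))))); auto.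
    unfold Q in Lq. lra.
  - destruct (VT n Hn5 _ Hend) as [N1 [T1 T2]]. destruct (Wt' _ Hend) as [N2 [T3 T4]].
    apply Rle_trans with (Ba + (C ^ 2 * X + C ^ 2 * X / eps)); [lra|]. unfold D, Rdiv. nra.
  - exists x3; split; auto.
    apply (sturm_count w w1 (V n) (V1 n) (fun x => Fw x - FV n x) xs X x3); auto.
    + apply sturm_pair_intro.
      * intros x Hx; refine (conj _ (conj _ (conj _ _))); auto.
      * intros x Hx N; refine (conj _ (conj _ _)); auto; [apply Hw|]. assert (Z := Gap2 n Hn x Hx N). lra.
      * intros e He. destruct (W0 n e He) as [d [d0 Hd]]; exists d; split; auto. intros x Hx.
        replace (w1 x * V n x - w x * V1 n x) with (- (V1 n x * w x - V n x * w1 x)) by ring. rewrite Rabs_Ropp; auto.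
    + apply Hin; auto.
    + intros x Hx; apply Hw.
    + apply has_zeros_mono with X1; auto; lra. }
assert (se : 0 < sqrt eps) by (apply sqrt_lt_R0; auto). assert (se2 : sqrt eps * sqrt eps = eps) by (apply sqrt_sqrt; lra).
set (y := yv eps xi).
assert (Iy : forall b u v, b < X -> 0 < u < v -> v <= b -> y u < y v).
{ intros b u v Hb Huv Hv. apply (incr_strict y (fun x => sqrt (rho x) / sqrt eps)); [lra| | |].
  - intros x Hx. eapply is_derive_continuous, (yv_derive X C eps xi rho rho1); auto; lra.
  - intros x Hx. apply (yv_derive X C eps xi rho rho1); auto; lra.
  - intros x Hx. destruct (L3' x ltac:(lra)) as [_ [_ [_ [_ [[R1 _] _]]]]]. apply Rdiv_lt_0_compat; auto. apply sqrt_lt_R0; lra. }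
assert (Py : forall x, 0 < x < X -> 0 < y x) by (intros x Hx; apply Rdiv_lt_0_compat; auto; apply L3'; auto).
assert (VZ : forall n x, V n x = 0 <-> hermite (2 * n + p) (y x) = 0) by (intros n x; apply mv_zero).
assert (Lo : forall n, en n <= E -> has_zeros (V n) 0 X1 n).
{ intros n Hn. apply has_zeros_ext with (fun x => hermite (2 * n + p) (y x)); [intros z _; apply VZ|].
  assert (X1in : 0 < X1 < X) by (unfold X1, X; lra).
  apply (has_zeros_pull (hermite (2 * n + p)) y X1); [intros; apply (Iy X1); auto; lra|lra| |].
  - intros z Hz.
    (* By [xi x <= C * x], a point this small satisfies [y x0 < z]. The intermediate value theorem
       is thus applied away from [0], where nothing is known about [y]. *)
    set (x0 := Rmin (X1 / 2) (z * sqrt eps / (2 * C))).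
    assert (x0p : 0 < x0) by (apply Rmin_glb_lt; [lra|apply Rdiv_lt_0_compat; [apply Rmult_lt_0_compat|]; lra]).
    assert (x0a : x0 <= X1 / 2) by apply Rmin_l. assert (x0b : x0 <= z * sqrt eps / (2 * C)) by apply Rmin_r.
    assert (y0 : y x0 < z).
    { destruct (L3' x0 ltac:(lra)) as [[_ U] _]. unfold y, yv. apply Rlt_div_l; auto.
      assert (C * x0 <= C * (z * sqrt eps / (2 * C))) by (apply Rmult_le_compat_l; lra).
      replace (C * (z * sqrt eps / (2 * C))) with (z * sqrt eps / 2) in H by (field; lra).
      assert (0 < z * sqrt eps) by (apply Rmult_lt_0_compat; lra). lra. }
    destruct (Ranalysis5.IVT_interv (fun x => y x - z) x0 X1) as [x [Q1 Q2]]; try lra.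
    + intros u Hu. apply continuous_pt. apply (continuous_minus y (fun _ => z)); [|apply continuous_const].
      eapply is_derive_continuous, (yv_derive X C eps xi rho rho1); auto; lra.
    + exists x. split; [|lra]. split; [lra|]. destruct Q1 as [_ [Q1|Q1]]; auto. subst x. lra.
  - apply hermite_zeros_ge; auto. unfold y, yv.
    replace ((xi X1 / sqrt eps) ^ 2) with (xi X1 ^ 2 / (sqrt eps * sqrt eps)) by (field; lra). rewrite se2.
    apply (Rle_div_r _ _ eps); auto. assert (Z := Xi1 X1 ltac:(lra)). unfold en in Hn. assert (0 < / C) by (apply Rinv_0_lt_compat; auto). lra. }
assert (Up : forall n x3, X1 <= x3 <= X1 + 1 -> has_zeros (V n) 0 x3 (S n) -> False).
{ intros n x3 Hx3 Hz. destruct (Hin x3 Hx3) as [Hx _].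
  assert (Hz' : has_zeros (fun x => hermite (2 * n + p) (y x)) 0 x3 (S n)) by (apply has_zeros_ext with (V n); auto; intros z _; apply VZ).
  apply (has_zeros_push (hermite (2 * n + p)) y x3) in Hz'; [|intros; apply (Iy x3); auto; lra|intros; apply Py; lra].
  apply hermite_zeros_le_parity in Hz'; auto. lia. }
assert (enS : forall n, en (S n) = en n + 4 * eps).
{ intros n. unfold en. replace (2 * S n + p)%nat with (S (S (2 * n + p))) by lia. rewrite !S_INR. ring. }
assert (NEn : forall n, en n < E - M * eps ^ 2 \/ E + M * eps ^ 2 < en n).
{ intros n. destruct (Rlt_le_dec (en n) (E - M * eps ^ 2)); auto. destruct (Rlt_le_dec (E + M * eps ^ 2) (en n)); auto.
  exfalso. apply NE. exists (2 * n + p)%nat. fold (en n). apply Rabs_le; lra. }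
assert (Me : 0 <= M * eps ^ 2) by (apply Rmult_le_pos; lra).
(* Since no level is within [M * eps^2] of [E], a first level above [E] is contradictory: at index
   [0] one zero is already too many, and otherwise [E] lies in the gap just below. Levels being
   unbounded, this refutes [NE]. *)
assert (Main : forall n, E + M * eps ^ 2 < en n -> False).
{ induction n as [|n IH]; intros Hn.
  - assert (H5 : en 0%nat <= E + 5 * eps).
    { unfold en. replace (2 * 0 + p)%nat with p by lia. assert (INR p <= 1) by (change 1 with (INR 1); apply le_INR; auto). nra. }
    destruct (St2 0%nat H5 Hn I) as [x3 [Hx3 Hz]]. apply (Up 0%nat x3); auto.
  - destruct (NEn n) as [Q1|Q1]; [|auto].
    assert (Hz := St1 n ltac:(lra) Q1 (Lo n ltac:(lra))).
    destruct (St2 (S n) ltac:(rewrite enS; lra) Hn Hz) as [x3 [Hx3 Hz']]. apply (Up (S n) x3); auto. }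
destruct (INR_unbounded ((E + M * eps ^ 2) / eps)) as [n Hn].
apply (Main n). apply (Rlt_div_l _ _ _ eps0) in Hn.
unfold en. rewrite plus_INR, mult_INR. assert (0 <= INR p) by apply pos_INR. simpl (INR 2). assert (0 <= INR n) by apply pos_INR. nra.
Qed.

End Quantization.

(** * Eigenvalues and the phase *)

Lemma Cnorm_sqr z : Cnorm z ^ 2 = Re z ^ 2 + Im z ^ 2.
Proof. unfold Cnorm. apply pow2_sqrt. assert (0 <= Re z ^ 2) by apply pow2_ge_0. assert (0 <= Im z ^ 2) by apply pow2_ge_0. lra. Qed.

Lemma phase_factor eps s : eps <> 0 ->
  Cexp (Cdiv (Cmul (RtoC 2) (Cmul Ci (RtoC s))) (RtoC eps)) = (cos (2 * s / eps), sin (2 * s / eps)).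
Proof.
intros H. set (z := Cdiv (Cmul (RtoC 2) (Cmul Ci (RtoC s))) (RtoC eps)).
assert (E1 : Re z = 0).
{ unfold z, Cdiv, Cinv, Cmul, RtoC, Ci, Re, Im; simpl. field. auto. }
assert (E2 : Im z = 2 * s / eps).
{ unfold z, Cdiv, Cinv, Cmul, RtoC, Ci, Re, Im; simpl. field. auto. }
unfold Cexp. rewrite E1, E2, exp_0, !Rmult_1_l. reflexivity.
Qed.

Lemma phase_inverse th z : Cmul z (cos th, sin th) = Cone <-> z = (cos th, - sin th).
Proof.
destruct z as [x y]. unfold Cmul, Cone, Re, Im; simpl. assert (S := sin2_cos2 th). unfold Rsqr in S. split; intros E.
- injection E; intros E2 E1.
  f_equal.
  + transitivity (x * (sin th * sin th + cos th * cos th)); [rewrite S; ring|].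
    transitivity (cos th * (x * cos th - y * sin th) + sin th * (x * sin th + y * cos th)); [ring|]. rewrite E1, E2; ring.
  + transitivity (y * (sin th * sin th + cos th * cos th)); [rewrite S; ring|].
    transitivity (cos th * (x * sin th + y * cos th) - sin th * (x * cos th - y * sin th)); [ring|]. rewrite E1, E2; ring.
- injection E; intros -> ->. f_equal; [|ring]. rewrite <- S. ring.
Qed.

Lemma sin_abs_le x : Rabs (sin x) <= Rabs x.
Proof.
assert (W : forall y, 0 <= y -> Rabs (sin y) <= y).
{ intros y Hy. assert (B := mvt_bound sin cos 0 y 1). rewrite sin_0, !Rminus_0_r, Rmult_1_l in B. apply B; auto.
  - intros z _; apply continuous_pt, continuity_sin.
  - intros z _; apply is_derive_Reals, derivable_pt_lim_sin.
  - intros z _; apply Rabs_le, COS_bound. }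
destruct (Rle_lt_dec 0 x) as [H|H].
- rewrite (Rabs_pos_eq x); auto.
- rewrite <- (Rabs_Ropp (sin x)), <- sin_neg, <- (Rabs_Ropp x), (Rabs_pos_eq (- x)) by lra. apply W; lra.
Qed.

(** With [d] the offset of [th] from an odd multiple of [PI], the left side is the chord length
    [2 * |sin (d / 2)|]. *)
Lemma phase_near_minus_one th (k : nat) : Cnorm (Cadd (cos th, - sin th) Cone) <= Rabs (th - PI * (2 * INR k + 1)).
Proof.
set (d := th - PI * (2 * INR k + 1)).
assert (Ec : cos th = - cos d).
{ replace th with (d + PI + 2 * INR k * PI) by (unfold d; ring). rewrite cos_period. apply neg_cos. }
assert (Es : cos d = 1 - 2 * (sin (d / 2) * sin (d / 2))).
{ replace d with (2 * (d / 2)) at 1 by field. rewrite cos_2a_sin. ring. }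
unfold Cnorm, Cadd, Cone, Re, Im; simpl.
replace ((cos th + 1) * ((cos th + 1) * 1) + (- sin th + 0) * ((- sin th + 0) * 1))
  with (2 + 2 * cos th) by (assert (S := sin2_cos2 th); unfold Rsqr in S; lra || nra).
rewrite Ec, Es. replace (2 + 2 * - (1 - 2 * (sin (d / 2) * sin (d / 2)))) with ((2 * sin (d / 2)) ^ 2) by ring.
replace ((2 * sin (d / 2)) ^ 2) with (Rsqr (2 * sin (d / 2))) by (unfold Rsqr; ring).
rewrite sqrt_Rsqr_abs, Rabs_mult, (Rabs_pos_eq 2) by lra.
assert (B := sin_abs_le (d / 2)). unfold Rdiv at 2 in B. rewrite Rabs_mult, (Rabs_pos_eq (/ 2)) in B by lra. lra.
Qed.

(* The real and imaginary parts of an eigenfunction separately solve the same real system. *)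
Lemma eigenfunction_real (A : R -> R) (eps mu : R) : 0 < eps ->
  is_eigenvalue A eps (Cmul Ci (RtoC mu)) ->
  exists u1 u2 : R -> R,
    (forall x, is_derive u1 x ((mu * u1 x + A x * u2 x) / eps)) /\
    (forall x, is_derive u2 x (- (A x * u1 x + mu * u2 x) / eps)) /\
    (exists x, u1 x <> 0 \/ u2 x <> 0) /\
    (exists M, forall a, 0 <= a -> RInt (fun x => u1 x ^ 2 + u2 x ^ 2) (- a) a <= M).
Proof.
intros He [u1 [u2 [u1' [u2' [Hd [Heq [[M HM] [x0 Hx0]]]]]]]].
assert (Eqs : forall x, eps * Re (u1' x) = mu * Re (u1 x) + A x * Re (u2 x) /\
   eps * Im (u1' x) = mu * Im (u1 x) + A x * Im (u2 x) /\
   eps * Re (u2' x) = - (A x * Re (u1 x) + mu * Re (u2 x)) /\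
   eps * Im (u2' x) = - (A x * Im (u1 x) + mu * Im (u2 x))).
{ intros x. destruct (Heq x) as [E1 E2].
  unfold Cadd, Cmul, Copp, Cdiv, Cinv, RtoC, Ci, Re, Im in E1, E2; simpl in E1, E2.
  unfold Re, Im.
  replace (0 * (0 * 1) + 1 * (1 * 1)) with 1 in E1, E2 by ring.
  injection E1; intros F1 F2. injection E2; intros F3 F4. unfold Rdiv in *. rewrite Rinv_1 in *. lra. }
assert (Key : forall pr : Cplx -> R, (pr = Re \/ pr = Im) -> (pr (u1 x0) <> 0 \/ pr (u2 x0) <> 0) ->
  exists u1 u2 : R -> R,
    (forall x, is_derive u1 x ((mu * u1 x + A x * u2 x) / eps)) /\
    (forall x, is_derive u2 x (- (A x * u1 x + mu * u2 x) / eps)) /\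
    (exists x, u1 x <> 0 \/ u2 x <> 0) /\
    (exists M, forall a, 0 <= a -> RInt (fun x => u1 x ^ 2 + u2 x ^ 2) (- a) a <= M)).
{ intros pr Hpr N. exists (fun x => pr (u1 x)), (fun x => pr (u2 x)).
  assert (D1 : forall x, is_derive (fun x => pr (u1 x)) x ((mu * pr (u1 x) + A x * pr (u2 x)) / eps)).
  { intros x. destruct (Hd x) as [[R1 I1] _]. destruct (Eqs x) as [Q1 [Q2 _]].
    destruct Hpr as [->| ->]; apply is_derive_Reals.
    - rewrite <- Q1. replace (eps * Re (u1' x) / eps) with (Re (u1' x)) by (field; lra). exact R1.
    - rewrite <- Q2. replace (eps * Im (u1' x) / eps) with (Im (u1' x)) by (field; lra). exact I1. }
  assert (D2 : forall x, is_derive (fun x => pr (u2 x)) x (- (A x * pr (u1 x) + mu * pr (u2 x)) / eps)).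
  { intros x. destruct (Hd x) as [_ [R1 I1]]. destruct (Eqs x) as [_ [_ [Q1 Q2]]].
    destruct Hpr as [->| ->]; apply is_derive_Reals.
    - rewrite <- Q1. replace (eps * Re (u2' x) / eps) with (Re (u2' x)) by (field; lra). exact R1.
    - rewrite <- Q2. replace (eps * Im (u2' x) / eps) with (Im (u2' x)) by (field; lra). exact I1. }
  refine (conj D1 (conj D2 (conj _ _))).
  - exists x0; auto.
  - exists M. intros a Ha. destruct (HM a Ha) as [prf Hprf]. rewrite <- RInt_Reals in Hprf.
    eapply Rle_trans; [|apply Hprf]. apply RInt_le; [lra| | |].
    + apply rint_ex. intros x.
      apply (continuous_plus (fun x => pr (u1 x) ^ 2) (fun x => pr (u2 x) ^ 2)).
      * apply (continuous_comp (fun x => pr (u1 x)) (fun y => y ^ 2)); [eapply is_derive_continuous, D1|].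
        apply is_derive_continuous with (2 * pr (u1 x)). auto_derive; auto; ring.
      * apply (continuous_comp (fun x => pr (u2 x)) (fun y => y ^ 2)); [eapply is_derive_continuous, D2|].
        apply is_derive_continuous with (2 * pr (u2 x)). auto_derive; auto; ring.
    + apply ex_RInt_Reals_1; auto.
    + intros x _. rewrite !Cnorm_sqr.
      assert (P1 := pow2_ge_0 (Re (u1 x))). assert (P2 := pow2_ge_0 (Im (u1 x))).
      assert (P3 := pow2_ge_0 (Re (u2 x))). assert (P4 := pow2_ge_0 (Im (u2 x))).
      destruct Hpr as [->| ->]; lra. }
assert (NZ : forall z : Cplx, z <> Czero -> Re z <> 0 \/ Im z <> 0).
{ intros [x y] N. unfold Re, Im; simpl. destruct (Req_dec x 0) as [->|]; auto. right. intros ->. apply N. reflexivity. }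
destruct Hx0 as [N|N]; apply NZ in N; destruct N as [N|N]; [apply (Key Re)|apply (Key Im)|apply (Key Re)|apply (Key Im)]; auto.
Qed.

Section Profile.

Variable A : R -> R.
Hypothesis HA1 : hypA1 A.
Hypothesis HA2 : hypA2 A.
Hypothesis HA3 : hypA3 A.

Lemma profile_decay a : 0 < a -> exists x, 0 < x /\ A x < a.
Proof.
intros Ha. destruct HA1 as [_ [_ [rho [theta [tau [r0 [_ [_ [t0 [F [_ [FA [K [R0 [R00 B]]]]]]]]]]]]]]].
(* [x >= 1] and [x > Rabs K / a] give [K * x^(-1 - tau) <= Rabs K / x < a]; [x >= R0] makes the
   decay estimate available. *)
set (x := Rmax R0 1 + Rabs K / a).
assert (Ka : 0 <= Rabs K / a) by (apply Rmult_le_pos; [apply Rabs_pos|left; apply Rinv_0_lt_compat; auto]).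
assert (M1 := Rmax_l R0 1). assert (M2 := Rmax_r R0 1).
assert (X1 : 1 <= x /\ R0 <= x /\ Rabs K / a < x) by (unfold x; lra).
assert (Nx : forall r, 0 <= r -> Cnorm (RtoC r) = r).
{ intros r Hr. unfold Cnorm, RtoC, Re, Im; simpl. replace (r * (r * 1) + 0 * (0 * 1)) with (r ^ 2) by ring. apply sqrt_pow2; auto. }
assert (A0 : 0 < A x) by apply HA1.
exists x; split; [lra|].
specialize (B (RtoC x)). rewrite FA, !Nx in B by lra.
assert (Q : A x <= K * Rpower x (- 1 - tau)).
{ apply B; [|lra]. unfold Dom, RtoC, Re, Im; simpl. rewrite Rabs_R0. eapply Rlt_le_trans; [apply r0|apply Rmax_l]. }
assert (P0 : 0 < Rpower x (- 1 - tau)) by apply exp_pos.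
assert (P1 : Rpower x (- 1 - tau) <= / x).
{ rewrite <- (Rpower_1 x) at 2 by lra. rewrite <- Rpower_Ropp. apply Rle_Rpower; lra. }
apply Rle_lt_trans with (Rabs K * / x).
- eapply Rle_trans; [apply Q|]. eapply Rle_trans; [apply Rmult_le_compat_r; [lra|apply Rle_abs]|].
  apply Rmult_le_compat_l; auto. apply Rabs_pos.
- apply Rlt_div_l; [lra|]. destruct X1 as [_ [_ X1]]. apply (Rlt_div_l _ _ _ Ha) in X1. lra.
Qed.

(** The phase [2 * s / eps] is [PI / eps] times [4 / PI * half_action], so an error [M * eps^2] in
    the quantized level becomes an error [PI * M * eps] in the phase. *)
Lemma eigenvalue_phase a : 0 < a -> exists K eps0, 0 <= K /\ 0 < eps0 /\
  forall eps mu s, 0 < eps < eps0 -> a <= mu -> S_is A mu s -> is_eigenvalue A eps (Cmul Ci (RtoC mu)) ->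
  Cnorm (Cadd (cos (2 * s / eps), - sin (2 * s / eps)) Cone) <= K * eps.
Proof.
intros Ha. destruct HA1 as [Apos [[Dn [D0 HD]] _]]. destruct HA2 as [Aeven HDn].
assert (Adecr : forall x, 0 < x -> Dn 1%nat x < 0) by (apply HDn; split; auto).
assert (A20 : Dn 2%nat 0 < 0) by (apply HA3; split; auto).
assert (DD : forall n x, is_derive (Dn n) x (Dn (S n) x)) by (intros; apply is_derive_Reals, HD).
assert (DA : forall x, is_derive A x (Dn 1%nat x)) by (intros x; rewrite <- D0; apply DD).
destruct (quantization A (Dn 1%nat) (Dn 2%nat) (Dn 3%nat) (Dn 4%nat) (Dn 5%nat) DA (DD _) (DD _) (DD _) (DD _) Apos Aeven Adecr A20 profile_decay a Ha)
  as [M [eps0 [M0 [e0 Q]]]].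
assert (PI0 := PI_RGT_0).
exists (PI * M), eps0. split; [apply Rmult_le_pos; lra|]. split; auto.
intros eps mu s He Hmu [xs [Hxs [Axs [pr Hpr]]]] Eig.
destruct (eigenfunction_real A eps mu ltac:(lra) Eig) as [u1 [u2 [U1 [U2 [U3 U4]]]]].
destruct (Q eps mu xs u1 u2 He Hmu Hxs Axs U1 U2 U3 U4) as [k Hk].
assert (Cq : forall x, continuous (fun x => sqrt (Rabs (A x ^ 2 - A xs ^ 2))) x).
{ intros u. apply (continuous_comp (fun x => Rabs (A x ^ 2 - A xs ^ 2)) sqrt); [|apply continuous_sqrt].
  apply (continuous_comp (fun x => A x ^ 2 - A xs ^ 2) Rabs); [|apply continuous_pt, Rcontinuity_abs].
  apply (ex_derive_continuous (fun x => A x ^ 2 - A xs ^ 2)). auto_derive. exists (Dn 1%nat u); apply DA. }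
set (q := fun x => sqrt (Rabs (A x ^ 2 - A xs ^ 2))) in *.
assert (Es : s = 2 * half_action A xs).
{ rewrite <- Hpr, <- RInt_Reals.
  transitivity (RInt q (- xs) xs).
  - apply RInt_ext. rewrite Rmin_left, Rmax_right by lra. intros x Hx. unfold q. rewrite Axs. f_equal.
    rewrite Rabs_pos_eq; auto. rewrite <- Axs.
    assert (L : forall y, 0 <= y < xs -> A xs < A y).
    { intros y Hy. apply (A_decr A (Dn 1%nat) DA Adecr); auto. }
    assert (Ax : A xs < A x) by (destruct (Rle_lt_dec 0 x); [apply L; lra|rewrite <- (Ropp_involutive x), Aeven; apply L; lra]). nra.
  - rewrite (rint_chasles q Cq (- xs) 0 xs). unfold half_action. fold q.
    (* As a function of the upper limit, this sum has zero derivative because [q] is even. *)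
    assert (G : RInt q 0 xs + RInt q 0 (- xs) = 0).
    { assert (DG : forall x, is_derive (fun x => RInt q 0 x + RInt q 0 (- x)) x 0).
      { intros x. evar_last.
        - apply (is_derive_plus (fun x => RInt q 0 x) (fun x => RInt q 0 (- x))); [apply rint_derive, Cq|].
          apply (is_derive_comp (fun x => RInt q 0 x) Ropp x (q (- x)) (-1)); [apply rint_derive, Cq|auto_derive; auto; ring].
        - unfold plus, scal; simpl; unfold mult; simpl. unfold q. rewrite Aeven. ring. }
      assert (B := mvt_bound (fun x => RInt q 0 x + RInt q 0 (- x)) (fun _ => 0) 0 xs 0 Hxs). cbv beta in B.
      rewrite Ropp_0, (@RInt_point R_CompleteNormedModule) in B. change zero with 0 in B.
      assert (Z : Rabs (RInt q 0 xs + RInt q 0 (- xs) - (0 + 0)) <= 0 * (xs - 0)).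
      { apply B; intros; [apply (is_derive_continuous _ _ 0), DG|apply DG|rewrite Rabs_R0; lra]. }
      rewrite Rmult_0_l in Z. assert (P := Rabs_pos (RInt q 0 xs + RInt q 0 (- xs) - (0 + 0))).
      assert (E0 : Rabs (RInt q 0 xs + RInt q 0 (- xs) - (0 + 0)) = 0) by lra.
      apply Rabs_eq_0 in E0. lra. }
    assert (Op : RInt q (- xs) 0 = - RInt q 0 (- xs)).
    { assert (Z := rint_chasles q Cq 0 (- xs) 0). rewrite (@RInt_point R_CompleteNormedModule) in Z. change zero with 0 in Z. lra. }
    change (RInt q (- xs) 0 + RInt q 0 xs = 2 * RInt q 0 xs). lra. }
eapply Rle_trans; [apply (phase_near_minus_one _ k)|].
replace (2 * s / eps - PI * (2 * INR k + 1)) with (PI / eps * (4 / PI * half_action A xs - eps * (2 * INR k + 1))) by (rewrite Es; field; lra).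
rewrite Rabs_mult, (Rabs_pos_eq (PI / eps)) by (left; apply Rdiv_lt_0_compat; lra).
apply Rle_trans with (PI / eps * (M * eps ^ 2)).
- apply Rmult_le_compat_l; auto. left; apply Rdiv_lt_0_compat; lra.
- right; field; lra.
Qed.

(** The phase factor depends on [mu] and [eps] alone, while its equation is required for every value
    [s] of the action. *)
Lemma S_is_unique mu s s' : S_is A mu s -> S_is A mu s' -> s = s'.
Proof.
destruct HA1 as [Apos [[Dn [D0 HD]] _]]. destruct HA2 as [Aeven HDn].
assert (Adecr : forall x, 0 < x -> Dn 1%nat x < 0) by (apply HDn; split; auto).
assert (DA : forall x, is_derive A x (Dn 1%nat x)) by (intros x; rewrite <- D0; apply is_derive_Reals, HD).
intros [xs [X0 [X1 [pr E]]]] [xs' [X0' [X1' [pr' E']]]].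
assert (Q : xs = xs').
{ destruct (Rtotal_order xs xs') as [L|[L|L]]; auto; exfalso.
  - assert (Z := A_decr A (Dn 1%nat) DA Adecr xs xs' ltac:(lra)). lra.
  - assert (Z := A_decr A (Dn 1%nat) DA Adecr xs' xs ltac:(lra)). lra. }
subst xs'. rewrite <- E, <- E'. apply RiemannInt_P5.
Qed.

End Profile.

(** * Choice of the phase factor *)

Theorem theorem2p2 (A : R -> R) :
  hypA1 A -> hypA2 A -> hypA3 A ->
  exists m : R -> R -> Cplx,
    (* m(mu,eps) = -1 + O(eps), uniformly on closed I = [a,b] in (0, A(0)] *)
    (forall a b : R, 0 < a -> a <= b -> b <= A 0 ->
       exists K eps0 : R, 0 < eps0 /\
         forall eps mu, 0 < eps -> eps < eps0 -> a <= mu <= b ->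
           Cnorm (Cadd (m mu eps) Cone) <= K * eps) /\
    (* characterization of eigenvalues i*mu *)
    (forall eps mu s : R, 0 < eps -> 0 < mu -> mu <= A 0 -> S_is A mu s ->
       (is_eigenvalue A eps (Cmul Ci (RtoC mu)) <->
        Cmul (m mu eps) (Cexp (Cdiv (Cmul (RtoC 2) (Cmul Ci (RtoC s))) (RtoC eps))) = Cone)).
Proof.
intros HA1 HA2 HA3.
set (eig := fun mu eps => is_eigenvalue A eps (Cmul Ci (RtoC mu))).
set (e := fun s eps : R => (cos (2 * s / eps), sin (2 * s / eps))).
(* Either [z] is within [eps] of [-1] by construction, or it is forced by an eigenvalue, and then
   the quantization controls it. The guard [0 < eps] leaves the value arbitrary for other [eps]. *)
assert (Pt : forall mu eps, exists z : Cplx, 0 < eps ->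
  (forall s, S_is A mu s -> (eig mu eps <-> Cmul z (e s eps) = Cone)) /\
  (Cnorm (Cadd z Cone) <= eps \/
   exists s, S_is A mu s /\ eig mu eps /\ z = (cos (2 * s / eps), - sin (2 * s / eps)))).
{ intros mu eps. destruct (Rlt_le_dec 0 eps) as [He|He]; [|exists Cone; intros; lra].
  assert (Nm : forall y, Cnorm (Cadd (-1 + y, 0) Cone) = Rabs y).
  { intros y. unfold Cnorm, Cadd, Cone, Re, Im; simpl.
    replace ((-1 + y + 1) * ((-1 + y + 1) * 1) + (0 + 0) * ((0 + 0) * 1)) with (Rsqr y) by (unfold Rsqr; ring). apply sqrt_Rsqr_abs. }
  destruct (classic (exists s, S_is A mu s)) as [[s Hs]|N].
  2:{ exists (-1 + 0, 0). intros _; split; [intros s Hs; exfalso; apply N; exists s; auto|].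
      left; rewrite Nm, Rabs_R0; lra. }
  assert (U : forall s', S_is A mu s' -> s' = s) by (intros s' Hs'; apply (S_is_unique A HA1 HA2 mu); auto).
  destruct (classic (eig mu eps)) as [Eg|NEg].
  - exists (cos (2 * s / eps), - sin (2 * s / eps)). intros _; split.
    + intros s' Hs'; rewrite (U s' Hs'). split; auto. intros _; apply phase_inverse; auto.
    + right; exists s; auto.
  - (* not an eigenvalue: perturb [-1] if it happens to satisfy the equation *)
    destruct (Req_dec (cos (2 * s / eps)) (-1)) as [E1|E1].
    + exists (-1 + eps, 0). intros _; split; [|left; rewrite Nm, Rabs_pos_eq; lra].
      intros s' Hs'; rewrite (U s' Hs'). split; [intros; contradiction|]. intros Z. apply phase_inverse in Z.
      injection Z; intros _ Z1. lra.
    + exists (-1 + 0, 0). intros _; split; [|left; rewrite Nm, Rabs_R0; lra].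
      intros s' Hs'; rewrite (U s' Hs'). split; [intros; contradiction|]. intros Z. apply phase_inverse in Z.
      injection Z; intros _ Z1. lra. }
exists (fun mu eps => proj1_sig (constructive_indefinite_description _ (Pt mu eps))). split.
- intros a b Ha Hab Hb. destruct (eigenvalue_phase A HA1 HA2 HA3 a Ha) as [K [eps0 [K0 [e0 HK]]]].
  exists (K + 1), eps0. split; auto. intros eps mu He He0 Hmu.
  destruct (constructive_indefinite_description _ (Pt mu eps)) as [z Hz]; simpl.
  destruct (Hz He) as [_ [B|[s [Hs [Eg ->]]]]].
  + eapply Rle_trans; [apply B|]. nra.
  + apply Rle_trans with (K * eps); [|nra]. apply (HK eps mu s); auto; lra.
- intros eps mu s He Hmu HmuA Hs. rewrite phase_factor by lra.
  destruct (constructive_indefinite_description _ (Pt mu eps)) as [z Hz]; simpl.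
  destruct (Hz He) as [E _]. apply E; auto.
Qed.
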